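(* Let $\overline\nu$ be a partition of $d$, with largest part $\nu_2$. Then there exists a polynomial $k_{\overline\nu}(x_C)$ with rational coefficients in the variables $x_C$, where $C$ runs over the set of connected diagram classes of size $1\le |C|\le d$, such that, for all $n\ge d+\nu_2$ and all partitions $\lambda$ of $n$, the Kronecker coefficient ${\sf g}(\lambda,\lambda,(n-d,\overline\nu))$ is obtained from $k_{\overline\nu}(x_C)$ by evaluating each $x_C$ at ${\sf r}_\lambda(C)$, that is, $$ {\sf g}(\lambda,\lambda,(n-d,\overline\nu)) = k_{\overline\nu}({\sf r}_\lambda(C)). $$
   Context: For partitions $\lambda,\mu,\nu$ of $n$, ${\sf g}(\lambda,\mu,\nu)=\langle\chi^\lambda\otimes\chi^\mu,\chi^\nu\rangle$ is the Kronecker coefficient, where $\chi^\lambda$ is the irreducible character of the symmetric group ${\sf S}_n$ attached to $\lambda$ and $\otimes$ is the pointwise product of characters. For a partition $\overline\nu=(\nu_2,\dots,\nu_r)$ of $d$ and $n\ge d+\nu_2$, $(n-d,\overline\nu)$ is the partition $(n-d,\nu_2,\dots,\nu_r)$ of $n$ (with $\nu_2=0$ if $\overline\nu$ is empty). A partition $\lambda$ is identified with its diagram $\{(i,j)\mid 1\le i\le \ell(\lambda),\ 1\le j\le\lambda_i\}\subset\mathbb N\times\mathbb N$ ($\mathbb N$ the positive integers, elements are called squares). If $\alpha\subseteq\lambda$ are partitions, the skew diagram $\lambda/\alpha$ is the set of squares of $\lambda$ not in $\alpha$. Squares are adjacent if they share an edge; connectedness and connected components of skew diagrams refer to this (connected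 diagrams are nonempty). Two skew diagrams $\rho,\sigma$ are isomorphic if there is a bijection between their sets of connected components such that corresponding components are translates of one another. A diagram class is an isomorphism class $D=[\sigma]$ of skew diagrams; its size is $|D|=|\sigma|$ (number of squares), and $D$ is connected if $\sigma$ is. For a partition $\lambda$ and a diagram class $D$, ${\sf r}_\lambda(D)$ is the number of $\lambda$-removable diagrams in $D$, i.e. the number of partitions $\alpha\subseteq\lambda$ such that $\lambda/\alpha$ belongs to $D$. *)

(* Defs.v *)
From HB Require Import structures.
From mathcomp Require Import all_boot all_order all_algebra all_fingroup.
From mathcomp Require Import all_solvable all_field all_character.
From mathcomp Require Import finmap.
From mathcomp Require Import mathcomp_extra boolp classical_sets functions.
From mathcomp.multinomials Require Import monalg.

Set Implicit Arguments.
Unset Strict Implicit.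
Unset Printing Implicit Defensive.

Import Order.TTheory GRing.Theory Num.Theory GroupScope.
Local Open Scope nat_scope.

(** * Partitions and diagrams *)

Definition is_part (la : seq nat) : bool := sorted geq la && (0 \notin la).

Definition is_part_of (n : nat) (la : seq nat) : bool :=
  is_part la && (sumn la == n).

Definition conj_part (la : seq nat) : seq nat :=
  mkseq (fun j => count (fun p => j < p) la) (head 0 la).

(* Partitions have positive parts, so the first part is dropped when it is 0;
   for n >= d + nu_2 this only happens when n = d = 0. *)
Definition add_first_row (n d : nat) (nubar : seq nat) : seq nat :=
  if n - d == 0 then nubar else (n - d) :: nubar.

Notation square := (nat * nat)%type.

(* Rows and columns are numbered from 1. *)
Definition diagram (la : seq nat) : {fset square} :=
  [fset x in [seq (i, j) | i <- iota 1 (size la),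
                           j <- iota 1 (nth 0 la i.-1)]]%fset.

Definition skew_diagram (la al : seq nat) : {fset square} :=
  (diagram la `\` diagram al)%fset.

Definition is_skew (s : {fset square}) : Prop :=
  exists la al : seq nat,
    [/\ is_part la, is_part al, (diagram al `<=` diagram la)%fset
      & s = skew_diagram la al].

(** * Connected components, isomorphism and diagram classes *)

Definition adjacent : rel square := fun x y =>
  (x.1 == y.1) && ((x.2 == y.2.+1) || (y.2 == x.2.+1)) ||
  (x.2 == y.2) && ((x.1 == y.1.+1) || (y.1 == x.1.+1)).

Definition linked (s : {fset square}) : rel s :=
  connect (fun x y : s => adjacent (val x) (val y)).

Definition component (s : {fset square}) (x : s) : {fset square} :=
  [fset val y | y in [pred y : s | linked x y]]%fset.

Definition components (s : {fset square}) : set {fset square} :=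
  range (@component s).

Definition is_connected (s : {fset square}) : Prop :=
  s != fset0 /\ forall x y : s, linked x y.

Definition shift (v : int * int) (s : {fset square}) : {fset int * int} :=
  [fset (Posz x.1 + v.1, Posz x.2 + v.2)%R | x in s]%fset.

Definition translate (s t : {fset square}) : Prop :=
  exists v : int * int, shift v s = shift (0, 0)%R t.

Definition skew_iso (s t : {fset square}) : Prop :=
  exists f : {fset square} -> {fset square},
    set_bij (components s) (components t) f /\
    forall c, components s c -> translate c (f c).

Definition diagram_class_of (s : {fset square}) : set {fset square} :=
  [set t | is_skew t /\ skew_iso s t]%classic.

(* Size and connectedness do not depend on the representative. *)
Definition is_conn_class (d : nat) (D : set {fset square}) : Prop :=
  exists s : {fset square},
    [/\ is_skew s, is_connected s, 1 <= #|` s| <= d & D = diagram_class_of s].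

Definition conn_class (d : nat) : choiceType :=
  {D : set {fset square} | `[< is_conn_class d D >]}.

(* A partition al contained in la has at most [size la] parts, each at most
   [head 0 la], so al ranges over a finite type of bounded sequences. *)
Definition removable (la : seq nat) (D : set {fset square}) : nat :=
  #|[set a : {bseq size la of 'I_(head 0 la).+1} |
      let al := [seq nat_of_ord x | x <- a] in
      [&& is_part al, (diagram al `<=` diagram la)%fset
        & `[< D (skew_diagram la al) >] ] ]|.

(** * Characters of the symmetric group *)

Section SymmetricCharacters.
Variable n : nat.
Local Notation Sn := [set: 'S_n].

(* [reshape_index la i] is the index of the block containing i when
   {0, ..., n-1} is cut into consecutive blocks of sizes la_1, la_2, ... *)
Definition young_set (la : seq nat) : {set 'S_n} :=
  [set s : 'S_n | [forall i, reshape_index la (s i) == reshape_index la i]].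

Fact young_group_set la : group_set (young_set la).
Proof.
apply/group_setP; split.
  by rewrite inE; apply/forallP=> i; rewrite perm1.
move=> s t; rewrite !inE => /forallP hs /forallP ht; apply/forallP=> i.
by rewrite permM (eqP (ht _)) (eqP (hs _)).
Qed.
Canonical young_group la := Group (young_group_set la).

Fact sign_class_fun :
  is_class_fun <<Sn>> [ffun s : 'S_n => (-1) ^+ odd_perm s : algC]%R.
Proof.
rewrite genGid; apply: intro_class_fun => [s t _ _|s]; last by rewrite inE.
by rewrite odd_permJ.
Qed.
Definition sign_cfun : 'CF(Sn) := Cfun 0 sign_class_fun.

Definition ind_triv (la : seq nat) : 'CF(Sn) := ('Ind[Sn, young_group la] 1)%R.

Definition ind_sign (la : seq nat) : 'CF(Sn) :=
  ('Ind[Sn, young_group la] ('Res[young_group la] sign_cfun))%R.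

(* chi^la is the unique common irreducible constituent of Ind 1 from the Young
   subgroup of la and Ind sgn from that of the conjugate partition
   (James-Kerber, The Representation Theory of the Symmetric Group, 2.1.11). *)
Definition sym_char (la : seq nat) : 'CF(Sn) :=
  if [pick i : Iirr Sn | (i \in irr_constt (ind_triv la)) &&
                         (i \in irr_constt (ind_sign (conj_part la)))]
  is Some i then ('chi_i)%R else 0%R.

Definition kronecker (la mu nu : seq nat) : algC :=
  '[sym_char la * sym_char mu, sym_char nu]%R.

End SymmetricCharacters.

(** * Polynomials in arbitrarily many variables

    [{malg rat[{cmonom I}]}] is the monoid algebra of the free commutative
    monoid on I, i.e. the polynomial ring over rat in the variables x_i. *)

Definition cmonom_eval (I : choiceType) (v : I -> rat) (m : {cmonom I}) : rat :=
  (\prod_(i <- finsupp m) v i ^+ m i)%R.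

Definition poly_eval (I : choiceType) (v : I -> rat)
    (p : {malg rat[{cmonom I}]}) : rat :=
  mmap idfun (cmonom_eval v) p.

(* Main.v *)
Require Import Defs.
From HB Require Import structures.
From mathcomp Require Import all_boot all_order all_algebra all_fingroup.
From mathcomp Require Import all_solvable all_field all_character.
From mathcomp Require Import finmap.
From mathcomp Require Import mathcomp_extra boolp classical_sets functions.
From mathcomp.multinomials Require Import monalg.
From mathcomp Require Import zify ring lra.

(** Write [nu = (n - d, nubar)]. By the Jacobi-Trudi formula the character of
    [nu] is a signed sum, over the permutations [w] of its rows, of permutation
    characters of Young subgroups. The parts below the first one do not involve
    [n], so each of these subgroups is the product of a symmetric group of degree
    [n - e], where [e <= d], and of a Young subgroup of ['S_e] that depends on
    [nubar] and [w] only. Pairing the square of the character of [la] with such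
    a permutation character amounts to restricting to this product. The
    restriction is the sum, over the partitions [al] of [n - e] inside [la], of
    the character of [al] times the skew character of [la / al]; orthonormality
    removes the mixed terms of the square and leaves a sum over the removable
    diagrams [la / al] of size [e] of a number that depends on their skew
    character only ([avg_psi_sqr_shapes]).

    A skew character is determined by its pairings with permutation characters
    ([psi_determined]), and these count the fillings of the diagram by
    horizontal strips ([kostka_fillings]). Fillings see only which squares lie
    to the right of or below which others, so the number attached to [la / al]
    is constant on diagram classes, and the Kronecker coefficient is a fixed
    linear combination of numbers of removable diagrams in classes of size at
    most [d].

    It remains to express the classes that are not connected through connected
    ones. The union of two removable diagrams is removable. Hence the product of
    the numbers for two classes is a combination of the numbers for the classes
    of the possible unions, and the only unions of the largest possible size are
    the disjoint ones, in which no square of one part is adjacent to the other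
    part. A disconnected diagram is such a disjoint union of two smaller ones,
    so its number is a polynomial in numbers for smaller classes
    ([filt_count_decomp], [filt_sum_poly]).

    The characters of the symmetric group are handled through colourings. The
    number [phi A s] of colourings of content [A] fixed by [s] is the value of a
    permutation character, and averages of products of such numbers count
    tables with given margins ([phiM], [avg_phi]). The determinants [psi] of
    these characters turn the remaining facts into signed counts of integer
    vectors: Pieri's rule is a sign-reversing exchange of two entries
    ([kostka_cons]), orthonormality follows from the dominance order
    ([psi_orthonormal]), and the uniqueness of the zero-one table with
    conjugate margins identifies [psi] with [sym_char] ([sym_charE]). *)

Set Implicit Arguments.
Unset Strict Implicit.
Unset Printing Implicit Defensive.

Import Order.TTheory GRing.Theory Num.Theory.
Local Open Scope nat_scope.

(** * Reindexing sums over sequences *)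

Lemma big_seq_surj (R : Type) (idx : R) (op : Monoid.com_law idx)
    (I J : eqType) (r : seq I) (r' : seq J) (P : pred I) (P' : pred J)
    (F : I -> R) (F' : J -> R) (h : I -> J) :
  uniq r -> uniq r' ->
  {in [seq i <- r | P i] &, injective h} ->
  (forall i, i \in r -> P i -> [/\ h i \in r', P' (h i) & F i = F' (h i)]) ->
  (forall j, j \in r' -> P' j -> exists i, [/\ i \in r, P i & h i = j]) ->
  \big[op/idx]_(i <- r | P i) F i = \big[op/idx]_(j <- r' | P' j) F' j.
Proof.
move=> ur ur' injh hP hP'.
rewrite -[LHS]big_filter -[RHS]big_filter.
have pe : perm_eq [seq h i | i <- [seq i <- r | P i]] [seq j <- r' | P' j].
  apply: uniq_perm; rewrite ?filter_uniq ?map_inj_in_uniq ?filter_uniq // => j.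
  apply/mapP/idP => [[i]|]; rewrite mem_filter => /andP[].
    by move=> Pi ri ->; rewrite mem_filter; case: (hP i ri Pi) => -> ->.
  move=> Pj rj; case: (hP' j rj Pj) => i [ri Pi <-].
  by exists i; rewrite ?mem_filter ?ri ?Pi.
rewrite -(perm_big _ pe) /= big_map !big_seq; apply: eq_bigr => i.
by rewrite mem_filter => /andP[Pi ri]; case: (hP i ri Pi).
Qed.

Lemma big_seq_bij (R : Type) (idx : R) (op : Monoid.com_law idx)
    (I J : eqType) (r : seq I) (r' : seq J) (P : pred I) (P' : pred J)
    (F : I -> R) (F' : J -> R) (h : I -> J) (h' : J -> I) :
  uniq r -> uniq r' ->
  (forall i, i \in r -> P i -> [/\ h i \in r', P' (h i), h' (h i) = i
                                 & F i = F' (h i)]) ->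
  (forall j, j \in r' -> P' j -> [/\ h' j \in r, P (h' j) & h (h' j) = j]) ->
  \big[op/idx]_(i <- r | P i) F i = \big[op/idx]_(j <- r' | P' j) F' j.
Proof.
move=> ur ur' hP hP'; apply: (@big_seq_surj _ _ _ _ _ _ _ _ _ _ _ h) => //.
- move=> i j; rewrite !mem_filter => /andP[Pi ri] /andP[Pj rj] e.
  by case: (hP i ri Pi) => _ _ <- _; case: (hP j rj Pj) => _ _ <- _; rewrite e.
- by move=> i ri Pi; case: (hP i ri Pi).
- by move=> j rj Pj; case: (hP' j rj Pj) => ? ? ?; exists (h' j).
Qed.

Lemma partition_big_seq (R : Type) (idx : R) (op : Monoid.com_law idx)
    (I J : eqType) (r : seq I) (r' : seq J) (P : pred I) (P' : pred J)
    (f : I -> J) (F : I -> R) :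
  uniq r' -> (forall i, i \in r -> P i -> P' (f i) -> f i \in r') ->
  \big[op/idx]_(i <- r | P i && P' (f i)) F i =
  \big[op/idx]_(j <- r' | P' j) \big[op/idx]_(i <- r | P i && (f i == j)) F i.
Proof.
move=> ur' fr'; rewrite big_mkcondr.
under [RHS]eq_bigr do rewrite big_mkcondr.
rewrite [RHS]exchange_big /= big_seq_cond [RHS]big_seq_cond.
apply: eq_bigr => i /andP[ir Pi]; rewrite big_mkcond; case: ifP => Pf.
  rewrite (bigD1_seq (f i)) ?fr' //= Pf eqxx big1 ?Monoid.mulm1 // => j.
  by rewrite eq_sym => /negbTE ->; case: ifP.
rewrite big1 // => j _; case: ifP => // P'j; case: eqP => // e.
by rewrite e P'j in Pf.
Qed.

(** * Colourings and their fixed-point counts *)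

Definition vecs (Q : finType) (b : nat) : seq {ffun Q -> nat} :=
  [seq [ffun q => nat_of_ord (f q)] | f : {ffun Q -> 'I_b}].

Lemma mem_vecs (Q : finType) b (A : {ffun Q -> nat}) :
  (A \in vecs Q b) = [forall q, A q < b].
Proof.
apply/mapP/forallP => [[f _ ->] q|h]; first by rewrite ffunE.
exists [ffun q => Ordinal (h q)]; first by rewrite mem_enum.
by apply/ffunP=> q; rewrite !ffunE.
Qed.

Lemma uniq_vecs (Q : finType) b : uniq (vecs Q b).
Proof.
rewrite map_inj_uniq ?enum_uniq // => f g /ffunP e.
by apply/ffunP=> q; apply/val_inj; have := e q; rewrite !ffunE.
Qed.

Definition wt (Q : finType) (A : {ffun Q -> nat}) : nat := \sum_q A q.

Lemma leq_wt (Q : finType) (A : {ffun Q -> nat}) q : A q <= wt A.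
Proof. by rewrite /wt (bigD1 q) //= leq_addr. Qed.

Lemma vecs_wt (Q : finType) (A : {ffun Q -> nat}) b :
  wt A < b -> A \in vecs Q b.
Proof.
move=> h; rewrite mem_vecs; apply/forallP=> q; exact: leq_ltn_trans (leq_wt A q) h.
Qed.

Section Colourings.
Variables (n : nat) (Q : finType).
Implicit Types (c : {ffun 'I_n -> Q}) (A : {ffun Q -> nat}) (s : 'S_n).

Definition content c : {ffun Q -> nat} := [ffun q => #|[set i | c i == q]|].
Definition recolour c s : {ffun 'I_n -> Q} := [ffun i => c (s i)].
Definition stabc c : {set 'S_n} := [set s | recolour c s == c].
(** For a colouring [b] of content [A], this is the character of the
    permutation action on the cosets of the Young subgroup [stabc b]. *)
Definition phi A s : nat :=
  #|[set c | (content c == A) && (recolour c s == c)]|.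

Lemma wt_content c : wt (content c) = n.
Proof.
rewrite /wt -[RHS]card_ord -sum1_card.
rewrite (partition_big (fun i => c i) predT) //=; apply: eq_bigr => q _.
by rewrite ffunE -sum1_card; apply: eq_bigl => i; rewrite inE.
Qed.

Lemma recolourM c s t : recolour c (s * t)%g = recolour (recolour c t) s.
Proof. by apply/ffunP=> i; rewrite !ffunE permM. Qed.

Lemma recolour1 c : recolour c 1%g = c.
Proof. by apply/ffunP=> i; rewrite !ffunE perm1. Qed.

Lemma content_recolour c s : content (recolour c s) = content c.
Proof.
apply/ffunP=> q; rewrite !ffunE -[RHS](card_preimset _ (@perm_inj _ s)).
by apply: eq_card => i; rewrite !inE ffunE.
Qed.

Lemma content_count c q : content c q = count_mem q [tuple c i | i < n].
Proof.
rewrite ffunE -sum1_card -sum1_count big_map big_enum_cond /=.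
by apply: eq_bigl => i; rewrite inE.
Qed.

Lemma recolour_trans c c' :
  content c = content c' -> exists s, recolour c s = c'.
Proof.
move=> e.
have : perm_eq [tuple c' i | i < n] [tuple c i | i < n].
  by apply/allP => q _ /=; rewrite -!content_count e.
move/tuple_permP => [s es]; exists s; apply/ffunP=> i; rewrite ffunE.
have := congr1 (fun t => nth (c' i) t i) es.
by rewrite -!tnth_nth !tnth_mktuple => ->.
Qed.

(** List every colour [q] exactly [A q] times and colour [i] by the [i]-th
    entry. *)
Lemma content_onto A : wt A = n -> exists c, content c = A.
Proof.
move=> wA; pose l := flatten [seq nseq (A q) q | q <- enum Q].
have sl : size l == n.
  rewrite size_flatten /shape -map_comp sumnE big_map big_enum /= -wA.
  by apply/eqP/eq_bigr => q _; rewrite size_nseq.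
exists [ffun i => tnth (Tuple sl) i]; apply/ffunP=> q.
rewrite content_count; under eq_mktuple do rewrite ffunE.
rewrite (_ : [tuple _ | _ < _] = Tuple sl); last first.
  by apply: eq_from_tnth => i; rewrite tnth_mktuple.
rewrite /= /l count_flatten -map_comp sumnE big_map big_enum /=.
rewrite (bigD1 q) //= big1 ?addn0 => [|q' nq]; rewrite count_nseq /= ?eqxx ?mul1n //.
by rewrite (negbTE nq).
Qed.

Lemma group_set_stabc c : group_set (stabc c).
Proof.
apply/group_setP; split=> [|s t]; rewrite !inE ?recolour1 // => /eqP hs /eqP ht.
by rewrite recolourM ht hs.
Qed.
Canonical stabc_group c := Group (group_set_stabc c).

(** Orbit-stabiliser: colourings of the same content form one orbit, and the
    permutations carrying [c] to [c'] are a coset of the stabiliser of [c]. *)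
Lemma card_transporter c c' :
  content c = content c' -> #|[set s | recolour c s == c']| = #|stabc c|.
Proof.
case/recolour_trans=> t <-; rewrite -(card_lcoset (stabc c) t).
apply: eq_card => s; rewrite mem_lcoset !inE recolourM.
apply/eqP/eqP => [->|e]; first by rewrite -recolourM mulVg recolour1.
by rewrite -[in RHS]e -recolourM mulgV recolour1.
Qed.

(** Grouping the [y] by the colouring [recolour c y]: [s ^ y] stabilises [c]
    exactly when [s] fixes that colouring. This is the value of the character
    induced from the trivial character of [stabc c]. *)
Lemma phi_ind A s c : content c = A ->
  #|[set y | (s ^ y)%g \in stabc c]| = (#|stabc c| * phi A s)%N.
Proof.
move=> cA.
have e y : ((s ^ y)%g \in stabc c) = (recolour (recolour c y) s == recolour c y).
  rewrite inE conjgE !recolourM; apply/eqP/eqP => [e|->].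
    by rewrite -[in RHS]e -[in RHS]recolourM mulgV recolour1.
  by rewrite -recolourM mulVg recolour1.
rewrite -sum1_card (partition_big (recolour c) (fun c' =>
  (content c' == A) && (recolour c' s == c'))) /=; last first.
  by move=> y; rewrite inE e content_recolour cA eqxx.
rewrite (eq_bigr (fun=> #|stabc c|)) => [|c' /andP[/eqP c'A fc']].
  by rewrite sum_nat_const mulnC; congr (_ * _); apply: eq_card => c'; rewrite inE.
rewrite -(@card_transporter c c') ?cA ?c'A // -sum1_card; apply: eq_bigl => y.
rewrite [X in X && _]inE e [RHS]inE; case: (recolour c y =P c') => [->|]; rewrite ?andbF //.
by rewrite fc'.
Qed.

End Colourings.

Section Averages.
Variables (n : nat) (Q : finType).
Implicit Types (c : {ffun 'I_n -> Q}) (A : {ffun Q -> nat}) (s : 'S_n).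

Lemma phi_eq0 A s : wt A != n -> phi A s = 0.
Proof.
move=> wA; apply: eq_card0 => c; rewrite inE; apply/negbTE.
by apply: contra wA => /andP[/eqP <- _]; rewrite wt_content.
Qed.

(** Burnside's double counting of pairs (permutation, fixed colouring), kept
    with a weight so that it applies to the sign character as well. *)
Lemma sum_phi_weighted (w : 'S_n -> rat) A :
  (\sum_s w s * (phi A s)%:R =
   \sum_(c : {ffun 'I_n -> Q} | content c == A) \sum_(s in stabc c) w s)%R.
Proof.
rewrite (exchange_big_dep predT) //=; apply: eq_bigr => s _.
rewrite (eq_bigl (fun c => (content c == A) && (recolour c s == c))); last first.
  by move=> c; rewrite inE.
rewrite sumr_const -[RHS]mulr_natr; congr (_ * _%:R)%R.
by apply: eq_card => c; rewrite inE.
Qed.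

Lemma sum_stabc A : wt A = n ->
  \sum_(c : {ffun 'I_n -> Q} | content c == A) #|stabc c| = n`!.
Proof.
case/content_onto=> b cb; rewrite -card_Sn -sum1_card.
rewrite (partition_big (recolour b) (fun c => content c == A)) => [|s _] /=; last first.
  by rewrite content_recolour cb.
apply: eq_bigr => c /eqP cc.
case: (@recolour_trans _ _ b c); first by rewrite cb cc.
move=> t <-; rewrite -(card_rcoset (stabc _) t) -sum1_card.
by apply: eq_bigl => s; rewrite mem_rcoset inE -recolourM mulgKV.
Qed.

Definition avg (f : 'S_n -> rat) : rat := (n`!%:R^-1 * \sum_s f s)%R.

Lemma eq_avg f g : f =1 g -> avg f = avg g.
Proof. by move=> e; congr (_ * _)%R; apply: eq_bigr => s _. Qed.

Lemma avg_sum (I : Type) (r : seq I) (P : pred I) (F : I -> 'S_n -> rat) :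
  avg (fun s => \sum_(i <- r | P i) F i s)%R = (\sum_(i <- r | P i) avg (F i))%R.
Proof. by rewrite /avg exchange_big -mulr_sumr. Qed.

Lemma avgZ a f : avg (fun s => a * f s)%R = (a * avg f)%R.
Proof. by rewrite /avg -mulr_sumr mulrCA. Qed.

Lemma fact_rat_neq0 m : (m`!%:R != 0 :> rat)%R.
Proof. by rewrite pnatr_eq0 -lt0n fact_gt0. Qed.

Lemma avg_phi A : wt A = n -> avg (fun s => (phi A s)%:R)%R = 1%R.
Proof.
move=> wA; rewrite /avg (eq_bigr (fun s => 1 * (phi A s)%:R)%R) => [|s _]; last by rewrite mul1r.
rewrite (sum_phi_weighted (fun=> 1%R)) (eq_bigr (fun c => #|stabc c|%:R%R)).
  by rewrite -natr_sum sum_stabc // mulVf ?fact_rat_neq0.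
by move=> c _; rewrite sumr_const.
Qed.

Definition sgn (s : 'S_n) : rat := ((-1) ^+ s)%R.

(** When two points share a colour, multiplication by their transposition is a
    sign-reversing bijection of the stabiliser; otherwise the stabiliser is
    trivial. *)
Lemma sum_sgn_stabc c :
  (\sum_(s in stabc c) sgn s =
   if [forall q, content c q <= 1]%N then #|stabc c|%:R else 0)%R.
Proof.
case: ifP => [/forallP h|/negbT]; last first.
  rewrite negb_forall => /existsP[q]; rewrite -ltnNge ffunE.
  case/card_gt1P=> i [j [+ + ij]]; rewrite !inE => /eqP ci /eqP cj.
  have tc : tperm i j \in stabc c.
    rewrite inE; apply/eqP/ffunP=> k; rewrite ffunE.
    by case: tpermP => [->|->|]; rewrite ?ci ?cj.
  (* Multiplication by [tperm i j] turns the sum into its opposite. *)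
  set S := (LHS); suff : S = (- S)%R by lra.
  rewrite {1}/S (reindex_inj (mulgI (tperm i j))) /= -sumrN.
  apply: eq_big => [s|s _]; first by rewrite groupMl.
  by rewrite /sgn odd_mul_tperm ij signr_addb mulN1r.
suff -> : stabc c = 1%g by rewrite big_set1 cards1 /sgn odd_perm1.
apply/setP=> s; rewrite !inE; apply/eqP/eqP => [/ffunP cs|->]; last exact: recolour1.
apply/permP=> i; rewrite perm1.
have := h (c i); rewrite ffunE => /card_le1_eqP; apply; rewrite !inE ?eqxx //.
by rewrite -[in eqbRHS](cs i) ffunE.
Qed.

Lemma avg_sgn_phi A : wt A = n ->
  avg (fun s => sgn s * (phi A s)%:R)%R = [forall q, A q <= 1]%N%:R%R.
Proof.
move=> wA; rewrite /avg sum_phi_weighted.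
rewrite (eq_bigr (fun c => [forall q, A q <= 1]%N%:R * #|stabc c|%:R)%R).
  by rewrite -mulr_sumr -natr_sum sum_stabc // mulrCA mulVf ?mulr1 ?fact_rat_neq0.
move=> c /eqP cA; rewrite sum_sgn_stabc cA; case: ifP => _; by rewrite ?mul1r ?mul0r.
Qed.

End Averages.

Section Products.
Variables (n : nat) (Q Q' : finType).
Implicit Types (A : {ffun Q -> nat}) (B : {ffun Q' -> nat}) (s : 'S_n).
Implicit Types (M : {ffun Q * Q' -> nat}).

Definition rowsums M : {ffun Q -> nat} := [ffun q => \sum_q' M (q, q')].
Definition colsums M : {ffun Q' -> nat} := [ffun q' => \sum_q M (q, q')].

Lemma wt_rowsums M : wt (rowsums M) = wt M.
Proof.
rewrite /wt (eq_bigr (fun p => M (p.1, p.2))) => [|[] //].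
by rewrite -(pair_bigA _ (fun q q' => M (q, q'))) /=; apply: eq_bigr => q _; rewrite ffunE.
Qed.

Lemma wt_colsums M : wt (colsums M) = wt M.
Proof.
rewrite /wt [RHS](eq_bigr (fun p => M (p.1, p.2))) => [|[] //].
rewrite -(pair_bigA _ (fun q q' => M (q, q'))) exchange_big /=.
by apply: eq_bigr => q _; rewrite ffunE.
Qed.

Lemma phi_relabel (h : Q -> Q') (B : {ffun Q' -> nat}) s : bijective h ->
  phi [ffun q => B (h q)] s = phi B s.
Proof.
case=> h' hK h'K; rewrite /phi.
pose H (c : {ffun 'I_n -> Q}) := [ffun i => h (c i)].
have injH : injective H.
  by move=> c c' /ffunP e; apply/ffunP=> i; have := e i; rewrite !ffunE => /(can_inj hK).
rewrite -(card_imset _ injH); apply: eq_card => c'; rewrite !inE.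
apply/imsetP/andP => [[c]|[/eqP cB /eqP fc]].
  rewrite inE => /andP[/eqP /ffunP e /eqP f] ->; split.
    apply/eqP/ffunP=> q; have := e (h' q); rewrite !ffunE h'K => <-.
    by apply: eq_card => i; rewrite !inE ffunE (can2_eq hK h'K).
  by apply/eqP/ffunP=> i; rewrite !ffunE -{2}f ffunE.
exists [ffun i => h' (c' i)]; last by apply/ffunP=> i; rewrite !ffunE h'K.
rewrite inE; apply/andP; split; apply/eqP/ffunP=> i; rewrite !ffunE; last first.
  by rewrite -{2}fc ffunE.
rewrite -cB ffunE; apply: eq_card => j; rewrite !inE ffunE.
by rewrite (can2_eq h'K hK).
Qed.

(** A pair of colourings is one colouring by pairs of colours, so a product of
    permutation characters is a sum of permutation characters over the tables
    with the prescribed margins. Entries of such a table are at most [n], hence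
    the bound [n.+1] on the range of summation. *)
Lemma phiM A B s :
  (phi A s * phi B s)%N =
  \sum_(M <- vecs (Q * Q')%type n.+1 | (rowsums M == A) && (colsums M == B)) phi M s.
Proof.
pose pr (c : {ffun 'I_n -> Q * Q'}) := ([ffun i => (c i).1], [ffun i => (c i).2]).
have injp : injective pr.
  move=> c d [/ffunP e1 /ffunP e2]; apply/ffunP=> i.
  move: (e1 i) (e2 i); rewrite !ffunE.
  by case: (c i) (d i) => a b [a' b'] /= -> ->.
have rs c : rowsums (content c) = content (pr c).1.
  apply/ffunP=> q; rewrite !ffunE -sum1_card.
  rewrite (partition_big (fun i => (c i).2) predT) //=; apply: eq_bigr => q' _.
  rewrite ffunE -sum1_card; apply: eq_bigl => i; rewrite !inE ffunE.
  by case: (c i) => a b; rewrite xpair_eqE.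
have cs c : colsums (content c) = content (pr c).2.
  apply/ffunP=> q; rewrite !ffunE -sum1_card.
  rewrite (partition_big (fun i => (c i).1) predT) //=; apply: eq_bigr => q' _.
  rewrite ffunE -sum1_card; apply: eq_bigl => i; rewrite !inE ffunE.
  by case: (c i) => a b; rewrite xpair_eqE andbC.
rewrite -cardsX.
transitivity #|[set c : {ffun 'I_n -> Q * Q'} |
   [&& rowsums (content c) == A, colsums (content c) == B & recolour c s == c]]|.
  rewrite -[RHS](card_imset _ injp); apply: eq_card => -[c1 c2]; rewrite !inE /=.
  apply/idP/imsetP => [/andP[/andP[a1 f1] /andP[a2 f2]]|[c]].
    exists [ffun i => (c1 i, c2 i)]; last first.
      by congr (_, _); apply/ffunP=> i; rewrite !ffunE.
    rewrite inE rs cs.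
    rewrite (_ : (pr _).1 = c1); last by apply/ffunP=> i; rewrite !ffunE.
    rewrite (_ : (pr _).2 = c2); last by apply/ffunP=> i; rewrite !ffunE.
    rewrite a1 a2; apply/eqP/ffunP=> i; rewrite !ffunE.
    by rewrite -{2}(eqP f1) -{2}(eqP f2) !ffunE.
  rewrite inE rs cs => /and3P[rA cB /eqP f] [-> ->]; rewrite rA cB /=.
  by apply/andP; split; apply/eqP/ffunP=> i; rewrite !ffunE -{2}f ffunE.
rewrite -sum1_card (eq_bigl (fun c => [&& rowsums (content c) == A,
  colsums (content c) == B & recolour c s == c])); last by move=> c; rewrite inE.
rewrite big_mkcond /= [RHS](eq_bigr (fun M => \sum_(c : {ffun 'I_n -> Q * Q'})
   ((content c == M) && (recolour c s == c)))); last first.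
  by move=> M _; rewrite /phi -sum1_card big_mkcond; apply: eq_bigr => c _; rewrite inE.
rewrite exchange_big /=; apply: eq_bigr => c _.
have cv : content c \in vecs (Q * Q')%type n.+1 by apply: vecs_wt; rewrite wt_content.
rewrite andbA; case: ifP => [/andP[/andP[rA cB] fc]|nh].
  rewrite big_mkcond (bigD1_seq (content c)) ?uniq_vecs //= rA cB eqxx fc big1 // => M.
  by rewrite eq_sym => /negbTE ->; case: ifP.
rewrite big1_seq // => M /andP[h _]; case: eqP => //= e; subst M.
by move: nh; rewrite h /= => ->.
Qed.

End Products.

(** * Contingency tables *)

Definition leV (Q : finType) (Z A : {ffun Q -> nat}) : bool :=
  [forall q, Z q <= A q].
Definition addV (Q : finType) (Z A : {ffun Q -> nat}) : {ffun Q -> nat} :=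
  [ffun q => Z q + A q].
Definition subV (Q : finType) (A Z : {ffun Q -> nat}) : {ffun Q -> nat} :=
  [ffun q => A q - Z q].

Lemma wt_addV (Q : finType) (Z A : {ffun Q -> nat}) : wt (addV Z A) = wt Z + wt A.
Proof. by rewrite /wt -big_split; apply: eq_bigr => q _; rewrite ffunE. Qed.

Lemma addVK (Q : finType) (Z A : {ffun Q -> nat}) : subV (addV A Z) Z = A.
Proof. by apply/ffunP=> q; rewrite !ffunE addnK. Qed.

Lemma subVK (Q : finType) (Z A : {ffun Q -> nat}) : leV Z A -> addV (subV A Z) Z = A.
Proof. by move/forallP=> h; apply/ffunP=> q; rewrite !ffunE subnK. Qed.

Lemma leV_addl (Q : finType) (Z A : {ffun Q -> nat}) : leV Z (addV A Z).
Proof. by apply/forallP=> q; rewrite ffunE leq_addl. Qed.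

Lemma wt_subV (Q : finType) (A Z : {ffun Q -> nat}) : leV Z A -> wt (subV A Z) = wt A - wt Z.
Proof. by move=> h; rewrite -{2}(subVK h) wt_addV addnK. Qed.

Lemma leV_wt (Q : finType) (Z A : {ffun Q -> nat}) : leV Z A -> wt Z <= wt A.
Proof. by move/forallP=> h; apply: leq_sum. Qed.

Lemma leV_eq (Q : finType) (Z A : {ffun Q -> nat}) : leV Z A -> wt Z = wt A -> Z = A.
Proof.
move=> h e; have := wt_subV h; rewrite e subnn => /eqP.
rewrite /wt sum_nat_eq0 => /forallP h0; apply/ffunP=> q; apply/eqP.
by rewrite eqn_leq (forallP h) -subn_eq0; have := h0 q; rewrite ffunE.
Qed.

(** The number of tables with row sums [A] and column sums [p], by removing the
    first column; the summation variable is what remains of [A] afterwards. *)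
Fixpoint num_tables (Q : finType) (A : {ffun Q -> nat}) (p : seq nat) : nat :=
  if p is k :: p' then
    \sum_(Y <- vecs Q (wt A).+1 | leV Y A && (wt Y + k == wt A)) num_tables Y p'
  else wt A == 0.

Definition vec_of_seq (p : seq nat) : {ffun 'I_(size p) -> nat} :=
  [ffun j => nth 0 p (nat_of_ord j)].
Definition phiS n (p : seq nat) : 'S_n -> nat := phi (vec_of_seq p).

Lemma wt_vec_of_seq p : wt (vec_of_seq p) = sumn p.
Proof.
rewrite sumnE (big_nth 0) big_mkord; apply: eq_bigr => i _; by rewrite ffunE.
Qed.

(** A table is its first column together with the table of the other columns;
    the first column is recovered as [A] minus the row sums of the rest. *)
Lemma count_tables (Q : finType) (A : {ffun Q -> nat}) (p : seq nat) b : wt A < b ->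
  \sum_(M <- vecs (Q * 'I_(size p))%type b |
     (rowsums M == A) && (colsums M == vec_of_seq p)) 1 = num_tables A p.
Proof.
elim: p A => [|k p IH] A wAb /=.
  have e0 (M N : {ffun Q * 'I_0 -> nat}) : M = N by apply/ffunP=> -[? []].
  have r0 M : rowsums (Q' := 'I_0) M = [ffun=> 0].
    by apply/ffunP=> q; rewrite !ffunE big_ord0.
  rewrite (eq_bigl (fun M => (wt A == 0))) => [|M]; last first.
    rewrite r0 (_ : colsums M == _) ?andbT; last by apply/eqP/ffunP=> -[].
    apply/eqP/eqP => [<-|w0]; first by rewrite /wt big1 // => q _; rewrite ffunE.
    apply/esym/leV_eq; last by rewrite w0 /wt big1 // => q _; rewrite ffunE.
    by apply/forallP=> q; rewrite ffunE -[leqRHS]w0 leq_wt.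
  case: (wt A =P 0) => w0; last by rewrite big_pred0_eq.
  have vN : [ffun=> 0] \in vecs (Q * 'I_0)%type b.
    by rewrite mem_vecs; apply/forallP=> -[? []].
  rewrite (bigD1_seq _ vN) ?uniq_vecs //= big1 // => M /negP[]; apply/eqP; exact: e0.
pose m := size p.
pose h (M : {ffun Q * 'I_m.+1 -> nat}) : {ffun Q * 'I_m -> nat} :=
  [ffun x => M (x.1, lift ord0 x.2)].
pose h' (M : {ffun Q * 'I_m -> nat}) : {ffun Q * 'I_m.+1 -> nat} :=
  [ffun x => if unlift ord0 x.2 is Some j then M (x.1, j) else A x.1 - rowsums M x.1].
transitivity (\sum_(M <- vecs (Q * 'I_m)%type b |
   (colsums M == vec_of_seq p) && (leV (rowsums M) A && (wt (rowsums M) + k == wt A))) 1).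
  apply: (@big_seq_bij _ _ _ _ _ _ _ _ _ _ _ h h'); rewrite ?uniq_vecs // {}/h {}/h'.
    move=> M; rewrite mem_vecs => /forallP Mb /andP[/eqP rM /eqP cM].
    have eA q : A q = M (q, ord0) + \sum_(j < m) M (q, lift ord0 j).
      by rewrite -rM ffunE big_ord_recl.
    have rs q : rowsums [ffun x => M (x.1, lift ord0 x.2)] q = \sum_(j < m) M (q, lift ord0 j).
      by rewrite ffunE; apply: eq_bigr => j _; rewrite ffunE.
    split=> //.
    - by rewrite mem_vecs; apply/forallP=> x; rewrite ffunE.
    - apply/and3P; split.
      + apply/eqP/ffunP=> j; rewrite !ffunE.
        have := congr1 (fun f : {ffun _ -> nat} => f (lift ord0 j)) cM; rewrite !ffunE /= => <-.
        by apply: eq_bigr => q _; rewrite ffunE.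
      + by apply/forallP=> q; rewrite rs eA leq_addl.
      + apply/eqP; rewrite {2}/wt (eq_bigr _ (fun q _ => eA q)) big_split addnC /=; congr (_ + _).
          have := congr1 (fun f : {ffun _ -> nat} => f ord0) cM; rewrite !ffunE /= => <-.
          by [].
        by rewrite /wt; apply: eq_bigr => q _; rewrite rs.
    - apply/ffunP=> -[q j]; rewrite ffunE /=; case: unliftP => [j' ->|->]; first by rewrite ffunE.
      by rewrite rs eA addnK.
  move=> M; rewrite mem_vecs => /forallP Mb /and3P[/eqP cM /forallP lM /eqP wM].
  set N := [ffun x => _].
  have rN : rowsums N = A.
    apply/ffunP=> q; rewrite ffunE big_ord_recl ffunE /= unlift_none.
    rewrite (eq_bigr (fun j => M (q, j))) => [|j _]; last by rewrite ffunE /= liftK.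
    by have := lM q; rewrite ffunE => h; rewrite subnK.
  split.
  - rewrite mem_vecs; apply/forallP=> -[q j]; rewrite ffunE /=; case: unlift => [j'|] //.
    by apply: leq_ltn_trans wAb; apply: leq_trans (leq_wt A q); exact: leq_subr.
  - rewrite rN eqxx /=; apply/eqP/ffunP=> j; rewrite !ffunE.
    case: (unliftP ord0 j) => [j' ->|->] /=.
      have := congr1 (fun f : {ffun _ -> nat} => f j') cM; rewrite !ffunE /= => <-.
      by apply: eq_bigr => q _; rewrite ffunE /= liftK.
    rewrite (eq_bigr (fun q => subV A (rowsums M) q)) => [|q _]; last first.
      by rewrite !ffunE /= unlift_none.
    rewrite -/(wt _) wt_subV; first by rewrite -wM addKn.
    by apply/forallP.
  - by apply/ffunP=> -[q j]; rewrite !ffunE /= liftK.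
rewrite (@partition_big_seq _ _ _ _ _ _ (vecs Q (wt A).+1) (fun M => colsums M == vec_of_seq p)
  (fun Y => leV Y A && (wt Y + k == wt A)) (@rowsums Q 'I_m)) ?uniq_vecs //; last first.
  by move=> M _ _ /andP[MA _]; apply: vecs_wt; rewrite ltnS leV_wt.
apply: eq_bigr => Y /andP[YA _]; rewrite -(IH Y); last exact: leq_ltn_trans (leV_wt YA) wAb.
by apply: eq_bigl => M; rewrite andbC.
Qed.

(** Mackey's formula for two Young subgroups: double cosets are tables. *)
Lemma avg_num_tables n (Q : finType) (A : {ffun Q -> nat}) (p : seq nat) : wt A = n ->
  avg (fun s : 'S_n => (phi A s)%:R * (phiS p s)%:R)%R = (num_tables A p)%:R%R.
Proof.
move=> wA; rewrite -(count_tables p (b := n.+1)) ?wA // natr_sum.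
rewrite (eq_avg (g := fun s => \sum_(M <- vecs (Q * 'I_(size p))%type n.+1 |
     (rowsums M == A) && (colsums M == vec_of_seq p)) (phi M s)%:R)%R); last first.
  by move=> s; rewrite -natrM phiM natr_sum.
rewrite avg_sum; apply: eq_bigr => M /andP[/eqP rM _].
by rewrite avg_phi // -wt_rowsums rM.
Qed.

(** * Signed Kostka numbers and the Pieri rule *)

Section PermV.
Variable r : nat.
Implicit Types (x y z l a p A : {ffun 'I_r -> nat}) (u w : 'S_r) (q : seq nat).

Definition permV w x : {ffun 'I_r -> nat} := [ffun i => x (w i)].

Lemma permVM u w x : permV (u * w)%g x = permV u (permV w x).
Proof. by apply/ffunP=> i; rewrite !ffunE permM. Qed.

Lemma permV1 x : permV 1 x = x.
Proof. by apply/ffunP=> i; rewrite ffunE perm1. Qed.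

Lemma permVK u : cancel (permV u) (permV u^-1).
Proof. by move=> x; rewrite -permVM mulVg permV1. Qed.

Lemma permVKV u : cancel (permV u^-1) (permV u).
Proof. by move=> x; rewrite -permVM mulgV permV1. Qed.

Lemma wt_permV w x : wt (permV w x) = wt x.
Proof. by rewrite /wt [RHS](reindex_perm w); apply: eq_bigr => i _; rewrite ffunE. Qed.

Lemma leV_permV w x y : leV (permV w x) (permV w y) = leV x y.
Proof.
apply/forallP/forallP => h i; last by rewrite !ffunE.
by have := h (w^-1 i)%g; rewrite !ffunE permKV.
Qed.

Lemma mem_vecs_permV w x b : (permV w x \in vecs _ b) = (x \in vecs _ b).
Proof.
rewrite !mem_vecs; apply/forallP/forallP => h i; last by rewrite !ffunE.
by have := h (w^-1 i)%g; rewrite !ffunE permKV.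
Qed.

Lemma subV_permV w x y : subV (permV w x) (permV w y) = permV w (subV x y).
Proof. by apply/ffunP=> i; rewrite !ffunE. Qed.

Lemma num_tables_permV w A q : num_tables (permV w A) q = num_tables A q.
Proof.
elim: q A => [|k q IH] A /=; rewrite wt_permV //.
apply: (@big_seq_bij _ _ _ _ _ _ _ _ _ _ _ (permV w^-1) (permV w)); rewrite ?uniq_vecs //.
  move=> Y YV /andP[YA wY]; rewrite mem_vecs_permV wt_permV wY YV andbT.
  split=> //; [by rewrite -(leV_permV w) permVKV | exact: permVKV |].
  by rewrite -[RHS]IH permVKV.
by move=> Y YV /andP[YA wY]; rewrite mem_vecs_permV wt_permV leV_permV permVK YA.
Qed.

Definition num_tablesD l p q : nat := if leV p l then num_tables (subV l p) q else 0.

Lemma num_tablesD_permV w l p q : num_tablesD (permV w l) (permV w p) q = num_tablesD l p q.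
Proof. by rewrite /num_tablesD leV_permV subV_permV num_tables_permV. Qed.

Lemma num_tablesD_nil l p : num_tablesD l p [::] = (l == p).
Proof.
rewrite /num_tablesD /=; case: ifP => [pl|npl]; last first.
  by case: eqP npl => // ->; case/negP; apply/forallP=> i.
rewrite wt_subV // subn_eq0; congr nat_of_bool; apply/idP/eqP => [lp|->] //.
by apply/esym/leV_eq => //; apply/eqP; rewrite eqn_leq leV_wt.
Qed.

Lemma leV_trans Q : transitive (@leV Q).
Proof.
move=> y x z /forallP xy /forallP yz; apply/forallP=> q; exact: leq_trans (xy q) (yz q).
Qed.

Lemma num_tablesD_cons l p k q :
  num_tablesD l p (k :: q) =
  \sum_(z <- vecs _ (wt l).+1 | leV z l && (wt z + k == wt l)) num_tablesD z p q.
Proof.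
rewrite {1}/num_tablesD; case: ifP => [pl|npl]; last first.
  rewrite big1 // => z /andP[zl _]; rewrite /num_tablesD; case: ifP => // pz.
  by rewrite (leV_trans pz zl) in npl.
rewrite /= [RHS](eq_bigr (fun z => if leV p z then num_tables (subV z p) q else 0)) //.
rewrite -big_mkcondr /= wt_subV //; have wpl := leV_wt pl.
apply: (@big_seq_bij _ _ _ _ _ _ _ _ _ _ _ (fun Y => addV Y p) (fun z => subV z p));
  rewrite ?uniq_vecs //.
  move=> Y _ /andP[YA /eqP wY].
  have Yl : leV (addV Y p) l.
    apply/forallP=> i; have := forallP YA i; have := forallP pl i; rewrite !ffunE; lia.
  rewrite addVK; split=> //; first by apply: vecs_wt; rewrite ltnS leV_wt.
  rewrite Yl leV_addl wt_addV andbT /=; apply/eqP; lia.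
move=> z _ /andP[/andP[zl /eqP wz] pz]; split.
- by apply: vecs_wt; rewrite ltnS wt_subV // leq_sub2r // leV_wt.
- rewrite wt_subV //; apply/andP; split; last first.
    by apply/eqP; have := leV_wt pz; lia.
  by apply/forallP=> i; rewrite !ffunE leq_sub2r //; apply: (forallP zl).
- exact: subVK.
Qed.

Lemma sgnM n (u w : 'S_n) : sgn (u * w)%g = (sgn u * sgn w)%R.
Proof. by rewrite /sgn odd_permM signr_addb. Qed.

Lemma sgn1 n : sgn (1%g : 'S_n) = 1%R.
Proof. by rewrite /sgn odd_perm1. Qed.

(** For strictly decreasing [l = la + delta] and [a = al + delta], where [delta]
    is the staircase, this is the skew Kostka number of [la / al] and [q], as
    the alternating sum given by the Jacobi-Trudi determinant. All
    vectors [l] are allowed, since the proofs use that it is alternating. *)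
Definition kostka l a q : rat := (\sum_w sgn w * (num_tablesD l (permV w a) q)%:R)%R.

Lemma kostka_permV u l a q : kostka (permV u l) a q = (sgn u * kostka l a q)%R.
Proof.
rewrite /kostka (reindex_inj (mulgI u)) mulr_sumr /=; apply: eq_bigr => w _.
by rewrite permVM num_tablesD_permV sgnM mulrA.
Qed.

Definition decr x : bool := [forall i : 'I_r, forall j : 'I_r, (i < j) ==> (x j < x i)].

Lemma decrP x : reflect (forall i j : 'I_r, i < j -> x j < x i) (decr x).
Proof.
apply: (iffP forallP) => [h i j ij|h i]; first exact: implyP (forallP (h i) j) ij.
by apply/forallP=> j; apply/implyP; apply: h.
Qed.

(** In terms of partitions, [la / ze] is a horizontal strip. *)
Definition strip l z : bool :=
  leV z l && [forall i : 'I_r, forall j : 'I_r, (j == i.+1 :> nat) ==> (l j < z i)].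

Lemma stripP l z : reflect (leV z l /\ forall i j : 'I_r, j = i.+1 :> nat -> l j < z i) (strip l z).
Proof.
apply: (iffP andP) => -[zl h]; split=> //.
  by move=> i j e; apply: implyP (forallP (forallP h i) j) _; apply/eqP.
by apply/forallP=> i; apply/forallP=> j; apply/implyP=> /eqP; apply: h.
Qed.

Lemma strip_decr l z : decr l -> strip l z -> decr z.
Proof.
move=> /decrP dl /stripP[/forallP zl h]; apply/decrP=> i j ij.
have i1 : i.+1 < r by exact: leq_ltn_trans ij (ltn_ord j).
have := h i (Ordinal i1) erefl; apply: leq_ltn_trans; apply: leq_trans (zl j) _.
move: ij; rewrite leq_eqVlt => /orP[/eqP e|ij]; last by apply/ltnW/dl.
by rewrite (_ : Ordinal i1 = j) //; apply/val_inj.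
Qed.

(** The topmost pair of consecutive rows at which [z] violates the horizontal
    strip condition; it is the pair exchanged by the cancelling involution. *)
Definition minbad l z (p : 'I_r * 'I_r) : bool :=
  [&& p.2 == p.1.+1 :> nat, z p.1 <= l p.2 &
    [forall p' : 'I_r * 'I_r,
       (p'.1 < p.1) && (p'.2 == p'.1.+1 :> nat) ==> ~~ (z p'.1 <= l p'.2)]].

Lemma minbad_uniq l z (p p' : 'I_r * 'I_r) : minbad l z p -> minbad l z p' -> p = p'.
Proof.
case: p p' => [i j] [i' j'] /and3P[/= /eqP ej zi /forallP mi] /and3P[/= /eqP ej' zi' /forallP mi'].
case: (ltngtP i i') => [lt|lt|e].
- by have := mi' (i, j); rewrite /= lt ej eqxx zi.
- by have := mi (i', j'); rewrite /= lt ej' eqxx zi'.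
- by congr (_, _); apply/val_inj => //=; rewrite ej ej' e.
Qed.

Lemma minbad_ex l z : leV z l -> ~~ strip l z -> exists p : 'I_r * 'I_r, minbad l z p.
Proof.
rewrite /strip => -> /=; rewrite negb_forall => /existsP[i0].
rewrite negb_forall => /existsP[j0]; rewrite negb_imply -leqNgt => /andP[e0 z0].
pose B := [pred p : 'I_r * 'I_r | (p.2 == p.1.+1 :> nat) && (z p.1 <= l p.2)].
have B0 : B (i0, j0) by rewrite /= e0.
case: (arg_minnP (fun p : 'I_r * 'I_r => nat_of_ord p.1) B0) => p /andP[e zp] mp.
exists p; rewrite /minbad e zp; apply/forallP=> p'; apply/implyP=> /andP[lt e'].
by apply/negP=> z'; have := mp p'; rewrite /B /= e' z' leqNgt lt => /(_ isT).
Qed.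

Definition swapbad l z : {ffun 'I_r -> nat} :=
  if [pick p | minbad l z p] is Some p then permV (tperm p.1 p.2) z else z.

Lemma swapbadE l z (p : 'I_r * 'I_r) : minbad l z p -> swapbad l z = permV (tperm p.1 p.2) z.
Proof.
move=> mp; rewrite /swapbad; case: pickP => [p' mp'|/(_ p)]; last by rewrite mp.
by rewrite (minbad_uniq mp mp').
Qed.

(** Both entries of the exchanged pair are at most [l p.2], so that the exchange
    keeps [z] below [l] and keeps the violation at the same rows; rows above
    the pair are untouched. This makes [swapbad] an involution. *)
Lemma minbad_swap l z (p : 'I_r * 'I_r) : decr l -> leV z l -> minbad l z p ->
  minbad l (permV (tperm p.1 p.2) z) p /\ leV (permV (tperm p.1 p.2) z) l.
Proof.
case: p => i j /= /decrP dl /forallP zl /and3P[/= /eqP e zi /forallP mi]; split.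
  apply/and3P; split=> /=; rewrite ?ffunE ?tpermL ?e // -?e //.
  apply/forallP=> -[i' j']; apply/implyP=> /= /andP[lt e'].
  rewrite ffunE tpermD; first by have := mi (i', j'); rewrite /= lt e'.
    by apply/eqP=> h; rewrite h ltnn in lt.
  by apply/eqP=> h; rewrite -h e in lt; lia.
apply/forallP=> k; rewrite ffunE; case: tpermP => [->|->|_ _] //.
by apply: leq_trans (zl j) _; apply/ltnW/dl; rewrite e.
Qed.

(** Pieri's rule. Expanding one column gives the sum over all [z] below [l];
    the terms that are not horizontal strips cancel in pairs under [swapbad],
    which changes the sign of the alternating function [kostka]. *)
Lemma kostka_cons l a k q : decr l ->
  kostka l a (k :: q) =
  (\sum_(z <- vecs _ (wt l).+1 | strip l z && (wt z + k == wt l)%N) kostka z a q)%R.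
Proof.
move=> dl; transitivity
  (\sum_(z <- vecs 'I_r (wt l).+1 | leV z l && (wt z + k == wt l)%N) kostka z a q)%R.
  rewrite /kostka exchange_big /=; apply: eq_bigr => w _.
  by rewrite num_tablesD_cons natr_sum mulr_sumr.
rewrite (bigID (strip l)) /= [X in (_ + X)%R](_ : _ = 0)%R ?addr0; last first.
  set S := (LHS); suff : S = (- S)%R by lra.
  rewrite {2}/S -sumrN.
  apply: (@big_seq_bij _ _ _ _ _ _ _ _ _ _ _ (swapbad l) (swapbad l)); rewrite ?uniq_vecs //.
    move=> z zV /andP[/andP[zl wz] nz]; case: (minbad_ex zl nz) => p mp.
    case: (minbad_swap dl zl mp) => mp' zl'; rewrite (swapbadE mp) (swapbadE mp').
    rewrite mem_vecs_permV wt_permV zl' wz; split=> //.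
    - apply/negP=> /stripP[_ h]; case/and3P: mp' => /eqP e + _.
      by rewrite leqNgt h.
    - by rewrite -permVM tperm2 permV1.
    rewrite kostka_permV /sgn odd_tperm; case/and3P: mp => /eqP e _ _.
    rewrite (_ : p.1 != p.2) ?expr1 ?mulN1r ?opprK //.
    by apply/eqP=> h; rewrite -h in e; lia.
  move=> z zV /andP[/andP[zl wz] nz]; case: (minbad_ex zl nz) => p mp.
  case: (minbad_swap dl zl mp) => mp' zl'; rewrite (swapbadE mp) (swapbadE mp').
  rewrite mem_vecs_permV wt_permV zl' wz -permVM tperm2 permV1; split=> //.
  apply/negP=> /stripP[_ h]; case/and3P: mp' => /eqP e + _.
  by rewrite leqNgt h.
apply: eq_bigl => z; rewrite -andbA [X in _ && X]andbC andbA; congr (_ && _).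
by rewrite /strip andbA andbb.
Qed.

Lemma decr_perm x w : decr x -> decr (permV w x) -> w = 1%g.
Proof.
move=> /decrP dx /decrP dw.
have mw (i j : 'I_r) : i < j -> w i < w j.
  move=> ij; have := dw i j ij; rewrite !ffunE; apply: contraTT; rewrite -!leqNgt.
  by rewrite leq_eqVlt => /orP[/eqP/val_inj->//|/dx/ltnW].
have h : leV [ffun i : 'I_r => nat_of_ord i] [ffun i => nat_of_ord (w i)].
  apply/forallP=> -[i ir]; rewrite !ffunE; elim: i ir => //= i IH ir.
  exact: leq_ltn_trans (IH (ltnW ir)) (mw (Ordinal (ltnW ir)) (Ordinal ir) (ltnSn i)).
have /ffunP e : [ffun i : 'I_r => nat_of_ord i] = [ffun i => nat_of_ord (w i)].
  apply: leV_eq h _; rewrite /wt [LHS](reindex_perm w); apply: eq_bigr => i _.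
  by rewrite !ffunE.
by apply/permP=> i; rewrite perm1; apply/val_inj; have := e i; rewrite !ffunE.
Qed.

Lemma kostka_nil l a : decr l -> decr a -> kostka l a [::] = (l == a)%:R%R.
Proof.
move=> dl da; rewrite /kostka (bigD1 1%g) //= permV1 sgn1 mul1r num_tablesD_nil.
rewrite big1 ?addr0 // => w nw; rewrite num_tablesD_nil; case: eqP => [e|]; last by rewrite mulr0.
have dw : decr (permV w a) by rewrite -e.
by rewrite (decr_perm da dw) eqxx in nw.
Qed.

End PermV.

(** * Row lengths and dominance *)

Section Rows.
Variable r : nat.
Implicit Types (x y z l a : {ffun 'I_r -> nat}) (w : 'S_r) (q : seq nat) (f : nat -> nat).

Definition delta : {ffun 'I_r -> nat} := [ffun i : 'I_r => r - i.+1].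

(** The partition encoded by a strictly decreasing vector, continued by zero
    below row [r]. *)
Definition row x (i : nat) : nat :=
  if (insub i : option 'I_r) is Some j then x j - delta j else 0.

Arguments row x i : simpl never.

Definition ofrow f : {ffun 'I_r -> nat} := [ffun i : 'I_r => f i + delta i].

Lemma decr_delta : decr delta.
Proof. by apply/decrP=> i j ij; rewrite !ffunE; have := ltn_ord j; lia. Qed.

Lemma decr_ge x : decr x -> leV delta x.
Proof.
move=> /decrP dx; apply/forallP=> i; rewrite ffunE.
have [m] := ubnP (r - i.+1); elim: m i => // m IH i lm.
case: (ltnP i.+1 r) => ir; last by rewrite (eqP ir).
have := IH (Ordinal ir); have := dx i (Ordinal ir) (ltnSn i); rewrite /=; lia.
Qed.

Lemma row_ord x (i : 'I_r) : row x i = x i - delta i.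
Proof. by rewrite /row valK. Qed.

Lemma row_out x i : r <= i -> row x i = 0.
Proof. by move=> h; rewrite /row insubN // -leqNgt. Qed.

Lemma row_ofrow f i : i < r -> row (ofrow f) i = f i.
Proof. by move=> ir; rewrite (row_ord _ (Ordinal ir)) !ffunE addnK. Qed.

Lemma row_addK x (i : 'I_r) : decr x -> row x i + delta i = x i.
Proof. by move=> dx; rewrite row_ord subnK // (forallP (decr_ge dx)). Qed.

Lemma row_inj x y : decr x -> decr y -> row x =1 row y -> x = y.
Proof.
by move=> dx dy e; apply/ffunP=> i; rewrite -(row_addK i dx) -(row_addK i dy) e.
Qed.

Lemma row_anti x i : decr x -> row x i.+1 <= row x i.
Proof.
move=> dx; case: (ltnP i.+1 r) => ir; last by rewrite row_out.
have := row_addK (Ordinal ir) dx; have := row_addK (Ordinal (ltnW ir)) dx.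
have /decrP/(_ (Ordinal (ltnW ir)) (Ordinal ir) (ltnSn i)) := dx.
by rewrite /= !ffunE /=; lia.
Qed.

Lemma decr_ofrow f : (forall i, i.+1 < r -> f i.+1 <= f i) -> decr (ofrow f).
Proof.
move=> fm; apply/decrP=> -[i ir] [j jr] /= ij; rewrite !ffunE /=.
suff : f j <= f i by lia.
elim: j jr ij => // j IH jr; rewrite ltnS leq_eqVlt => /orP[/eqP->|ij]; first exact: fm.
by apply: leq_trans (fm _ jr) (IH _ ij); exact: ltnW.
Qed.

Lemma wt_row x : decr x -> wt x = \sum_(0 <= i < r) row x i + wt delta.
Proof.
move=> dx; rewrite /wt big_mkord -big_split /=; apply: eq_bigr => i _.
by rewrite row_addK.
Qed.

Lemma leV_row x y : decr x -> decr y -> leV x y = [forall i : 'I_r, row x i <= row y i].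
Proof.
move=> dx dy; apply/forallP/forallP=> h i; have := h i;
  by rewrite -(row_addK i dx) -(row_addK i dy) leq_add2r.
Qed.

Lemma leV_rowP x y : decr x -> decr y -> reflect (forall i, row x i <= row y i) (leV x y).
Proof.
move=> dx dy; rewrite leV_row //; apply: (iffP forallP) => h i //.
by case: (ltnP i r) => ir; [apply: (h (Ordinal ir))|rewrite row_out].
Qed.

Lemma strip_rowP l z : decr l -> decr z ->
  reflect (forall i, row z i <= row l i /\ row l i.+1 <= row z i) (strip l z).
Proof.
move=> dl dz; apply: (iffP (stripP l z)) => [[zl h] i|h]; last split.
- split; first by move/leV_rowP: zl; apply.
  case: (ltnP i.+1 r) => ir; last by rewrite row_out.
  have := h (Ordinal (ltnW ir)) (Ordinal ir) erefl.
  rewrite -(row_addK (Ordinal ir) dl) -(row_addK (Ordinal (ltnW ir)) dz) !ffunE /=; lia.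
- by apply/leV_rowP=> // i; case: (h i).
- move=> i j e; rewrite -(row_addK i dz) -(row_addK j dl) !ffunE e.
  by have := (h i).2; have := ltn_ord j; lia.
Qed.

(** Removing a horizontal strip moves row [i.+1] of the old partition inside
    row [i] of the new one. After [k] strips at least the rows from [k] on are
    still there, so that the first [k] strips fit into the first [k] rows. *)
Lemma kostka_dominance x q k : decr x -> kostka x delta q != 0%R ->
  sumn (take k q) + \sum_(k <= i < r) row x i <= \sum_(0 <= i < r) row x i.
Proof.
elim: q x k => [|p q IH] x k dx nz.
  rewrite add0n; case: (leqP k r) => kr; last by rewrite big_geq // ltnW.
  by rewrite [leqRHS](big_cat_nat (n := k)) //= leq_addl.
case: k => [|k]; first by rewrite take0.
move: nz; rewrite kostka_cons // => nz.
have [z [sz wz kz]] : exists z, [/\ strip x z, wt z + p = wt x & kostka z delta q != 0%R].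
  apply: contrapT => nex; case/eqP: nz; rewrite big1_seq // => z /andP[/andP[sz /eqP wz] _].
  by apply/eqP; apply: contrapT => kz; apply: nex; exists z; split=> //; apply/negP.
have dz := strip_decr dx sz; have /(strip_rowP dx dz) rz := sz.
have := IH z k dz kz; move: wz; rewrite (wt_row dx) (wt_row dz) => wz h.
suff : \sum_(k.+1 <= i < r) row x i <= \sum_(k <= i < r) row z i by rewrite /=; lia.
case: (ltnP k r) => kr; last by rewrite !big_geq // leqW.
rewrite -(prednK (leq_ltn_trans (leq0n k) kr)) big_add1 /= [leqRHS]big_nat_recr /=.
  by apply: leq_trans (leq_addr _ _); apply: leq_sum => i _; case: (rz i).
by rewrite -ltnS prednK // (leq_ltn_trans (leq0n k) kr).
Qed.

(** Peeling off a strip of size [row x 0] must leave the partition without its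
    first row: interlacing bounds the rest from below by that partition, and
    the sizes agree. *)
Lemma kostka_self_prefix x m : decr x -> m <= r -> (forall i, m <= i -> row x i = 0) ->
  kostka x delta (mkseq (row x) m) = 1%R.
Proof.
elim: m x => [|m IH] x dx mr r0.
  rewrite kostka_nil // ?decr_delta // (_ : x = delta) ?eqxx //.
  by apply/ffunP=> i; rewrite -(row_addK i dx) r0.
rewrite /mkseq /= -[1]addn0 iotaDl -map_comp kostka_cons //.
(* The only candidate: the partition without its first row. *)
pose z := ofrow (fun i => row x i.+1).
have dz : decr z by apply: decr_ofrow => i _; exact: row_anti.
have rz i : row z i = row x i.+1.
  case: (ltnP i r) => ir; first by rewrite row_ofrow.
  by rewrite !row_out // ltnW.
have sz : strip x z by apply/strip_rowP=> // i; rewrite rz row_anti.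
have r_gt0 : 0 < r by exact: leq_trans mr.
have wz : wt z + row x 0 = wt x.
  rewrite (wt_row dx) (wt_row dz) (eq_bigr _ (fun i _ => rz i)).
  have shift f n : 0 < n -> f n = 0 -> \sum_(0 <= i < n) f i.+1 + f 0 = \sum_(0 <= i < n) f i.
    by case: n => // n _ fn; rewrite big_nat_recr //= [RHS]big_nat_recl //= fn addn0 addnC.
  by rewrite addnAC shift // row_out.
have zl : leV z x by case/stripP: sz.
rewrite big_mkcond (bigD1_seq z) ?uniq_vecs //=; last by apply: vecs_wt; rewrite ltnS leV_wt.
rewrite sz wz eqxx /= [X in kostka z _ X](_ : _ = mkseq (row z) m); last first.
  by apply: eq_map => i /=; rewrite rz.
rewrite IH // ?(ltnW mr) //; last by move=> i mi; rewrite rz r0.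
rewrite big1 ?addr0 // => y ny; case: ifP => // /andP[sy /eqP wy]; case/eqP: ny.
have dy := strip_decr dx sy; move/(strip_rowP dx dy): sy => ry.
apply/esym/leV_eq; last by lia.
by apply/leV_rowP => // i; rewrite rz; case: (ry i).
Qed.

End Rows.
Arguments row {r} x i : simpl never.

(** * Skew Jacobi-Trudi functions and orthonormality *)

Section Psi.
Variable r : nat.
Implicit Types (x y z l a p A : {ffun 'I_r -> nat}) (u w : 'S_r) (q : seq nat).

Definition phiD n l p (s : 'S_n) : nat := if leV p l then phi (subV l p) s else 0.

(** The skew Jacobi-Trudi determinant, with products of complete symmetric
    functions read as permutation characters; [l] and [a] are partitions shifted
    by the staircase. For [a = delta r] it turns out to be an irreducible
    character of the symmetric group. *)
Definition psi n l a (s : 'S_n) : rat := (\sum_w sgn w * (phiD l (permV w a) s)%:R)%R.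

Lemma phiD_permV n u l p (s : 'S_n) : phiD (permV u l) (permV u p) s = phiD l p s.
Proof.
rewrite /phiD leV_permV subV_permV; case: ifP => // _.
by apply: phi_relabel; exists u^-1%g; [exact: permK|exact: permKV].
Qed.

Lemma psi_permV n u l a (s : 'S_n) : psi (permV u l) a s = (sgn u * psi l a s)%R.
Proof.
rewrite /psi (reindex_inj (mulgI u)) mulr_sumr /=; apply: eq_bigr => w _.
by rewrite permVM phiD_permV sgnM mulrA.
Qed.

Lemma psi_eq0 n l a (s : 'S_n) : wt l != n + wt a -> psi l a s = 0%R.
Proof.
move=> wl; rewrite /psi big1 // => w _; rewrite /phiD; case: ifP => h; last by rewrite mulr0.
rewrite phi_eq0 ?mulr0 // wt_subV // wt_permV; move: (leV_wt h); rewrite wt_permV.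
by apply: contraTneq => e; apply: contraNN wl; lia.
Qed.

(** Invariance under the transposition makes the value its own opposite. *)
Lemma psi_eq0_tperm n l a (s : 'S_n) i j : i != j -> l i = l j -> psi l a s = 0%R.
Proof.
move=> ij e; have := psi_permV (tperm i j) l a s.
rewrite /sgn odd_tperm ij (_ : permV _ l = l) ?expr1; last first.
  by apply/ffunP=> k; rewrite ffunE; case: tpermP => [->|->|].
by lra.
Qed.

Lemma avg_psi_phiS n l a q : wt l = n + wt a ->
  avg (fun s : 'S_n => psi l a s * (phiS q s)%:R)%R = kostka l a q.
Proof.
move=> wl; rewrite /psi; under eq_avg => s do rewrite mulr_suml.
rewrite avg_sum; apply: eq_bigr => w _.
rewrite (eq_avg (g := fun s => sgn w * ((phiD l (permV w a) s)%:R * (phiS q s)%:R))%R).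
  rewrite avgZ /phiD /num_tablesD; case: ifP => h; last first.
    by rewrite /avg big1 ?mulr0 // => s _; rewrite mul0r.
  by rewrite avg_num_tables // wt_subV // wt_permV wl addnK.
by move=> s; rewrite mulrA.
Qed.

Definition seqV A : seq nat := [seq A i | i <- enum 'I_r].

Lemma size_seqV A : size (seqV A) = r.
Proof. by rewrite size_map size_enum_ord. Qed.

Lemma nth_seqV A (i : 'I_r) : nth 0 (seqV A) i = A i.
Proof. by rewrite (nth_map i) ?size_enum_ord // nth_ord_enum. Qed.

Lemma phi_seqV n A (s : 'S_n) : phi A s = phiS (seqV A) s.
Proof.
pose h (i : 'I_(size (seqV A))) := cast_ord (size_seqV A) i.
rewrite -(@phi_relabel _ _ _ h); last first.
  by exists (cast_ord (esym (size_seqV A))); [exact: cast_ordK|exact: cast_ordKV].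
by congr phi; apply/ffunP=> i; rewrite !ffunE -(nth_seqV A (h i)).
Qed.

Lemma sum_ord_lt k (F : nat -> nat) : k <= r ->
  \sum_(0 <= i < k) F i = \sum_(i : 'I_r | i < k) F i.
Proof.
by move=> kr; rewrite (big_nat_widen _ _ _ _ _ kr) big_mkord; apply: eq_bigl => i.
Qed.

Lemma sumn_take_seqV A k : k <= r -> sumn (take k (seqV A)) = \sum_(i : 'I_r | i < k) A i.
Proof.
move=> kr; rewrite -(@map_nth_iota0 _ 0) ?size_seqV // sumnE big_map.
rewrite -[k in iota 0 k]subn0 -/(index_iota 0 k) sum_ord_lt //.
by apply: eq_bigr => i _; rewrite nth_seqV.
Qed.

(** [delta r] is decreasing, so the first [k] positions carry its [k] largest
    values. *)
Lemma sum_delta_perm w k : \sum_(i : 'I_r | i < k) delta r (w i) <= \sum_(i : 'I_r | i < k) delta r i.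
Proof.
pose X := [set i : 'I_r | i < k].
rewrite (eq_bigl (fun i => i \in X)) => [|i]; last by rewrite inE.
rewrite [leqRHS](eq_bigl (fun i => i \in X)) => [|i]; last by rewrite inE.
rewrite -(big_imset (fun j => delta r j)) /=; last by move=> i j _ _ /perm_inj.
rewrite (big_setID X) /= [leqRHS](big_setID (w @: X)) /= finset.setIC leq_add2l.
apply: (@leq_trans (\sum_(j in w @: X :\: X) (r - k.+1))).
  by apply: leq_sum => i; rewrite !inE ffunE -leqNgt => /andP[ki _]; lia.
apply: (@leq_trans (\sum_(j in X :\: w @: X) (r - k.+1))).
  rewrite !sum_nat_const leq_mul2r; apply/orP; right.
  have e : #|w @: X| = #|X| by apply: card_imset; exact: perm_inj.
  by rewrite cardsD [leqRHS]cardsD e finset.setIC.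
by apply: leq_sum => i; rewrite !inE ffunE => /andP[_ ki]; lia.
Qed.

(** Inductively [w] fixes all positions before [i]; the inequality for [i.+1]
    then forces [w i <= i]. *)
Lemma perm_of_sum_delta w :
  (forall k, k <= r -> \sum_(i : 'I_r | i < k) delta r i <= \sum_(i : 'I_r | i < k) delta r (w i)) ->
  w = 1%g.
Proof.
move=> h; have wi (i : 'I_r) : w i = i.
  have [m] := ubnP (nat_of_ord i); elim: m i => // m IH i; rewrite ltnS => im.
  have := h i.+1 (ltn_ord i); rewrite (bigD1 i) //= [leqRHS](bigD1 i) //=.
  rewrite (eq_bigr (fun j => delta r (w j))) => [|j /andP[ji nji]]; last first.
    by rewrite IH //; apply: leq_trans im; rewrite ltn_neqAle -ltnS ji andbT.
  rewrite leq_add2r !ffunE => d.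
  have le : w i <= i by have := ltn_ord (w i); have := ltn_ord i; lia.
  apply/val_inj => /=; apply/eqP; rewrite eqn_leq le leqNgt; apply/negP=> lt.
  have := IH (w i) (leq_trans lt im) => /perm_inj e; by rewrite e ltnn in lt.
by apply/permP=> i; rewrite perm1.
Qed.

Lemma avg_psi_psi n x y a : wt x = n + wt a ->
  avg (fun s : 'S_n => psi x a s * psi y a s)%R =
  (\sum_w sgn w * if leV (permV w a) y then kostka x a (seqV (subV y (permV w a))) else 0)%R.
Proof.
move=> wx; rewrite {2}/psi; under eq_avg => s do rewrite mulr_sumr.
rewrite avg_sum; apply: eq_bigr => w _.
rewrite (eq_avg (g := fun s => sgn w * (psi x a s * (phiD y (permV w a) s)%:R))%R).
  rewrite avgZ /phiD; case: ifP => h; last first.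
    by rewrite /avg [X in (_ * (_ * X))%R]big1 ?mulr0 // => s _; rewrite mulr0.
  congr (_ * _)%R; rewrite -(avg_psi_phiS _ wx); apply: eq_avg => s.
  by rewrite phi_seqV.
by move=> s; rewrite mulrCA.
Qed.

Lemma sum_row_lt x k : decr x -> k <= r ->
  \sum_(0 <= i < k) row x i + \sum_(i : 'I_r | i < k) delta r i = \sum_(i : 'I_r | i < k) x i.
Proof.
move=> dx kr; rewrite sum_ord_lt // -big_split /=; apply: eq_bigr => i _.
by rewrite row_addK.
Qed.

(** Dominance for the parts [y - w delta] that occur in the Jacobi-Trudi
    expansion of [y]; the staircase is added on both sides to avoid truncated
    differences. *)
Lemma kostka_shift_dominance x y w k : decr x -> leV (permV w (delta r)) y -> k <= r ->
  kostka x (delta r) (seqV (subV y (permV w (delta r)))) != 0%R ->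
  \sum_(i : 'I_r | i < k) y i + \sum_(i : 'I_r | i < k) delta r i <=
  \sum_(i : 'I_r | i < k) x i + \sum_(i : 'I_r | i < k) delta r (w i).
Proof.
move=> dx wy kr /(kostka_dominance k dx); rewrite sumn_take_seqV //.
rewrite [leqRHS](big_cat_nat (n := k)) //= leq_add2r -(leq_add2r (\sum_(i : 'I_r | i < k) delta r i)).
rewrite sum_row_lt // => h.
rewrite (_ : \sum_(i : 'I_r | i < k) y i = \sum_(i : 'I_r | i < k)
  subV y (permV w (delta r)) i + \sum_(i : 'I_r | i < k) delta r (w i)).
  by rewrite addnAC leq_add2r.
rewrite -big_split /=; apply: eq_bigr => i _; rewrite !ffunE subnK //.
by have := forallP wy i; rewrite !ffunE.
Qed.

(** A nonzero pairing makes the partition of [x] dominate that of [y], because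
    permuting the staircase only increases the parts in the dominance order.
    The pairing being symmetric, the two partitions agree, and then only the
    identity term of the expansion survives. *)
Lemma psi_orthonormal n x y : decr x -> decr y ->
  wt x = n + wt (delta r) -> wt y = n + wt (delta r) ->
  avg (fun s : 'S_n => psi x (delta r) s * psi y (delta r) s)%R = (x == y)%:R%R.
Proof.
have dom n' x' y' : decr x' -> wt x' = n' + wt (delta r) ->
  avg (fun s : 'S_n' => psi x' (delta r) s * psi y' (delta r) s)%R != 0%R ->
  forall k, k <= r -> \sum_(i : 'I_r | i < k) y' i <= \sum_(i : 'I_r | i < k) x' i.
  move=> dx' wx'; rewrite avg_psi_psi // => nz k kr.
  have [w /eqP wnz] : exists w, (sgn w * (if leV (permV w (delta r)) y'
     then kostka x' (delta r) (seqV (subV y' (permV w (delta r)))) else 0) <> 0)%R.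
    apply: contrapT => nex; case/eqP: nz; rewrite big1 // => w _.
    by apply: contrapT => h; apply: nex; exists w.
  move: wnz; case: ifP; rewrite ?mulr0 ?eqxx // => wy; rewrite mulf_eq0 negb_or => /andP[_ kn].
  have := leq_trans (kostka_shift_dominance dx' wy kr kn) (leq_add (leqnn _) (sum_delta_perm w k)).
  by rewrite leq_add2r.
move=> dx dy wx wy.
have sym : avg (fun s : 'S_n => psi x (delta r) s * psi y (delta r) s)%R =
           avg (fun s : 'S_n => psi y (delta r) s * psi x (delta r) s)%R.
  by apply: eq_avg => s; rewrite mulrC.
case: (x =P y) => [<-|nxy]; last first.
  apply/eqP; apply: contrapT => /negP nz; apply: nxy.
  have pe k : k <= r -> \sum_(i : 'I_r | i < k) x i = \sum_(i : 'I_r | i < k) y i.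
    move=> kr; apply/eqP; rewrite eqn_leq (dom n x y) // andbT.
    by apply: (dom n y x) => //; rewrite -sym.
  apply/ffunP=> i; have := pe i.+1 (ltn_ord i).
  rewrite (bigD1 i) //= [in RHS](bigD1 i) //=.
  have e (z : {ffun 'I_r -> nat}) :
     \sum_(j < r | (j < i.+1) && (j != i)) z j = \sum_(j : 'I_r | j < i) z j.
    by apply: eq_bigl => j; rewrite ltnS [j < i]ltn_neqAle andbC.
  by rewrite !e (pe i) ?(ltnW (ltn_ord i)) // => /addIn.
rewrite avg_psi_psi // (bigD1 1%g) //= permV1 sgn1 mul1r decr_ge //.
rewrite big1 ?addr0 => [|w nw].
  rewrite (_ : seqV _ = mkseq (row x) r) ?kostka_self_prefix // => [i ri|]; first exact: row_out.
  apply: (@eq_from_nth _ 0) => [|i]; rewrite size_seqV ?size_mkseq // => ir.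
  by rewrite nth_mkseq // (row_ord _ (Ordinal ir)) (nth_seqV _ (Ordinal ir)) ffunE.
case: ifP => wx'; last by rewrite mulr0.
rewrite (_ : kostka _ _ _ = 0)%R ?mulr0 //; apply/eqP; apply: contrapT => /negP kn.
case/eqP: nw; apply: perm_of_sum_delta => k kr.
by have := kostka_shift_dominance dx wx' kr kn; rewrite leq_add2l.
Qed.

End Psi.

(** * Restriction to a Young subgroup of two blocks *)

Section Restriction.
Variable r : nat.
Implicit Types (x y z l a p : {ffun 'I_r -> nat}) (u w : 'S_r) (q : seq nat).
Local Notation tensor := {ffun 'I_r * 'I_r -> nat}.

Lemma big_vecs_widen (R : Type) (idx : R) (op : Monoid.com_law idx) (Q : finType)
    (P : pred {ffun Q -> nat}) (F : {ffun Q -> nat} -> R) k N : k < N ->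
  \big[op/idx]_(Z <- vecs Q N | (wt Z == k) && P Z) F Z =
  \big[op/idx]_(Z <- vecs Q k.+1 | (wt Z == k) && P Z) F Z.
Proof.
move=> kN; apply: (@big_seq_bij _ _ _ _ _ _ _ _ _ _ _ id id);
  rewrite ?uniq_vecs // => Z _ /andP[/eqP wZ PZ]; rewrite wZ eqxx PZ;
  by split=> //; apply: vecs_wt; rewrite wZ.
Qed.

(** [Z] is the content of a pair of colourings that contribute to
    [phiD l p1] and [phiD y p2] on ['S_k]. *)
Definition margins l p1 p2 y k (Z : tensor) : bool :=
  (wt Z == k) && ((addV (rowsums Z) p1 == l) && (addV (colsums Z) p2 == y)).

Lemma subV_eq (Q : finType) (l p Z : {ffun Q -> nat}) : leV p l -> (Z == subV l p) = (addV Z p == l).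
Proof.
move=> pl; apply/eqP/eqP => [->|<-]; first exact: subVK.
by rewrite addVK.
Qed.

Lemma phiDM k N x y p1 p2 (s : 'S_k) : k < N ->
  phiD x p1 s * phiD y p2 s = \sum_(Z <- vecs _ N | margins x p1 p2 y k Z) phi Z s.
Proof.
move=> kN; rewrite big_vecs_widen // big_mkcondl /=.
rewrite (eq_bigr (fun Z => phi Z s)) => [|Z _]; last first.
  by case: eqP => // /eqP wZ; rewrite phi_eq0.
rewrite /phiD; case: ifP => h1; last first.
  rewrite mul0n big1 // => Z /andP[/eqP e _]; case/negP: h1; rewrite -e; exact: leV_addl.
case: ifP => h2; last first.
  rewrite muln0 big1 // => Z /andP[_ /eqP e]; case/negP: h2; rewrite -e; exact: leV_addl.
by rewrite phiM; apply: eq_bigl => Z; rewrite !subV_eq.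
Qed.

Lemma avg_phiDDS k N x y p1 p2 q : k < N ->
  avg (fun s : 'S_k => (phiD x p1 s)%:R * (phiD y p2 s)%:R * (phiS q s)%:R)%R =
  (\sum_(Z <- vecs _ N | margins x p1 p2 y k Z) (num_tables Z q)%:R)%R.
Proof.
move=> kN.
rewrite (eq_avg (g := fun s => \sum_(Z <- vecs _ N | margins x p1 p2 y k Z)
   (phi Z s)%:R * (phiS q s)%:R)%R) => [|s]; last first.
  by rewrite -natrM (phiDM _ _ _ _ _ kN) natr_sum mulr_suml.
by rewrite avg_sum; apply: eq_bigr => Z /andP[/eqP wZ _]; rewrite avg_num_tables.
Qed.

Lemma avg_phiDD k N x y p1 p2 : k < N ->
  avg (fun s : 'S_k => (phiD x p1 s)%:R * (phiD y p2 s)%:R)%R =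
  (\sum_(Z <- vecs _ N | margins x p1 p2 y k Z) 1)%R.
Proof.
move=> kN.
rewrite (eq_avg (g := fun s => \sum_(Z <- vecs _ N | margins x p1 p2 y k Z) (phi Z s)%:R)%R)
   => [|s]; last by rewrite -natrM (phiDM _ _ _ _ _ kN) natr_sum.
by rewrite avg_sum; apply: eq_bigr => Z /andP[/eqP wZ _]; rewrite avg_phi.
Qed.

Lemma addVA (Q : finType) (A B C : {ffun Q -> nat}) : addV A (addV B C) = addV (addV A B) C.
Proof. by apply/ffunP=> i; rewrite !ffunE addnA. Qed.

Lemma rowsums_addV (Z Y : tensor) : rowsums (addV Z Y) = addV (rowsums Z) (rowsums Y).
Proof.
by apply/ffunP=> i; rewrite !ffunE -big_split /=; apply: eq_bigr => j _; rewrite ffunE.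
Qed.

Lemma colsums_addV (Z Y : tensor) : colsums (addV Z Y) = addV (colsums Z) (colsums Y).
Proof.
by apply/ffunP=> i; rewrite !ffunE -big_split /=; apply: eq_bigr => j _; rewrite ffunE.
Qed.

(** Restriction from ['S_n] to ['S_k] times ['S_e], the first column of size [k]
    being split off: a table [A] of pairs of colours with a column [Z] of weight
    [k] removed is a pair of tables, and the margins [x] and [y] of [Z] say how
    the margins of [A] are distributed. The sums over [x] and [y] have only
    finitely many nonzero terms, all below [l]. *)
Lemma avg_restrict n k e l p1 p2 q : n = k + e -> wt l = n + wt p1 -> wt p2 = wt p1 ->
  avg (fun s : 'S_n => (phiD l p1 s)%:R * (phiD l p2 s)%:R * (phiS (k :: q) s)%:R)%R =
  (\sum_(x <- vecs _ (wt l).+1) \sum_(y <- vecs _ (wt l).+1)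
     avg (fun s : 'S_k => (phiD x p1 s)%:R * (phiD y p2 s)%:R) *
     avg (fun s : 'S_e => (phiD l x s)%:R * (phiD l y s)%:R * (phiS q s)%:R))%R.
Proof.
move=> en wl wp; pose N := n.+1.
have kN : k < N by rewrite ltnS en leq_addr.
have eN : e < N by rewrite ltnS en leq_addl.
rewrite (avg_phiDDS _ _ _ _ _ (ltnSn n)) -/N.
transitivity (\sum_(Y <- vecs ('I_r * 'I_r)%type N | wt Y == e)
  \sum_(Z <- vecs ('I_r * 'I_r)%type N | margins l (addV (rowsums Y) p1) (addV (colsums Y) p2) l k Z)
    (num_tables Y q)%:R : rat)%R.
  transitivity (\sum_(A <- vecs ('I_r * 'I_r)%type N | margins l p1 p2 l n A)
     \sum_(Y <- vecs ('I_r * 'I_r)%type N | leV Y A && (wt Y == e)) (num_tables Y q)%:R : rat)%R.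
    apply: eq_bigr => A /andP[/eqP wA _]; rewrite /= natr_sum wA; apply: eq_bigl => Y.
    by congr (_ && _); rewrite en addnC eqn_add2l.
  rewrite (exchange_big_dep (fun Y => wt Y == e)) /=; last by move=> A Y _ /andP[].
  apply: eq_bigr => Y /eqP wY.
  apply: (@big_seq_bij _ _ _ _ _ _ _ _ _ _ _ (fun A => subV A Y) (fun Z => addV Z Y));
    rewrite ?uniq_vecs //.
    move=> A _ /andP[/and3P[/eqP wA /eqP rA /eqP cA] /andP[YA _]]; split=> //; last exact: subVK.
      by apply: vecs_wt; rewrite wt_subV // wA ltnS leq_subr.
    apply/and3P; split; first by rewrite wt_subV // wA wY en addnK.
      by rewrite addVA -rowsums_addV subVK // rA.
    by rewrite addVA -colsums_addV subVK // cA.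
  move=> Z _ /and3P[/eqP wZ /eqP rZ /eqP cZ]; split; last exact: addVK.
    by apply: vecs_wt; rewrite wt_addV wZ wY -en.
  rewrite leV_addl wY eqxx !andbT; apply/and3P; split; first by rewrite wt_addV wZ wY en.
    by rewrite rowsums_addV -addVA rZ.
  by rewrite colsums_addV -addVA cZ.
under [RHS]eq_bigr => x _ do under eq_bigr => y _ do
  rewrite (avg_phiDD _ _ _ _ kN) (avg_phiDDS _ _ _ _ _ eN) mulr_suml.
under [RHS]eq_bigr => x _ do under eq_bigr => y _ do
  (under eq_bigr => Z _ do rewrite mul1r).
transitivity (\sum_(Z <- vecs ('I_r * 'I_r)%type N | wt Z == k)
  \sum_(Y <- vecs ('I_r * 'I_r)%type N | margins l (addV (rowsums Z) p1) (addV (colsums Z) p2) l e Y)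
    (num_tables Y q)%:R : rat)%R.
  rewrite (exchange_big_dep (fun Z => wt Z == k)) /=; last by move=> Y Z _ /andP[].
  apply: eq_bigr => Z /eqP wZ; apply: eq_bigl => Y.
  rewrite /margins wZ eqxx; case: eqP => //= _.
  have sw (Q : finType) (A B C : {ffun Q -> nat}) : addV A (addV B C) = addV B (addV A C).
    by apply/ffunP=> i; rewrite !ffunE addnCA.
  by rewrite (sw _ (rowsums Y)) (sw _ (colsums Y)).
transitivity (\sum_(x <- vecs 'I_r (wt l).+1) \sum_(Z <- vecs ('I_r * 'I_r)%type N | (wt Z == k) && (addV (rowsums Z) p1 == x))
  \sum_(Y <- vecs ('I_r * 'I_r)%type N | margins l (addV (rowsums Z) p1) (addV (colsums Z) p2) l e Y)
    (num_tables Y q)%:R : rat)%R.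
  rewrite -(@partition_big_seq _ _ _ _ _ _ _ (fun Z => wt Z == k) predT (fun Z => addV (rowsums Z) p1)) ?uniq_vecs //.
    by apply: eq_bigl => Z; rewrite andbT.
  move=> Z _ /eqP wZ _; apply: vecs_wt; rewrite ltnS wt_addV wt_rowsums wZ wl en; lia.
apply: eq_bigr => x _.
transitivity (\sum_(y <- vecs 'I_r (wt l).+1) \sum_(Z <- vecs ('I_r * 'I_r)%type N |
      ((wt Z == k) && (addV (rowsums Z) p1 == x)) && (addV (colsums Z) p2 == y))
  \sum_(Y <- vecs ('I_r * 'I_r)%type N | margins l (addV (rowsums Z) p1) (addV (colsums Z) p2) l e Y)
    (num_tables Y q)%:R : rat)%R.
  rewrite -(@partition_big_seq _ _ _ _ _ _ _ (fun Z => (wt Z == k) && (addV (rowsums Z) p1 == x)) predT (fun Z => addV (colsums Z) p2)) ?uniq_vecs //.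
    by apply: eq_bigl => Z; rewrite andbT.
  move=> Z _ /andP[/eqP wZ _] _; apply: vecs_wt; rewrite ltnS wt_addV wt_colsums wZ wl wp en; lia.
apply: eq_bigr => y _; rewrite /margins; apply: eq_big => [Z|Z /andP[/andP[_ /eqP ->] /eqP ->]] //.
by rewrite andbA.
Qed.

Lemma sort_decr x : injective x -> exists u, decr (permV u x).
Proof.
move=> ix; pose t := [tuple x i | i < r].
have st : size (sort geq t) == r by rewrite size_sort size_tuple.
have /tuple_permP[u eu] : perm_eq (Tuple st) t by rewrite /= perm_sort.
have eux i : permV u x i = tnth (Tuple st) i.
  by rewrite ffunE (tnth_nth (x i)) eu -tnth_nth !tnth_mktuple.
exists u; apply/decrP=> i j ij.
have le : permV u x j <= permV u x i.
  rewrite !eux !(tnth_nth 0) /=.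
  apply: (sorted_ltn_nth (leT := geq)) => //; rewrite ?inE ?(eqP st) //.
    by move=> a b c /= ba ac; exact: leq_trans ac ba.
  by apply: sort_sorted => a b; exact: leq_total.
rewrite ltn_neqAle le andbT; apply/eqP; rewrite !ffunE => /ix /perm_inj e.
by rewrite e ltnn in ij.
Qed.

Lemma decr_inj x : decr x -> injective x.
Proof.
move=> /decrP dx i j e; apply/val_inj => /=.
by case: (ltngtP i j) => // /dx; rewrite e ltnn.
Qed.

Lemma permV_decr_eq a b u w : decr a -> decr b -> permV u a = permV w b -> a = b /\ u = w.
Proof.
move=> da db e.
have e' : permV (w^-1 * u)%g a = b by rewrite permVM e permVK.
have u1 : (w^-1 * u = 1)%g by apply: (decr_perm da); rewrite e'.
by split; [rewrite -e' u1 permV1|rewrite -[w]mulg1 -u1 mulKVg].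
Qed.

(** An injective vector is a permutation of exactly one strictly decreasing
    vector, in exactly one way. *)
Lemma sum_sorted b (F : {ffun 'I_r -> nat} -> rat) :
  (forall x i j, i != j -> x i = x j -> F x = 0%R) ->
  (\sum_(x <- vecs _ b) F x = \sum_(a <- vecs _ b | decr a) \sum_u F (permV u a))%R.
Proof.
move=> F0; pose inj x := [forall i, forall j, (x i == x j) ==> (i == j)].
have injP x : reflect (injective x) (inj x).
  apply: (iffP forallP) => [h i j e|h i].
    by apply/eqP; apply: implyP (forallP (h i) j) _; rewrite e.
  by apply/forallP=> j; apply/implyP=> /eqP/h->.
pose srt x := if [pick u | decr (permV u x)] is Some u then permV u x else x.
have srtP x : inj x -> decr (srt x) /\ exists u, srt x = permV u x.
  move=> /injP/sort_decr[u du]; rewrite /srt; case: pickP => [v dv|/(_ u)]; last by rewrite du.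
  by split=> //; exists v.
rewrite (bigID inj) /= [X in (_ + X)%R]big1 ?addr0 => [|x]; last first.
  rewrite negb_forall => /existsP[i]; rewrite negb_forall => /existsP[j].
  by rewrite negb_imply => /andP[/eqP e ij]; apply: F0 ij e.
transitivity (\sum_(x <- vecs _ b | inj x && decr (srt x)) F x)%R.
  by apply: eq_bigl => x; case ix: (inj x) => //=; case: (srtP x ix) => ->.
rewrite (@partition_big_seq _ _ _ _ _ _ (vecs _ b) inj (@decr r) srt) ?uniq_vecs //; last first.
  by move=> x xb ix _; case: (srtP x ix) => _ [u ->]; rewrite mem_vecs_permV.
rewrite big_seq_cond [RHS]big_seq_cond; apply: eq_bigr => a /andP[ab da].
rewrite -big_enum /=.
pose h x : 'S_r := odflt 1%g [pick u | permV u a == x].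
apply: (@big_seq_bij _ _ _ _ _ _ _ _ _ _ _ h (fun u => permV u a));
  rewrite ?uniq_vecs ?enum_uniq //.
  move=> x xb /andP[ix /eqP sx]; case: (srtP x ix) => _ [v ev].
  have ex : permV v^-1 a = x by rewrite -sx ev permVK.
  have hx : permV (h x) a = x.
    by rewrite /h; case: pickP => [w /eqP->//|/(_ v^-1%g)]; rewrite ex eqxx.
  by split; rewrite ?mem_enum ?hx.
move=> u _ _; have iu : inj (permV u a).
  by apply/injP=> i j; rewrite !ffunE => /(decr_inj da)/perm_inj.
have su : srt (permV u a) = a.
  case: (srtP _ iu) => d [v ev]; rewrite ev -permVM in d *.
  by case: (permV_decr_eq (u := 1%g) d da (permV1 _)).
rewrite mem_vecs_permV ab iu su eqxx; split=> //.
rewrite /h; case: pickP => [w /eqP e|/(_ u)]; last by rewrite eqxx.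
by case: (permV_decr_eq da da e).
Qed.

Lemma psi_gram n a b u v : decr a -> decr b ->
  avg (fun s : 'S_n => psi (permV u a) (delta r) s * psi (permV v b) (delta r) s)%R =
  (sgn u * sgn v * ((a == b) && (wt a == n + wt (delta r))%N)%:R)%R.
Proof.
move=> da db.
rewrite (eq_avg (g := fun s => (sgn u * sgn v) * (psi a (delta r) s * psi b (delta r) s))%R).
  rewrite avgZ; congr (_ * _)%R; case: (wt a =P n + wt (delta r)) => [wa|/eqP wa]; last first.
    rewrite andbF /avg big1 ?mulr0 // => s _; by rewrite psi_eq0 ?mul0r.
  case: (wt b =P n + wt (delta r)) => [wb|/eqP wb]; first by rewrite psi_orthonormal // andbT.
  rewrite /avg big1 ?mulr0 => [|s _]; last by rewrite [psi b _ _]psi_eq0 ?mulr0.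
  by case: eqP => // e; rewrite -e wa eqxx in wb.
by move=> s; rewrite !psi_permV; ring.
Qed.

(** The terms of [avg_restrict] assemble into pairings of the alternating
    functions [psi x (delta r)] on ['S_k]. After sorting [x] and [y],
    orthonormality leaves the diagonal only, which is the decomposition of the
    restricted character over the partitions of [k]. *)
Lemma avg_psi_sqr n k e l q : n = (k + e)%N -> wt l = n + wt (delta r) ->
  avg (fun s : 'S_n => psi l (delta r) s * psi l (delta r) s * (phiS (k :: q) s)%:R)%R =
  (\sum_(a <- vecs _ (wt l).+1 | decr a && (wt a == k + wt (delta r))%N)
     avg (fun s : 'S_e => psi l a s * psi l a s * (phiS q s)%:R))%R.
Proof.
move=> en wl; pose D w := permV w (delta r).
have psi2 m (l1 l2 a1 a2 : {ffun 'I_r -> nat}) (g : 'S_m -> rat) :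
  avg (fun s => psi l1 a1 s * psi l2 a2 s * g s)%R =
  (\sum_w \sum_v sgn w * sgn v *
     avg (fun s : 'S_m => (phiD l1 (permV w a1) s)%:R * (phiD l2 (permV v a2) s)%:R * g s))%R.
  under [RHS]eq_bigr => w _ do (under eq_bigr => v _ do rewrite -avgZ).
  under [RHS]eq_bigr => w _ do rewrite -avg_sum.
  rewrite -avg_sum; apply: eq_avg => s; rewrite /psi mulr_suml mulr_suml; apply: eq_bigr => w _.
  rewrite mulr_sumr mulr_suml; apply: eq_bigr => v _; ring.
rewrite psi2.
under eq_bigr => w _ do (under eq_bigr => v _ do
  rewrite (avg_restrict (k := k) (e := e) (l := l) (p1 := permV w (delta r)) (p2 := permV v (delta r)) q en) ?wt_permV // mulr_sumr).
pose T x y := avg (fun s : 'S_e => (phiD l x s)%:R * (phiD l y s)%:R * (phiS q s)%:R)%R.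
pose G x y := avg (fun s : 'S_k => psi x (delta r) s * psi y (delta r) s)%R.
transitivity (\sum_(x <- vecs 'I_r (wt l).+1) \sum_(y <- vecs 'I_r (wt l).+1) G x y * T x y)%R.
  under eq_bigr => w _ do rewrite exchange_big /=.
  rewrite exchange_big /=; apply: eq_bigr => x _.
  under eq_bigr => w _ do (under eq_bigr => v _ do rewrite mulr_sumr).
  under eq_bigr => w _ do rewrite exchange_big /=.
  rewrite exchange_big /=; apply: eq_bigr => y _.
  rewrite (_ : G x y = avg (fun s : 'S_k => psi x (delta r) s * psi y (delta r) s * 1)%R); last first.
    by apply: eq_avg => s; rewrite mulr1.
  rewrite psi2 mulr_suml; apply: eq_bigr => w _; rewrite mulr_suml; apply: eq_bigr => v _.
  rewrite -/(T x y) mulrA; congr (_ * _ * _)%R; apply: eq_avg => s; by rewrite mulr1.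
have G0l x y i j : i != j -> x i = x j -> G x y = 0%R.
  by move=> ij xij; rewrite /G /avg big1 ?mulr0 // => s _; rewrite (psi_eq0_tperm _ _ ij xij) mul0r.
have G0r x y i j : i != j -> y i = y j -> G x y = 0%R.
  by move=> ij xij; rewrite /G /avg big1 ?mulr0 // => s _; rewrite (psi_eq0_tperm _ _ ij xij) mulr0.
rewrite sum_sorted; last first.
  by move=> x i j ij xij; rewrite big1 // => y _; rewrite (G0l _ _ _ _ ij xij) mul0r.
rewrite big_mkcondr /= big_seq_cond [RHS]big_seq_cond; apply: eq_bigr => a /andP[ab da].
under eq_bigr => u _ do (rewrite sum_sorted; last by move=> y i j ij yij; rewrite (G0r _ _ _ _ ij yij) mul0r).
under eq_bigr => u _ do (under eq_bigr => b db do (under eq_bigr => v _ do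
  rewrite /G (psi_gram _ _ _ da db))).
case: ifP => wa; last first.
  by rewrite big1 // => u _; rewrite big1 // => b _; rewrite big1 // => v _; rewrite andbF mulr0 mul0r.
rewrite psi2; apply: eq_bigr => u _.
rewrite big_mkcond (bigD1_seq a) ?uniq_vecs //= da [X in (_ + X)%R]big1 ?addr0 => [|b nb]; last first.
  case: ifP => // db; rewrite big1 // => v _; rewrite eq_sym in nb.
  by rewrite (negbTE nb) mulr0 mul0r.
by apply: eq_bigr => v _; rewrite eqxx mulr1.
Qed.

End Restriction.

(** * Zero-one tables with conjugate margins *)

Section ZeroOne.
Variables (r : nat) (la : seq nat).
Hypothesis la_part : is_part la.
Hypothesis la_r : size la <= r.
Let m := size (conj_part la).
Let lam : {ffun 'I_r -> nat} := [ffun i : 'I_r => nth 0 la i].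

Lemma part_nth_anti i j : i <= j -> nth 0 la j <= nth 0 la i.
Proof.
move=> ij; case: (ltnP j (size la)) => js; last by rewrite nth_default.
case/andP: la_part => so _.
apply: (sorted_leq_nth (leT := geq)) => //; rewrite ?inE //.
- by move=> a b c /= ba ac; exact: leq_trans ac ba.
- by move=> a /=.
- exact: leq_ltn_trans ij js.
Qed.

Lemma size_conj_part : m = nth 0 la 0.
Proof. by rewrite /m size_mkseq; case: (la). Qed.

Lemma nth_conj_part (j : 'I_m) : nth 0 (conj_part la) j = \sum_(i : 'I_r) (j < lam i).
Proof.
have jm : j < head 0 la by have := ltn_ord j; rewrite {2}/m size_mkseq.
rewrite nth_mkseq // -sum1_count (big_nth 0) big_mkcond /=.
rewrite (eq_bigr (fun i : 'I_r => (j < nth 0 la i) : nat)) => [|i _]; last by rewrite ffunE.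
rewrite -(big_mkord predT (fun i => (j < nth 0 la i) : nat)) [RHS](big_cat_nat (n := size la)) //=.
rewrite [X in _ = _ + X]big_nat_cond [X in _ = _ + X]big1 ?addn0; last first.
  by move=> i /andP[/andP[h _] _]; rewrite nth_default.
by apply: eq_bigr => i _; case: ltnP.
Qed.

Definition zero_one (A : {ffun 'I_r -> nat}) (M : {ffun 'I_r * 'I_m -> nat}) : bool :=
  [&& rowsums M == A, colsums M == vec_of_seq (conj_part la) & [forall x, M x <= 1]].

(** Column [j] of the zero-one table whose rows are left justified with lengths
    [la] meets the first [k] rows as often as any zero-one column with the same
    sum can. *)
Lemma zero_one_col A M k (j : 'I_m) : zero_one A M ->
  \sum_(i : 'I_r | i < k) M (i, j) <= \sum_(i : 'I_r | i < k) (j < lam i).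
Proof.
case/and3P=> _ /eqP cM /forallP M1.
have cj : \sum_i M (i, j) = \sum_(i : 'I_r) (j < lam i).
  have := congr1 (fun f : {ffun _ -> nat} => f j) cM; rewrite !ffunE => ->.
  exact: nth_conj_part.
have [all_lt|] := boolP [forall i : 'I_r, (i < k) ==> (j < lam i)].
  by apply: leq_sum => i ik; rewrite (implyP (forallP all_lt i) ik).
rewrite negb_forall => /existsP[i0]; rewrite negb_imply -leqNgt => /andP[i0k ji0].
apply: (@leq_trans (\sum_i M (i, j))); first by rewrite [leqRHS](bigID (fun i : 'I_r => i < k)) leq_addr.
rewrite cj (bigID (fun i : 'I_r => i < k)) /= [X in _ + X]big1 ?addn0 // => i ik.
apply/eqP; rewrite eqb0 -leqNgt; apply: leq_trans ji0; rewrite !ffunE; apply: part_nth_anti.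
by apply: leq_trans (ltnW i0k) _; rewrite leqNgt.
Qed.

Lemma sum_lam i : \sum_(j : 'I_m) (j < lam i) = lam i.
Proof.
rewrite -(big_mkord predT (fun j => (j < lam i) : nat)).
have h : lam i <= m by rewrite size_conj_part ffunE part_nth_anti.
rewrite (big_cat_nat (n := lam i)) //= [X in _ + X]big_nat_cond [X in _ + X]big1 ?addn0; last first.
  by move=> j /andP[/andP[lj _] _]; rewrite ltnNge lj.
rewrite big_nat_cond (eq_bigr (fun=> 1)) => [|j /andP[/andP[_ ->]] //].
by rewrite -big_nat_cond sum_nat_const_nat subn0 muln1.
Qed.

Lemma zero_one_dominance A M k : zero_one A M ->
  \sum_(i : 'I_r | i < k) A i <= \sum_(i : 'I_r | i < k) lam i.
Proof.
move=> zM; have /and3P[/eqP rM _ _] := zM.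
rewrite (eq_bigr (fun i => \sum_j M (i, j))) => [|i _]; last by rewrite -rM ffunE.
rewrite [leqRHS](eq_bigr (fun i => \sum_(j : 'I_m) (j < lam i))) => [|i _]; last by rewrite sum_lam.
by rewrite exchange_big [leqRHS]exchange_big /=; apply: leq_sum => j _; apply: zero_one_col zM.
Qed.

(** Equal row sums force equality in every bound of [zero_one_col], and
    consecutive [k] then determine the entries. *)
Lemma zero_one_uniq M : zero_one lam M -> M = [ffun x : 'I_r * 'I_m => (x.2 < lam x.1) : nat].
Proof.
move=> zM; have /and3P[/eqP rM _ _] := zM.
have e k j : \sum_(i : 'I_r | i < k) M (i, j) = \sum_(i : 'I_r | i < k) (j < lam i).
  have se : \sum_j \sum_(i : 'I_r | i < k) M (i, j) =
            \sum_(j : 'I_m) \sum_(i : 'I_r | i < k) (j < lam i).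
    rewrite exchange_big [RHS]exchange_big /=; apply: eq_bigr => i _.
    by rewrite sum_lam -[in RHS]rM ffunE.
  have [_] := leqif_sum (fun j' (_ : predT j') => leqif_eq (zero_one_col k j' zM)).
  by rewrite se eqxx => /esym/forallP/(_ j)/eqP.
apply/ffunP=> -[i j]; rewrite ffunE /=.
have := e i.+1 j; rewrite (bigD1 i) //= [in RHS](bigD1 i) //=.
have ei (F : 'I_r -> nat) :
   \sum_(i' < r | (i' < i.+1) && (i' != i)) F i' = \sum_(i' : 'I_r | i' < i) F i'.
  by apply: eq_bigl => i'; rewrite ltnS [i' < i]ltn_neqAle andbC.
by rewrite !ei e => /addIn.
Qed.

Lemma zero_one_lam : zero_one lam [ffun x : 'I_r * 'I_m => (x.2 < lam x.1) : nat].
Proof.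
apply/and3P; split.
- by apply/eqP/ffunP=> i; rewrite ffunE -[RHS]sum_lam; apply: eq_bigr => j _; rewrite ffunE.
- apply/eqP/ffunP=> j; rewrite !ffunE nth_conj_part; apply: eq_bigr => i _; by rewrite ffunE.
- by apply/forallP=> x; rewrite ffunE leq_b1.
Qed.

Lemma avg_sgn_zero_one n (A : {ffun 'I_r -> nat}) : wt A = n ->
  avg (fun s : 'S_n => sgn s * ((phi A s)%:R * (phiS (conj_part la) s)%:R))%R =
  (\sum_(M <- vecs _ n.+1 | zero_one A M) 1)%R.
Proof.
move=> wA.
rewrite (eq_avg (g := fun s => \sum_(M <- vecs _ n.+1 | (rowsums M == A) &&
    (colsums M == vec_of_seq (conj_part la))) sgn s * (phi M s)%:R)%R) => [|s]; last first.
  by rewrite -natrM phiM natr_sum mulr_sumr.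
rewrite avg_sum.
rewrite (eq_bigr (fun M : {ffun 'I_r * 'I_m -> nat} => [forall x, M x <= 1]%N%:R)%R); last first.
  by move=> M /andP[/eqP rM _]; rewrite avg_sgn_phi // -wt_rowsums rM.
rewrite (bigID (fun M : {ffun 'I_r * 'I_m -> nat} => [forall x, M x <= 1]%N)) /=.
rewrite [X in (_ + X)%R]big1 ?addr0 => [|M /andP[_ /negbTE ->]] //.
by apply: eq_big => [M|M /andP[_ ->]] //; rewrite /zero_one andbA.
Qed.

Lemma avg_sgn_lam n : wt lam = n ->
  avg (fun s : 'S_n => sgn s * ((phi lam s)%:R * (phiS (conj_part la) s)%:R))%R = 1%R.
Proof.
move=> wl; rewrite avg_sgn_zero_one //.
rewrite big_mkcond (bigD1_seq [ffun x : 'I_r * 'I_m => (x.2 < lam x.1) : nat]) ?uniq_vecs //=.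
  rewrite zero_one_lam big1 ?addr0 // => M; case: ifP => // /zero_one_uniq ->.
  by rewrite eqxx.
rewrite mem_vecs; apply/forallP=> x; rewrite ffunE.
case lx: (_ < lam _) => //; rewrite ltnS -wl; apply: leq_trans (leq_wt lam x.1).
exact: leq_ltn_trans lx.
Qed.

Lemma zero_one_perm M w : leV (permV w (delta r)) (ofrow r (nth 0 la)) ->
  zero_one (subV (ofrow r (nth 0 la)) (permV w (delta r))) M -> w = 1%g.
Proof.
move=> wl zM; apply: perm_of_sum_delta => k kr; have := zero_one_dominance k zM.
rewrite -(leq_add2r (\sum_(i : 'I_r | i < k) delta r (w i))) -[leqLHS]big_split /=.
rewrite (eq_bigr (fun i => lam i + delta r i)) => [|i _]; last first.
  by have := forallP wl i; rewrite !ffunE => h; rewrite subnK.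
by rewrite big_split /= leq_add2l.
Qed.

(** Only the identity term survives: the other compositions in the expansion
    strictly dominate [la] and have no zero-one table with the conjugate column
    sums. *)
Lemma avg_sgn_psi n : sumn la = n ->
  avg (fun s : 'S_n => sgn s *
    (psi (ofrow r (nth 0 la)) (delta r) s * (phiS (conj_part la) s)%:R))%R = 1%R.
Proof.
move=> sn; have wlam : wt lam = n.
  rewrite -sn sumnE (big_nth 0) /wt (eq_bigr (fun i : 'I_r => nth 0 la i)) => [|i _]; last by rewrite ffunE.
  rewrite -(big_mkord predT (nth 0 la)) (big_cat_nat (n := size la)) //=.
  rewrite [X in _ + X]big_nat_cond [X in _ + X]big1 ?addn0 // => i /andP[/andP[h _] _].
  by rewrite nth_default.
pose l := ofrow r (nth 0 la); rewrite -/l.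
have l0 : leV (delta r) l by apply/forallP=> i; rewrite !ffunE leq_addl.
have wl : wt l = n + wt (delta r).
  by rewrite -wlam -wt_addV; congr wt; apply/ffunP=> i; rewrite !ffunE.
have lamE : subV l (delta r) = lam by apply/ffunP=> i; rewrite !ffunE addnK.
rewrite -[RHS](avg_sgn_lam wlam).
pose T w (s : 'S_n) := (sgn w * (sgn s * ((phiD l (permV w (delta r)) s)%:R *
  (phiS (conj_part la) s)%:R)))%R.
rewrite (eq_avg (g := fun s => \sum_w T w s)%R) => [|s]; last first.
  by rewrite mulr_suml mulr_sumr; apply: eq_bigr => w _; rewrite /T; ring.
rewrite avg_sum (bigD1 1%g) //= [X in (_ + X)%R]big1 ?addr0 => [|w nw].
  by apply: eq_avg => s; rewrite /T sgn1 mul1r permV1 /phiD l0 lamE.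
rewrite /T avgZ /phiD; case h : (leV (permV w (delta r)) l); last first.
  by rewrite /avg [X in (_ * (_ * X))%R]big1 ?mulr0 // => s _; rewrite mul0r mulr0.
rewrite avg_sgn_zero_one; last by rewrite wt_subV // wt_permV wl addnK.
rewrite big1 ?mulr0 // => M /(zero_one_perm h) w1.
by rewrite w1 eqxx in nw.
Qed.

End ZeroOne.

(** * The irreducible characters of the symmetric group *)

Section Characters.
Variable n : nat.
Local Notation Sn := [set: 'S_n].

(** Colour each point by the block of the composition [p] that contains it. *)
Lemma young_stabc (p : seq nat) : sumn p = n ->
  exists2 b : {ffun 'I_n -> 'I_(size p)},
    content b = vec_of_seq p & young_set n p = stabc b.
Proof.
move=> sp.
have lt (i : 'I_n) : reshape_index p i < size p by apply: reshape_indexP; rewrite sp.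
pose b : {ffun 'I_n -> 'I_(size p)} := [ffun i => Ordinal (lt i)].
exists b; last first.
  apply/setP=> s; rewrite !inE; apply/forallP/eqP => [h|/ffunP h i].
    by apply/ffunP=> i; rewrite !ffunE; apply/val_inj/eqP/h.
  by have := congr1 val (h i); rewrite !ffunE /= => ->.
apply/ffunP=> j; rewrite !ffunE -[RHS]card_ord.
have fl (c : 'I_(nth 0 p j)) : flatten_index p j c < n.
  have := congr1 sumn (cat_take_drop j.+1 p); rewrite sp sumn_cat (take_nth 0) // sumn_rcons.
  rewrite /flatten_index; have := ltn_ord c; lia.
rewrite -(card_imset _ (f := fun c => Ordinal (fl c))); last first.
  by move=> c d /(congr1 val) /= /addnI /val_inj.
apply: eq_card => i; rewrite inE; apply/eqP/imsetP => [bi|[c _ ->]]; last first.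
  by apply/val_inj; rewrite ffunE /= flatten_indexKl.
have lo : reshape_offset p i < nth 0 p j.
  by rewrite -bi ffunE /=; apply: reshape_offsetP; rewrite sp.
exists (Ordinal lo) => //; apply/val_inj => /=.
by rewrite -[LHS](reshape_indexK p) -bi ffunE.
Qed.

Lemma ind_trivE (p : seq nat) (s : 'S_n) : sumn p = n ->
  ind_triv n p s = ratr (phiS p s)%:R%R.
Proof.
move=> sp; have [b cb yb] := young_stabc sp; rewrite ratr_nat.
rewrite /ind_triv cfIndE ?finset.subsetT //= yb.
rewrite (eq_bigr (fun y => ((s ^ y)%g \in stabc b)%:R%R)) => [|y _]; last by rewrite cfun1E.
rewrite -natr_sum (eq_bigl predT) => [|y]; last by rewrite finset.inE.
rewrite (_ : \sum_y _ = #|[set y | (s ^ y)%g \in stabc b]|).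
  rewrite (phi_ind s cb) natrM mulKf // pnatr_eq0 -lt0n; apply/card_gt0P.
  by exists 1%g; rewrite group1.
by rewrite -sum1_card [RHS]big_mkcond /=; apply: eq_bigr => y _; rewrite !inE; case: ifP.
Qed.

Lemma ind_signE (p : seq nat) (s : 'S_n) : sumn p = n ->
  ind_sign n p s = ratr (sgn s * (phiS p s)%:R)%R.
Proof.
move=> sp; rewrite /ind_sign -[('Res[_] _)%R]mul1r cfIndM ?finset.subsetT //.
by rewrite cfunE -/(ind_triv n p) ind_trivE // cfunE /= mulrC rmorphM /= rmorph_sign.
Qed.

Lemma cfdot_avg (f g : 'CF(Sn)) (f' g' : 'S_n -> rat) :
  (forall s, f s = ratr (f' s)) -> (forall s, g s = ratr (g' s)) ->
  '[f, g]%R = ratr (avg (fun s => f' s * g' s)%R).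
Proof.
move=> ef eg; rewrite cfdotE /avg rmorphM /= fmorphV /= ratr_nat cardsT card_Sn rmorph_sum /=.
congr (_ * _)%R; apply: eq_big => [s|s _]; first by rewrite finset.inE.
by rewrite ef eg fmorph_rat rmorphM.
Qed.

(** The multiplicities are natural numbers, so two common constituents would
    contribute at least 2 to the pairing. *)
Lemma constt_uniq (phi psi : 'CF(Sn)) i j :
  phi \is a character -> psi \is a character -> '[phi, psi]%R = 1%R ->
  i \in irr_constt phi -> i \in irr_constt psi ->
  j \in irr_constt phi -> j \in irr_constt psi -> i = j.
Proof.
move=> cphi cpsi e; rewrite (cfdot_char_r _ cpsi) in e; rewrite !irr_consttE => iphi ipsi jphi jpsi.
have nat_ge1 k : '[phi, 'chi_k]%R != 0%R -> '[psi, 'chi_k]%R != 0%R ->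
   (1 <= '[phi, 'chi_k] * '[psi, 'chi_k])%R.
  have /natrP[a ->] := Cnat_cfdot_char_irr k cphi.
  have /natrP[b ->] := Cnat_cfdot_char_irr k cpsi.
  by rewrite !pnatr_eq0 -natrM ler1n muln_gt0 !lt0n => -> ->.
apply/eqP; apply: contraT => nij; move: e; rewrite (bigD1 i) //= (bigD1 j) 1?eq_sym //=.
set S := (\sum_(_ | _) _)%R => e.
have S0 : (0 <= S)%R.
  apply: sumr_ge0 => k _; apply: mulr_ge0; apply: natr_ge0; exact: Cnat_cfdot_char_irr.
have := lerD (nat_ge1 i iphi ipsi) (lerD (nat_ge1 j jphi jpsi) S0).
by rewrite e addr0 -[leLHS]/(2%:R)%R lern1.
Qed.

Variables (r : nat) (la : seq nat).
Hypothesis la_part : is_part_of n la.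
Hypothesis la_r : size la <= r.

Let l := ofrow r (nth 0 la).

Lemma is_part_la : is_part la. Proof. by case/andP: la_part. Qed.
Lemma sumn_la : sumn la = n. Proof. by case/andP: la_part => _ /eqP. Qed.

Lemma decr_la : decr l.
Proof. by apply: decr_ofrow => i _; apply: part_nth_anti => //; exact: is_part_la. Qed.

Lemma row_la i : row l i = nth 0 la i.
Proof.
case: (ltnP i r) => ir; first by rewrite row_ofrow.
by rewrite row_out // nth_default // (leq_trans la_r).
Qed.

Lemma wt_la : wt l = n + wt (delta r).
Proof.
rewrite wt_row ?decr_la // (eq_bigr _ (fun i _ => row_la i)); congr (_ + _).
rewrite (big_cat_nat (n := size la)) //= [X in _ + X]big_nat_cond [X in _ + X]big1 ?addn0.
  by rewrite -sumn_la sumnE [RHS](big_nth 0).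
by move=> i /andP[/andP[h _] _]; rewrite nth_default.
Qed.

Lemma sumn_conj_part : sumn (conj_part la) = n.
Proof.
rewrite -sumn_la sumnE (big_nth 0) big_mkord.
rewrite (eq_bigr (fun j : 'I__ => \sum_(i : 'I_(size la)) (j < [ffun i : 'I_(size la) => nth 0 la i] i))); last first.
  by move=> j _; apply: nth_conj_part.
rewrite exchange_big /= sumnE [RHS](big_nth 0) [RHS]big_mkord; apply: eq_bigr => i _.
by rewrite sum_lam ?ffunE // is_part_la.
Qed.

Definition psi_cfun : 'CF(Sn) :=
  (\sum_w (if leV (permV w (delta r)) l then
    (-1) ^+ w *: ind_triv n (seqV (subV l (permV w (delta r)))) else 0))%R.

Lemma psi_cfunE s : psi_cfun s = ratr (psi l (delta r) s).
Proof.
rewrite /psi_cfun sum_cfunE rmorph_sum /=; apply: eq_bigr => w _.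
rewrite /phiD; case: ifP => h; last by rewrite cfunE mulr0 rmorph0.
rewrite cfunE ind_trivE; first by rewrite -phi_seqV rmorphM /= rmorph_sign.
rewrite -[seqV _](take_size) size_seqV sumn_take_seqV //.
rewrite (eq_bigl predT) => [|i]; last exact: ltn_ord.
by rewrite -/(wt _) wt_subV // wt_permV wt_la addnK.
Qed.

Lemma psi_cfun_vchar : psi_cfun \in 'Z[irr Sn]%g.
Proof.
apply: rpred_sum => w _; case: ifP => _; last exact: rpred0.
by rewrite rpredZsign; apply/char_vchar/cfInd_char/rpred1.
Qed.

Lemma ind_triv_char p : ind_triv n p \is a character.
Proof. by apply/cfInd_char/rpred1. Qed.

Lemma sign_cfun_char : sign_cfun n \is a character.
Proof.
have rP : mx_repr Sn (fun s : 'S_n => ((-1) ^+ s)%:M : 'M[algC]_1)%R.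
  split=> [|s t _ _]; first by rewrite odd_perm1.
  by rewrite odd_permM signr_addb scalar_mxM.
rewrite (_ : sign_cfun n = cfRepr (MxRepresentation rP)) ?cfRepr_char //.
by apply/cfunP=> s; rewrite !cfunE /= finset.inE mxtrace_scalar.
Qed.

Lemma ind_sign_char p : ind_sign n p \is a character.
Proof. exact/cfInd_char/cfRes_char/sign_cfun_char. Qed.

(** A virtual character of norm one is irreducible up to sign, and pairing 1
    with [ind_triv] fixes the sign. It pairs to 1 with [ind_sign] as well, and
    the two induced characters have a single constituent in common. *)
Lemma psi_cfun_irr : exists i, psi_cfun = ('chi_i)%R /\
  forall j, (j \in irr_constt (ind_triv n la)) &&
            (j \in irr_constt (ind_sign n (conj_part la))) = (j == i).
Proof.
have norm1 : '[psi_cfun]%R = 1%R.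
  rewrite (cfdot_avg psi_cfunE psi_cfunE) psi_orthonormal ?decr_la ?wt_la //.
  by rewrite eqxx rmorph1.
have triv1 : '[psi_cfun, ind_triv n la]%R = 1%R.
  rewrite (cfdot_avg psi_cfunE (fun s => ind_trivE s sumn_la)) avg_psi_phiS ?wt_la //.
  rewrite [X in kostka _ _ X](_ : la = mkseq (row l) (size la)).
    rewrite kostka_self_prefix ?decr_la ?rmorph1 // => i h.
    by rewrite row_la nth_default.
  apply: (@eq_from_nth _ 0); rewrite ?size_mkseq // => i h.
  by rewrite nth_mkseq // row_la.
have sign1 : '[psi_cfun, ind_sign n (conj_part la)]%R = 1%R.
  rewrite (cfdot_avg psi_cfunE (fun s => ind_signE s sumn_conj_part)).
  rewrite (_ : avg _ = 1%R) ?rmorph1 // -[RHS](avg_sgn_psi is_part_la la_r sumn_la).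
  by apply: eq_avg => s; rewrite mulrCA.
have ts1 : '[ind_triv n la, ind_sign n (conj_part la)]%R = 1%R.
  rewrite (cfdot_avg (fun s => ind_trivE s sumn_la) (fun s => ind_signE s sumn_conj_part)).
  have wl : wt [ffun i : 'I_(size la) => nth 0 la i] = n by rewrite -sumn_la -wt_vec_of_seq.
  rewrite (_ : avg _ = 1%R) ?rmorph1 // -[RHS](avg_sgn_lam is_part_la (leqnn _) wl).
  by apply: eq_avg => s; rewrite mulrCA.
have [b [i ei]] := vchar_norm1P psi_cfun_vchar norm1.
have b0 : b = false.
  case: b ei => // ei; move: triv1; rewrite ei scaleN1r cfdotNl => e.
  have : (0 <= '['chi_i, ind_triv n la])%R.
    by apply: natr_ge0; rewrite Cnat_cfdot_char ?irr_char ?ind_triv_char.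
  by rewrite -[X in (0 <= X)%R]opprK e oppr_ge0 ler10.
move: ei; rewrite b0 scale1r => ei; exists i; split=> // j.
have ti : i \in irr_constt (ind_triv n la).
  by rewrite irr_consttE cfdotC -ei triv1 rmorph1 oner_eq0.
have si : i \in irr_constt (ind_sign n (conj_part la)).
  by rewrite irr_consttE cfdotC -ei sign1 rmorph1 oner_eq0.
apply/andP/eqP => [[tj sj]|->]; last by split.
exact: constt_uniq (ind_triv_char la) (ind_sign_char _) ts1 tj sj ti si.
Qed.

Lemma sym_charE s : sym_char n la s = ratr (psi l (delta r) s).
Proof.
have [i [ei ui]] := psi_cfun_irr; rewrite -psi_cfunE ei /sym_char.
by case: pickP => [j|/(_ i)]; rewrite ui ?eqxx // => /eqP ->.
Qed.

End Characters.

(** * Class functions spanned by permutation characters *)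

Lemma avgB e (f g : 'S_e -> rat) : avg (fun s => f s - g s)%R = (avg f - avg g)%R.
Proof. by rewrite /avg sumrB mulrBr. Qed.

Lemma avg_sqr_eq0 e (D : 'S_e -> rat) : avg (fun s => D s * D s)%R = 0%R -> forall s, D s = 0%R.
Proof.
move/eqP; rewrite /avg mulf_eq0 invr_eq0 (negbTE (fact_rat_neq0 _)) /= => h s.
move: h; rewrite psumr_eq0 => [/allP/(_ s)|t _]; last by rewrite -expr2 sqr_ge0.
by rewrite mem_index_enum -expr2 sqrf_eq0 => /(_ isT)/eqP.
Qed.

Lemma avg_psi_ortho e (D : 'S_e -> rat) r (x y : {ffun 'I_r -> nat}) :
  (forall q, avg (fun s => D s * (phiS q s)%:R)%R = 0%R) ->
  avg (fun s => D s * psi x y s)%R = 0%R.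
Proof.
move=> D0.
rewrite (eq_avg (g := fun s => \sum_w sgn w * (D s * (phiD x (permV w y) s)%:R))%R).
  rewrite avg_sum big1 // => w _; rewrite avgZ /phiD; case h: (leV (permV w y) x).
    rewrite (eq_avg (g := fun s => D s * (phiS (seqV (subV x (permV w y))) s)%:R)%R) ?D0 ?mulr0 //.
    by move=> s; rewrite phi_seqV.
  by rewrite /avg [X in (_ * (_ * X))%R]big1 ?mulr0 // => s _; rewrite mulr0.
by move=> s; rewrite /psi mulr_sumr; apply: eq_bigr => w _; rewrite mulrCA.
Qed.

(** The difference of the two functions is a combination of permutation
    characters and is orthogonal to all of them, hence to itself. *)
Lemma psi_determined r r' e (l a : {ffun 'I_r -> nat}) (l' a' : {ffun 'I_r' -> nat}) :
  wt l = e + wt a -> wt l' = e + wt a' -> (forall q, kostka l a q = kostka l' a' q) ->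
  psi (n := e) l a =1 psi l' a'.
Proof.
move=> wl wl' ek s; pose D (s : 'S_e) := (psi l a s - psi l' a' s)%R.
have D0 q : avg (fun s => D s * (phiS q s)%:R)%R = 0%R.
  rewrite (eq_avg (g := fun s => psi l a s * (phiS q s)%:R - psi l' a' s * (phiS q s)%:R)%R).
    by rewrite avgB !avg_psi_phiS // ek subrr.
  by move=> t; rewrite mulrBl.
apply/eqP; rewrite -subr_eq0; apply/eqP; apply: (avg_sqr_eq0 (D := D)) => {s}.
rewrite (eq_avg (g := fun s => D s * psi l a s - D s * psi l' a' s)%R) => [|s].
  by rewrite avgB !avg_psi_ortho // subrr.
by rewrite -mulrBr.
Qed.

Lemma psi_kostka_eq0 r e (l a : {ffun 'I_r -> nat}) : wt l = e + wt a ->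
  (forall q, kostka l a q = 0%R) -> forall s : 'S_e, psi l a s = 0%R.
Proof.
move=> wl k0; apply: avg_sqr_eq0; apply: avg_psi_ortho => q.
by rewrite avg_psi_phiS // k0.
Qed.

(** * Shapes, their filters and their isomorphisms *)

Notation shape := {fset nat * nat}.

Definition right_of (x y : nat * nat) : bool := (y.1 == x.1) && (y.2 == x.2.+1).
Definition below (x y : nat * nat) : bool := (y.2 == x.2) && (y.1 == x.1.+1).
Definition edge (x y : nat * nat) : bool := right_of x y || below x y.

(** Closed under moving right or down inside [s]. For the diagram of [la] these
    are the removable diagrams. The condition is local, so that it is visibly
    preserved by isomorphisms of the graph of adjacencies. *)
Definition filt (s rho : shape) : bool :=
  (rho `<=` s)%fset &&
  all (fun x => all (fun y => edge x y ==> (y \in rho)) s) rho.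

Lemma filtP (s rho : shape) :
  reflect ((rho `<=` s)%fset /\ forall x y, x \in rho -> y \in s -> edge x y -> y \in rho)
          (filt s rho).
Proof.
apply: (iffP andP) => -[sub h]; split=> //.
  by move=> x y xr ys; apply/implyP; exact: (allP (allP h x xr) y ys).
by apply/allP=> x xr; apply/allP=> y ys; apply/implyP; apply: h.
Qed.

(** An isomorphism of the directed graphs in which a square is joined to its
    right and to its lower neighbour. On connected shapes this amounts to being
    translates, and on all shapes it is the relation that the characters and
    the counts below depend on. *)
Definition giso_by (f : nat * nat -> nat * nat) (s t : shape) : Prop :=
  [/\ {in s &, injective f}, [fset f x | x in s]%fset = t,
      {in s &, forall x y, right_of (f x) (f y) = right_of x y} &
      {in s &, forall x y, below (f x) (f y) = below x y}].

Definition giso (s t : shape) : Prop := exists f, giso_by f s t.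

Lemma giso_refl s : giso s s.
Proof.
exists id; split=> //; apply/fsetP=> x; apply/imfsetP/idP => [[y ys ->]|xs] //.
by exists x.
Qed.

Lemma giso_by_sub f s t u : (u `<=` s)%fset -> giso_by f s t ->
  giso_by f u [fset f x | x in u]%fset.
Proof.
by move=> /fsubsetP us [fi _ fr fb]; split=> // x y /us xs /us ys; [apply: fi|apply: fr|apply: fb].
Qed.

(** The inverse sends [y] to the first square of [s] that is mapped to [y], and
    to [(0, 0)] outside [t]. *)
Lemma giso_by_inv f s t : giso_by f s t -> exists g, giso_by g t s /\
  (forall x, x \in s -> g (f x) = x) /\ (forall y, y \in t -> f (g y) = y).
Proof.
case=> fi <- fr fb.
pose g y := head (0, 0) [seq x <- s | f x == y].
have gf x : x \in s -> g (f x) = x.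
  move=> xs; rewrite /g.
  have : x \in [seq x' <- s | f x' == f x] by rewrite mem_filter eqxx.
  have : {subset [seq x' <- s | f x' == f x] <= s} by move=> y; rewrite mem_filter => /andP[].
  have : all (fun x' => f x' == f x) [seq x' <- s | f x' == f x] by exact: filter_all.
  case: [seq _ <- _ | _] => //= y q /andP[/eqP e _] sub _.
  by apply: fi => //; apply: sub; rewrite inE eqxx.
have fg y : y \in [fset f x | x in s]%fset -> f (g y) = y.
  by case/imfsetP=> x xs ->; rewrite gf.
have gs y : y \in [fset f x | x in s]%fset -> g y \in s.
  by case/imfsetP=> x xs ->; rewrite gf.
exists g; split=> //; split.
- by move=> x y xt yt e; rewrite -(fg x) // -(fg y) // e.
- apply/fsetP=> x; apply/imfsetP/idP => [[y yt ->]|xs]; first exact: gs.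
  by exists (f x); rewrite ?gf // in_imfset.
- by move=> x y xt yt; rewrite -fr ?gs // !fg.
- by move=> x y xt yt; rewrite -fb ?gs // !fg.
Qed.

Lemma giso_sym s t : giso s t -> giso t s.
Proof. by case=> f /giso_by_inv[g [h _]]; exists g. Qed.

Lemma giso_trans s t u : giso s t -> giso t u -> giso s u.
Proof.
case=> f [fi <- fr fb] [g [gi <- gr gb]]; exists (g \o f).
have ft x : x \in s -> f x \in [fset f x | x in s]%fset by move=> xs; rewrite in_imfset.
split.
- by move=> x y xs ys /= /gi e; apply: fi => //; apply: e; exact: ft.
- apply/fsetP=> y; apply/imfsetP/imfsetP => [[x xs ->]|[z /imfsetP[x xs ->] ->]].
    by exists (f x); rewrite ?ft.
  by exists x.
- by move=> x y xs ys /=; rewrite gr ?ft // fr.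
- by move=> x y xs ys /=; rewrite gb ?ft // fb.
Qed.

Lemma card_giso s t : giso s t -> #|` s| = #|` t|.
Proof. by case=> f [fi <- _ _]; rewrite card_in_imfset. Qed.

Lemma giso_by_edge f s t x y : giso_by f s t -> x \in s -> y \in s -> edge (f x) (f y) = edge x y.
Proof. by case=> _ _ fr fb xs ys; rewrite /edge fr ?fb. Qed.

Lemma filt_giso f s t u : giso_by f s t -> filt s u -> filt t [fset f x | x in u]%fset.
Proof.
move=> fst /filtP[us h]; have [fi ft fr fb] := fst; apply/filtP; split.
  by apply/fsubsetP=> y /imfsetP[x xu ->]; rewrite -ft in_imfset //; apply: (fsubsetP us).
move=> x' y' /imfsetP[x xu ->]; rewrite -ft => /imfsetP[y ys ->].
have xs := fsubsetP us x xu.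
by rewrite (giso_by_edge fst xs ys) => e; rewrite in_imfset //; exact: (h x).
Qed.

Lemma giso_by_fsetD f s t u : giso_by f s t -> (u `<=` s)%fset ->
  giso_by f (s `\` u)%fset (t `\` [fset f x | x in u])%fset.
Proof.
move=> fst us; have [fi ft fr fb] := fst.
have -> : (t `\` [fset f x | x in u])%fset = [fset f x | x in (s `\` u)%fset]%fset.
  apply/fsetP=> y; rewrite in_fsetD -ft; apply/andP/imfsetP => [[nu /imfsetP[x xs e]]|[x]].
    exists x => //; rewrite /= in_fsetD xs andbT; apply: contra nu => xu.
    by rewrite e in_imfset.
  rewrite /= in_fsetD => /andP[xu xs] ->; split; last by rewrite in_imfset.
  apply: contra xu => /imfsetP[x' x'u e].
  by rewrite (fi x x') // (fsubsetP us x').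
apply: giso_by_sub fst; exact: fsubsetDl.
Qed.

Lemma giso_by_sum (f : nat * nat -> nat * nat) (s t : shape) (P P' : pred shape)
    (F F' : shape -> rat) : giso_by f s t ->
  (forall u, (u `<=` s)%fset -> P u = P' [fset f x | x in u]%fset) ->
  (forall u, (u `<=` s)%fset -> P u -> F u = F' [fset f x | x in u]%fset) ->
  (\sum_(u <- fpowerset s | P u) F u = \sum_(u <- fpowerset t | P' u) F' u)%R.
Proof.
move=> fst hP hF; have [g [gts [gf fg]]] := giso_by_inv fst.
have [fi ft _ _] := fst; have [gi gt _ _] := gts.
have gfu u : (u `<=` s)%fset -> [fset g y | y in [fset f x | x in u]%fset]%fset = u.
  move=> /fsubsetP us; apply/fsetP=> x; apply/imfsetP/idP.
    by case=> y /imfsetP[x' x'u ->] ->; rewrite gf // us.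
  by move=> xu; exists (f x); rewrite ?in_imfset ?gf // us.
have fgu u : (u `<=` t)%fset -> [fset f x | x in [fset g y | y in u]%fset]%fset = u.
  move=> /fsubsetP us; apply/fsetP=> x; apply/imfsetP/idP.
    by case=> y /imfsetP[x' x'u ->] ->; rewrite fg // us.
  by move=> xu; exists (g x); rewrite ?in_imfset ?fg // us.
have fsub u : (u `<=` s)%fset -> ([fset f x | x in u] `<=` t)%fset.
  by move=> us; rewrite -ft; apply/fsubsetP=> y /imfsetP[x xu ->]; rewrite in_imfset // (fsubsetP us).
have gsub u : (u `<=` t)%fset -> ([fset g x | x in u] `<=` s)%fset.
  by move=> us; rewrite -gt; apply/fsubsetP=> y /imfsetP[x xu ->]; rewrite in_imfset // (fsubsetP us).
apply: (@big_seq_bij _ _ _ _ _ _ _ _ _ _ _ (fun u : shape => [fset f x | x in u]%fset)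
   (fun u : shape => [fset g x | x in u]%fset)); rewrite ?fset_uniq //.
  move=> u; rewrite fpowersetE => us Pu; split; rewrite ?fpowersetE ?fsub ?gfu //.
    by rewrite -hP.
  exact: hF.
move=> u; rewrite fpowersetE => us Pu; split; rewrite ?fpowersetE ?gsub ?fgu //.
by rewrite hP ?gsub // fgu.
Qed.

Definition hstrip (u : shape) : bool := all (fun x => all (fun y => ~~ below x y) u) u.

Lemma hstripP (u : shape) :
  reflect (forall x y, x \in u -> y \in u -> ~~ below x y) (hstrip u).
Proof.
apply: (iffP allP) => [h x y xu yu|h x xu]; first exact: (allP (h x xu)).
by apply/allP=> y yu; apply: h.
Qed.

Lemma hstrip_giso f s t u : giso_by f s t -> (u `<=` s)%fset ->
  hstrip [fset f x | x in u]%fset = hstrip u.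
Proof.
case=> _ _ _ fb /fsubsetP us; apply/hstripP/hstripP => h.
  by move=> x y xu yu; rewrite -fb ?us //; apply: h; rewrite in_imfset.
by move=> _ _ /imfsetP[x xu ->] /imfsetP[y yu ->]; rewrite fb ?us //; apply: h.
Qed.

Lemma filt_giso_eq f s t u : giso_by f s t -> (u `<=` s)%fset ->
  filt t [fset f x | x in u]%fset = filt s u.
Proof.
move=> fst us; apply/idP/idP; last exact: filt_giso.
move=> /filtP[_ h]; have [fi ft _ _] := fst; apply/filtP; split=> // x y xu ys exy.
have : f y \in [fset f x | x in u]%fset.
  have xs := fsubsetP us x xu.
  by apply: (h (f x)); rewrite -?ft ?in_imfset // (giso_by_edge fst).
by case/imfsetP=> y' y'u /fi e; rewrite e // (fsubsetP us y').
Qed.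

(** Semistandard fillings of [s] of content [q]: the squares with a given entry
    form a horizontal strip, and the strips are removed from the outside. *)
Fixpoint fillings (s : shape) (q : seq nat) : rat :=
  (if q is k :: q' then
     \sum_(u <- fpowerset s | [&& filt s u, #|` u| == k & hstrip u]) fillings (s `\` u)%fset q'
   else (s == fset0)%:R)%R.

Lemma fillings_giso s t q : giso s t -> fillings s q = fillings t q.
Proof.
elim: q s t => [|k q IH] s t st /=.
  by rewrite -[s == _]cardfs_eq0 -[t == _]cardfs_eq0 (card_giso st).
case: st => f fst; apply: (giso_by_sum fst) => u us.
  by rewrite (filt_giso_eq fst) // (hstrip_giso fst) // -(card_giso (ex_intro _ f (giso_by_sub us fst))).
by move=> _; apply: IH; exists f; apply: giso_by_fsetD.
Qed.

(** * Diagrams by rows *)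

Definition rdiag (r : nat) (f : nat -> nat) : shape :=
  [fset x in [seq (i, j) | i <- iota 1 r, j <- iota 1 (f i.-1)]]%fset.

Lemma mem_rdiag r f i j : ((i, j) \in rdiag r f) = [&& 0 < i <= r & 0 < j <= f i.-1].
Proof.
rewrite inE /=; apply/allpairsPdep/idP => [[i' [j' [+ + [-> ->]]]]|/andP[ir jf]].
  by rewrite !mem_iota !add1n !ltnS => -> ->.
by exists i, j; rewrite !mem_iota !add1n !ltnS.
Qed.

Lemma diagram_rdiag (la : seq nat) r : size la <= r -> diagram la = rdiag r (nth 0 la).
Proof.
move=> sr; have -> : diagram la = rdiag (size la) (nth 0 la) by [].
apply/fsetP=> -[i j]; rewrite !mem_rdiag.
apply/idP/idP => /andP[/andP[i0 ir] /andP[j0 jf]]; rewrite i0 j0 jf ?andbT /=.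
  exact: leq_trans sr.
by rewrite leqNgt; apply/negP=> h; move: jf; rewrite nth_default; [lia|rewrite -ltnS prednK].
Qed.

Lemma card_rdiag r f : #|` rdiag r f| = \sum_(0 <= i < r) f i.
Proof.
rewrite /rdiag card_fseq undup_id; last first.
  apply: allpairs_uniq_dep; rewrite ?iota_uniq //; first by move=> i _; exact: iota_uniq.
  by move=> [i j] [i' j'] _ _ /= [-> ->].
rewrite size_allpairs_dep sumnE big_map; under eq_bigr do rewrite size_iota.
by rewrite -[in iota 1 r](addn0 1) iotaDl big_map -[r in iota 0 r]subn0 -/(index_iota 0 r).
Qed.

Lemma rdiag_sub r f g : (rdiag r g `<=` rdiag r f)%fset = [forall i : 'I_r, g i <= f i].
Proof.
apply/fsubsetP/forallP => [h i|h [i j]].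
  case: (posnP (g i)) => [-> //|gi].
  have := h (i.+1, g i); rewrite !mem_rdiag /= ltn_ord gi leqnn => /(_ isT).
  by move=> /andP[].
rewrite !mem_rdiag => /andP[/andP[i0 ir] /andP[j0 jg]]; rewrite i0 ir j0 /=.
have ir' : i.-1 < r by rewrite prednK.
exact: leq_trans jg (h (Ordinal ir')).
Qed.

Lemma rdiag_inj r f g : rdiag r f = rdiag r g -> forall i, i < r -> f i = g i.
Proof.
move=> e i ir; apply/eqP; rewrite eqn_leq.
have := rdiag_sub r f g; rewrite e fsubset_refl => /esym/forallP/(_ (Ordinal ir)) /= ->.
by have := rdiag_sub r g f; rewrite e fsubset_refl => /esym/forallP/(_ (Ordinal ir)) /= ->.
Qed.

Lemma eq_rdiag r f g : (forall i, i < r -> f i = g i) -> rdiag r f = rdiag r g.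
Proof.
move=> e; apply/eqP; rewrite eqEfsubset !rdiag_sub.
by apply/andP; split; apply/forallP=> i; rewrite e.
Qed.

Definition anti (r : nat) (f : nat -> nat) := forall i, i.+1 < r -> f i.+1 <= f i.
Definition below_rows (r : nat) (f g : nat -> nat) := forall i, i < r -> f i <= g i.

(** A property of 1, ..., [m] that passes to smaller numbers holds on an initial
    segment, whose length is the number of its elements. *)
Lemma count_initial (P : pred nat) m :
  (forall j, 0 < j < m -> P j.+1 -> P j) ->
  forall j, 0 < j <= m -> P j = (j <= count P (iota 1 m)).
Proof.
elim: m => [|m IH] dP j; first by case: j.
have -> : iota 1 m.+1 = iota 1 m ++ [:: m.+1] by rewrite -[in LHS](addn1 m) iotaD.
rewrite count_cat /= addn0.
case Pm : (P m.+1); last first.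
  rewrite addn0 => /andP[j0]; rewrite leq_eqVlt => /orP[/eqP->|jm].
    rewrite Pm; apply/esym/negbTE; rewrite -ltnNge ltnS.
    by rewrite -[leqRHS](size_iota 1) count_size.
  rewrite -IH ?j0 // => i /andP[i0 im]; apply: dP; by rewrite i0 ltnW.
have all_P i : 0 < i <= m.+1 -> P i.
  have [k] := ubnP (m.+1 - i); elim: k i => // k IHk i lk /andP[i0 im].
  move: im; rewrite leq_eqVlt => /orP[/eqP->//|im]; apply: dP; first by rewrite i0.
  by apply: IHk; lia.
move=> /andP[j0 jm]; rewrite all_P ?j0 // (_ : count _ _ = m); first by rewrite addn1 jm.
rewrite -[RHS](size_iota 1); apply/eqP; rewrite -all_count; apply/allP=> i.
by rewrite mem_iota add1n ltnS => /andP[i0 im]; apply: all_P; rewrite i0 leqW.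
Qed.

Section FilterRows.
Variables (r : nat) (f g : nat -> nat).
Hypotheses (f_anti : anti r f) (g_anti : anti r g) (gf : below_rows r g f).
Local Notation s := (rdiag r f `\` rdiag r g)%fset.

(** The remaining part of row [i] consists of the squares outside [rho]: closure
    to the right makes it an initial segment of length [h i], and closure
    downwards makes [h] weakly decreasing. *)
Lemma filt_rows (rho : shape) : filt s rho ->
  exists h, [/\ anti r h, below_rows r g h, below_rows r h f
              & rho = (rdiag r f `\` rdiag r h)%fset].
Proof.
move=> /filtP[/fsubsetP rs up].
(* Rows are indexed from 0 by [f] and [g] and from 1 in shapes. *)
pose h i := count (fun j => (i.+1, j) \notin rho) (iota 1 (f i)).
have hP i j : i < r -> 0 < j <= f i -> ((i.+1, j) \notin rho) = (j <= h i).
  move=> ir jf; apply: (@count_initial (fun j => (i.+1, j) \notin rho) (f i)) => // k /andP[k0 kf].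
  apply: contra => kr; apply: (up _ _ kr); last by rewrite /edge /right_of /= !eqxx.
  have := rs _ kr; rewrite !in_fsetD !mem_rdiag /= ir kf k0 /= !andbT -!ltnNge.
  by case/andP=> /leqW.
have hf : below_rows r h f by move=> i ir; rewrite -[leqRHS](size_iota 1) count_size.
exists h; split=> //.
- move=> i ir; case: (posnP (h i.+1)) => [-> //|h0].
  have ir' := ltnW ir; have hf1 := leq_trans (hf _ ir) (f_anti ir).
  rewrite -hP ?h0 //; apply/negP=> kr.
  have := hP i.+1 (h i.+1) ir; rewrite h0 hf // leqnn => /(_ isT)/negP; apply.
  apply: (up _ _ kr); last by rewrite /edge /below /= !eqxx orbT.
  have := rs _ kr; rewrite !in_fsetD !mem_rdiag /= ir ir' h0 hf1 hf // /= !andbT -!ltnNge.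
  by apply: leq_trans; rewrite ltnS; exact: g_anti.
- move=> i ir; case: (posnP (g i)) => [-> //|g0].
  rewrite -hP ?g0 ?gf //; apply/negP=> /rs.
  by rewrite in_fsetD !mem_rdiag /= ir g0 leqnn.
- apply/fsetP=> -[[|i] j].
    rewrite in_fsetD !mem_rdiag /=; apply/negP=> /rs.
    by rewrite in_fsetD !mem_rdiag.
  rewrite in_fsetD !mem_rdiag /=; case: (ltnP i r) => ir /=; last first.
    by apply/negP=> /rs; rewrite in_fsetD !mem_rdiag /= [i < r]ltnNge ir.
  case jf : (0 < j <= f i); last first.
    by rewrite ?andbF; apply/negP=> /rs; rewrite in_fsetD !mem_rdiag /= ir jf ?andbF.
  by case/andP: (jf) => -> _; rewrite andbT -hP // negbK.
Qed.

Variable h : nat -> nat.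
Hypotheses (h_anti : anti r h) (gh : below_rows r g h) (hf : below_rows r h f).

Lemma rows_filt : filt s (rdiag r f `\` rdiag r h)%fset.
Proof.
apply/filtP; split.
  apply: fsetDS; rewrite rdiag_sub; apply/forallP=> i; exact: gh.
move=> [i j] [i' j']; rewrite !in_fsetD !mem_rdiag => /andP[nh /andP[/andP[i0 ir] /andP[j0 jf]]].
move=> /andP[_ /andP[/andP[i'0 i'r] /andP[j'0 j'f]]].
rewrite i'0 i'r j'0 j'f /= andbT -ltnNge.
move: nh; rewrite i0 ir j0 /= -ltnNge => hj.
case/orP=> /andP[/= /eqP e1 /eqP e2]; rewrite e1 e2 in i'0 i'r j'f *.
  exact: leqW.
by apply: leq_ltn_trans hj; rewrite -{1}(prednK i0) /= h_anti // prednK.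
Qed.

Lemma rows_diff : (s `\` (rdiag r f `\` rdiag r h))%fset = (rdiag r h `\` rdiag r g)%fset.
Proof.
have hs : (rdiag r h `<=` rdiag r f)%fset by rewrite rdiag_sub; apply/forallP=> i; exact: hf.
apply/fsetP=> x; rewrite !in_fsetD; have := fsubsetP hs x.
by case: (x \in rdiag r h) => [->|_]; case: (x \in rdiag r g); case: (x \in rdiag r f).
Qed.

Lemma card_rows : #|` (rdiag r f `\` rdiag r h)%fset| + \sum_(0 <= i < r) h i = \sum_(0 <= i < r) f i.
Proof.
have hs : (rdiag r h `<=` rdiag r f)%fset by rewrite rdiag_sub; apply/forallP=> i; exact: hf.
by rewrite -!card_rdiag cardfsDS // subnK // fsubset_leq_card.
Qed.

Lemma hstrip_rows : hstrip (rdiag r f `\` rdiag r h)%fset <-> (forall i, i.+1 < r -> f i.+1 <= h i).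
Proof.
split=> [/hstripP st i ir|st].
  rewrite leqNgt; apply/negP=> lt; have ir' := ltnW ir.
  have f1 : 0 < f i.+1 by exact: leq_ltn_trans lt.
  have := st (i.+1, f i.+1) (i.+2, f i.+1); rewrite !in_fsetD !mem_rdiag /= ir ir' f1 leqnn /=.
  rewrite f_anti // -!ltnNge lt (leq_ltn_trans (h_anti ir) lt) /= /below /= !eqxx.
  by move=> /(_ isT isT).
apply/hstripP=> -[i j] [i' j']; rewrite !in_fsetD !mem_rdiag.
move=> /andP[nh /andP[/andP[i0 ir] /andP[j0 jf]]] /andP[_ /andP[/andP[i'0 i'r] /andP[j'0 j'f]]].
apply/negP=> /andP[/= /eqP e1 /eqP e2]; rewrite e1 e2 /= in i'r j'f.
move: nh; rewrite i0 ir j0 /= => /negP; apply.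
by apply: leq_trans j'f _; rewrite -{1}(prednK i0) st // prednK.
Qed.

End FilterRows.

(** * Skew characters depend on the isomorphism class only *)

Definition shape_of r (x : {ffun 'I_r -> nat}) : shape := rdiag r (row x).

Section SkewShapes.
Variable r : nat.
Implicit Types (x y z l a : {ffun 'I_r -> nat}) (q : seq nat) (u : shape).

Lemma anti_row x : decr x -> anti r (row x).
Proof. by move=> dx i _; exact: row_anti. Qed.

Lemma shape_of_sub x y : decr x -> decr y -> (shape_of x `<=` shape_of y)%fset = leV x y.
Proof. by move=> dx dy; rewrite rdiag_sub leV_row. Qed.

Lemma shape_of_inj x y : decr x -> decr y -> shape_of x = shape_of y -> x = y.
Proof.
move=> dx dy /rdiag_inj e; apply: row_inj => // i.
by case: (ltnP i r) => ir; [exact: e|rewrite !row_out].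
Qed.

Lemma shape_of_delta : shape_of (delta r) = fset0.
Proof.
apply/fsetP=> -[i j]; rewrite mem_rdiag in_fset0; apply/negP=> /andP[/andP[i0 ir] /andP[j0]].
have ir' : i.-1 < r by rewrite prednK.
by rewrite (row_ord _ (Ordinal ir')) subnn leqNgt j0.
Qed.

Lemma leV_below x y : decr x -> decr y -> leV x y -> below_rows r (row x) (row y).
Proof. by move=> dx dy /(leV_rowP dx dy) h i _. Qed.

Lemma shape_of_filt l z a : decr l -> decr z -> decr a -> leV a z -> leV z l ->
  filt (shape_of l `\` shape_of a)%fset (shape_of l `\` shape_of z)%fset.
Proof. by move=> dl dz da az zl; apply: rows_filt; [exact: anti_row|exact: leV_below]. Qed.

Lemma filt_shape_of l a u : decr l -> decr a -> leV a l -> filt (shape_of l `\` shape_of a)%fset u ->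
  exists z, [/\ decr z, leV a z, leV z l & u = (shape_of l `\` shape_of z)%fset].
Proof.
move=> dl da al fu.
case: (filt_rows (anti_row dl) (anti_row da) (leV_below da dl al) fu) => h [ha gh hf ->].
have dz : decr (ofrow r h) by exact: decr_ofrow.
exists (ofrow r h); split=> //.
- by rewrite leV_row //; apply/forallP=> i; rewrite row_ofrow // gh.
- by rewrite leV_row //; apply/forallP=> i; rewrite row_ofrow // hf.
- by congr (_ `\` _)%fset; apply: eq_rdiag => i ir; rewrite row_ofrow.
Qed.

Lemma card_shape_of l z : decr l -> decr z -> leV z l -> #|` (shape_of l `\` shape_of z)%fset| + wt z = wt l.
Proof.
move=> dl dz zl; rewrite (wt_row dl) (wt_row dz) addnA; congr (_ + _).
by apply: card_rows; exact: leV_below.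
Qed.

Lemma hstrip_shape_of l z : decr l -> decr z -> leV z l -> hstrip (shape_of l `\` shape_of z)%fset = strip l z.
Proof.
move=> dl dz zl; apply/idP/(strip_rowP dl dz).
  move/(hstrip_rows (anti_row dl) (anti_row dz)) => h i.
  split; first by move/(leV_rowP dz dl): zl; apply.
  by case: (ltnP i.+1 r) => ir; [exact: h|rewrite row_out].
move=> h; apply/(hstrip_rows (anti_row dl) (anti_row dz)) => i _.
by case: (h i).
Qed.

Lemma shape_of_fsetD_inj l z z' : decr l -> decr z -> decr z' -> leV z l -> leV z' l ->
  (shape_of l `\` shape_of z = shape_of l `\` shape_of z')%fset -> z = z'.
Proof.
move=> dl dz dz' zl zl' e; apply: shape_of_inj => //.
by rewrite -(fsetDK (B := shape_of z) (A := shape_of l)) ?shape_of_sub // e fsetDK ?shape_of_sub.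
Qed.

(** Pieri's rule and the recursion for fillings agree term by term, once the
    intermediate partitions are read as filters. Intermediate partitions that
    do not contain [a] contribute 0. *)
Lemma kostka_fillings l a q : decr l -> decr a ->
  kostka l a q = if leV a l then fillings (shape_of l `\` shape_of a)%fset q else 0%R.
Proof.
elim: q l => [|k q IH] l dl da.
  rewrite kostka_nil //=; case: ifP => al; last first.
    by case: eqP al => // -> /negbT/negP[]; apply/forallP=> i.
  congr ((nat_of_bool _)%:R)%R; rewrite fsetD_eq0 shape_of_sub //; apply/eqP/idP => [->|la].
    by apply/forallP.
  by apply/esym/leV_eq => //; apply/eqP; rewrite eqn_leq !leV_wt.
rewrite kostka_cons //; case: ifP => al; last first.
  rewrite big1 // => z /andP[sz _]; have dz := strip_decr dl sz; rewrite IH //.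
  case: ifP => // az; move: al; rewrite (leV_trans az) //; by case/stripP: sz.
transitivity (\sum_(z <- vecs 'I_r (wt l).+1 | [&& strip l z, wt z + k == wt l & leV a z]%N)
   fillings (shape_of z `\` shape_of a)%fset q)%R.
  transitivity (\sum_(z <- vecs 'I_r (wt l).+1 | (strip l z && (wt z + k == wt l))%N)
     if leV a z then fillings (shape_of z `\` shape_of a)%fset q else 0)%R.
    by apply: eq_bigr => z /andP[sz _]; rewrite IH // (strip_decr dl sz).
  by rewrite -big_mkcondr /=; apply: eq_bigl => z; rewrite andbA.
apply: (@big_seq_surj _ _ _ _ _ _ _ _ _ _ _ (fun z => shape_of l `\` shape_of z)%fset);
  rewrite ?uniq_vecs ?fset_uniq //.
- move=> z z'; rewrite !mem_filter => /andP[/andP[sz _] _] /andP[/andP[sz' _] _].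
  have dz := strip_decr dl sz; have dz' := strip_decr dl sz'.
  by apply: shape_of_fsetD_inj => //; [case/stripP: sz|case/stripP: sz'].
- move=> z _ /and3P[sz /eqP wz az]; have dz := strip_decr dl sz.
  have zl : leV z l by case/stripP: sz.
  split; first by rewrite fpowersetE; case/filtP: (shape_of_filt dl dz da az zl).
    rewrite shape_of_filt // hstrip_shape_of // sz andbT /=; apply/eqP/(@addIn (wt z)).
    by rewrite card_shape_of // -wz addnC.
  by rewrite rows_diff //; exact: leV_below.
- move=> u _ /and3P[fu /eqP cu hu]; case: (filt_shape_of dl da al fu) => z [dz az zl eu].
  exists z; split=> //; first by apply: vecs_wt; rewrite ltnS leV_wt.
  by rewrite -hstrip_shape_of // -eu hu az andbT /= -(card_shape_of dl dz zl) -eu cu addnC.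
Qed.

End SkewShapes.

Definition skew_model (e : nat) (s : shape) r (l a : {ffun 'I_r -> nat}) : Prop :=
  [/\ decr l, decr a, leV a l, wt l = e + wt a & giso s (shape_of l `\` shape_of a)%fset].

Definition skew_value e q r (l a : {ffun 'I_r -> nat}) : rat :=
  avg (fun s : 'S_e => psi l a s * psi l a s * (phiS q s)%:R)%R.

Lemma skew_value_giso e q s r r' (l a : {ffun 'I_r -> nat}) (l' a' : {ffun 'I_r' -> nat}) :
  skew_model e s l a -> skew_model e s l' a' -> skew_value e q l a = skew_value e q l' a'.
Proof.
case=> dl da al wl gs [dl' da' al' wl' gs'].
have e1 : psi (n := e) l a =1 psi l' a'.
  apply: psi_determined => // p; rewrite !kostka_fillings // al al'.
  by rewrite -(fillings_giso _ gs) (fillings_giso _ gs').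
by apply: eq_avg => t; rewrite e1.
Qed.

(** The common value of [skew_value] at all realisations of the shape as a skew
    diagram, well defined by [skew_value_giso]. *)
Definition skew_coef e q (s : shape) : rat :=
  xget 0%R [set v | exists r (l a : {ffun 'I_r -> nat}),
    skew_model e s l a /\ v = skew_value e q l a]%classic.

Lemma skew_coefE e q s r (l a : {ffun 'I_r -> nat}) :
  skew_model e s l a -> skew_coef e q s = skew_value e q l a.
Proof.
move=> m; rewrite /skew_coef.
set S := [set _ | _]%classic.
have [r' [l' [a' [m' ->]]]] : S (xget 0%R S).
  by apply: xgetPex; exists (skew_value e q l a), r, l, a.
exact: skew_value_giso m' m.
Qed.

Lemma skew_coef_giso e q s t : giso s t -> skew_coef e q s = skew_coef e q t.
Proof.
move=> st; rewrite /skew_coef; congr xget; apply/seteqP; split=> v [r [l [a [[dl da al wl g] ->]]]];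
  exists r, l, a; split=> //; split=> //.
  exact: giso_trans (giso_sym st) g.
exact: giso_trans st g.
Qed.

(** The partitions [a] of [avg_psi_sqr] that are contained in [l] correspond to
    the filters of the diagram. For the others all the Kostka numbers vanish,
    and with them the skew character. *)
Lemma avg_psi_sqr_shapes r n e (l : {ffun 'I_r -> nat}) q :
  decr l -> wt l = n + wt (delta r) -> e <= n ->
  avg (fun s : 'S_n => psi l (delta r) s * psi l (delta r) s *
     (phiS ((n - e)%N :: q) s)%:R)%R =
  (\sum_(u <- fpowerset (shape_of l) | filt (shape_of l) u && (#|` u| == e)) skew_coef e q u)%R.
Proof.
move=> dl wl en; rewrite (@avg_psi_sqr r n (n - e) e l q); [|by rewrite subnK|by []].
have da := decr_delta r.
rewrite (bigID (fun a => leV a l)) /= [X in (_ + X)%R]big1 ?addr0; last first.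
  move=> a /andP[/andP[dea /eqP wa] nal].
  rewrite /avg big1 ?mulr0 // => s _.
  rewrite (psi_kostka_eq0 (l := l) (a := a)) ?mul0r //; first by rewrite wl wa; lia.
  by move=> p; rewrite kostka_fillings // (negbTE nal).
have dg0 : (shape_of l `\` shape_of (delta r) = shape_of l)%fset by rewrite shape_of_delta fsetD0.
apply: (@big_seq_surj _ _ _ _ _ _ _ _ _ _ _ (fun a => shape_of l `\` shape_of a)%fset);
  rewrite ?uniq_vecs ?fset_uniq //.
- move=> a b; rewrite !mem_filter => /andP[/andP[/andP[ea _] al] _] /andP[/andP[/andP[eb _] bl] _].
  exact: shape_of_fsetD_inj.
- move=> a _ /andP[/andP[ea /eqP wa] al]; split.
  + by rewrite fpowersetE fsubsetDl.
  + rewrite -[X in filt X _]dg0 shape_of_filt ?decr_ge //=; apply/eqP/(@addIn (wt a)).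
    by rewrite card_shape_of // wl wa; lia.
  + rewrite (skew_coefE q (l := l) (a := a)) //; split=> //; last exact: giso_refl.
    by rewrite wl wa; lia.
- move=> u _ /andP[]; rewrite -{1}dg0 => fu /eqP cu.
  case: (filt_shape_of dl da (decr_ge dl) fu) => z [dz az zl eu]; exists z; split=> //.
    by apply: vecs_wt; rewrite ltnS leV_wt.
  rewrite dz zl andbT /=; apply/eqP.
  by have := card_shape_of dl dz zl; rewrite -eu cu wl; lia.
Qed.

(** * Polynomials in the numbers of removable connected shapes *)

Section MonomialEvaluation.
Variables (I : choiceType) (v : I -> rat).

Lemma cmonom_evalEw (D : {fset I}) (m : {cmonom I}) : (finsupp m `<=` D)%fset ->
  cmonom_eval v m = (\prod_(i <- D) v i ^+ m i)%R.
Proof.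
move=> mD; rewrite /cmonom_eval; apply/esym.
rewrite (big_fsetID _ (mem (finsupp m))) /= [X in (_ * X)%R]big1_fset ?mulr1.
  apply: eq_fbigl => i; rewrite !inE /=; have := fsubsetP mD i.
  by case: (i \in finsupp m) => [->|]; rewrite ?andbF.
by move=> i; rewrite !inE /= => /andP[_ /fsfun_dflt ->] _; rewrite expr0.
Qed.

Lemma cmonom_eval_mmorphism : mmorphism (cmonom_eval v).
Proof.
split=> [m1 m2|]; last by rewrite /cmonom_eval mdom1 big_seq_fset0.
rewrite (@cmonom_evalEw (finsupp m1 `|` finsupp m2)%fset m1) ?fsubsetUl //.
rewrite (@cmonom_evalEw (finsupp m1 `|` finsupp m2)%fset m2) ?fsubsetUr //.
rewrite (@cmonom_evalEw (finsupp m1 `|` finsupp m2)%fset (mmul m1 m2)).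
  by rewrite -big_split /=; apply: eq_bigr => i _; rewrite cmM exprD.
apply/fsubsetP=> i; rewrite in_fsetU -!cmE_neq0 cmM; by case: (m1 i); case: (m2 i).
Qed.

HB.instance Definition _ := isMultiplicative.Build _ _ _ cmonom_eval_mmorphism.

Lemma poly_evalD p q : poly_eval v (p + q)%R = (poly_eval v p + poly_eval v q)%R.
Proof. exact: mmapD. Qed.

Lemma poly_evalM p q : poly_eval v (p * q)%R = (poly_eval v p * poly_eval v q)%R.
Proof. exact: (rmorphM (mmap idfun (cmonom_eval v))). Qed.

Lemma poly_evalC c : poly_eval v (c%:MP)%R = c.
Proof. exact: mmapC. Qed.

Lemma poly_evalX i : poly_eval v (mkmalgU (ucm i) 1)%R = v i.
Proof.
rewrite /poly_eval mmapU mul1r /cmonom_eval mdomU big_seq_fset1.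
by rewrite cmUU expr1.
Qed.

End MonomialEvaluation.

(** Functions of [la] given by one polynomial, uniformly in the size of [la]. *)
Definition removable_poly (d : nat) (f : seq nat -> rat) : Prop :=
  exists k : {malg rat[{cmonom conn_class d}]}, forall la, is_part la ->
    f la = poly_eval (fun C : conn_class d => ((removable la (val C))%:R)%R) k.

Section RemovablePoly.
Variable d : nat.
Implicit Types f g : seq nat -> rat.

Lemma eq_removable_poly f g : (forall la, is_part la -> f la = g la) ->
  removable_poly d g -> removable_poly d f.
Proof. by move=> e [k h]; exists k => la pla; rewrite e // h. Qed.

Lemma removable_polyC c : removable_poly d (fun=> c).
Proof. by exists (c%:MP)%R => la _; rewrite poly_evalC. Qed.

Lemma removable_polyD f g : removable_poly d f -> removable_poly d g ->
  removable_poly d (fun la => f la + g la)%R.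
Proof. by move=> [p hp] [q hq]; exists (p + q)%R => la pla; rewrite hp // hq // poly_evalD. Qed.

Lemma removable_polyM f g : removable_poly d f -> removable_poly d g ->
  removable_poly d (fun la => f la * g la)%R.
Proof. by move=> [p hp] [q hq]; exists (p * q)%R => la pla; rewrite hp // hq // poly_evalM. Qed.

Lemma removable_poly_sum (J : Type) (s : seq J) (P : pred J) (F : J -> seq nat -> rat) :
  (forall j, P j -> removable_poly d (F j)) ->
  removable_poly d (fun la => \sum_(j <- s | P j) F j la)%R.
Proof.
move=> h; elim: s => [|j s IH].
  by apply: eq_removable_poly (removable_polyC 0%R) => la _; rewrite big_nil.
case Pj : (P j); last by apply: eq_removable_poly IH => la _; rewrite big_cons Pj.
apply: eq_removable_poly (removable_polyD (h j Pj) IH) => la _.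
by rewrite big_cons Pj.
Qed.

Lemma removable_polyX (C : conn_class d) :
  removable_poly d (fun la => (removable la (val C))%:R)%R.
Proof. by exists (mkmalgU (ucm C) 1)%R => la _; rewrite poly_evalX. Qed.

End RemovablePoly.

(** * Finitely many isomorphism classes of each size *)

Definition code_type e : finType := {ffun 'I_e * 'I_e -> bool * bool}.

(** The adjacency tables of [s] with respect to the enumeration of its squares.
    Tables range over a finite type, which bounds the number of isomorphism
    classes of a given size. *)
Definition code e (s : shape) : code_type e :=
  [ffun ij => let x := nth (0, 0) s (nat_of_ord ij.1) in
              let y := nth (0, 0) s (nat_of_ord ij.2) in (right_of x y, below x y)].

Lemma code_giso e (s t : shape) : #|` s| = e -> #|` t| = e -> code e s = code e t -> giso s t.
Proof.
move=> cs ct ec.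
have it x : x \in s -> index x s < size t.
  by rewrite -index_mem => xs; rewrite -[size t]/(#|` t|) ct -cs.
pose f x := nth (0, 0) t (index x s).
have fE x y : x \in s -> y \in s ->
    (right_of (f x) (f y), below (f x) (f y)) = (right_of x y, below x y).
  move=> xs ys.
  have ix : index x s < e by rewrite -cs index_mem.
  have iy : index y s < e by rewrite -cs index_mem.
  have := congr1 (fun c : code_type e => c (Ordinal ix, Ordinal iy)) ec.
  by rewrite !ffunE /= !nth_index // => ->.
exists f; split.
- move=> x y xs ys /eqP; rewrite /f nth_uniq ?it ?fset_uniq // => /eqP e'.
  by rewrite -(nth_index (0, 0) xs) e' nth_index.
- apply/fsetP=> y; apply/imfsetP/idP => [[x xs ->]|yt]; first by rewrite mem_nth ?it.
  have iy : index y t < size s by rewrite -[size s]/(#|` s|) cs -ct index_mem.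
  exists (nth (0, 0) s (index y t)); first by rewrite /= mem_nth.
  by rewrite /f index_uniq ?fset_uniq // nth_index.
- by move=> x y xs ys; case: (fE x y xs ys).
- by move=> x y xs ys; case: (fE x y xs ys).
Qed.

(** The codes of all the shapes isomorphic to [s]: a complete invariant with
    values in a finite type. *)
Definition iso_class e (s : shape) : {set code_type e} :=
  [set c | `[< exists t, [/\ #|` t| = e, giso s t & code e t = c] >]]%SET.

Lemma iso_classP e (s t : shape) : #|` s| = e -> #|` t| = e ->
  iso_class e s = iso_class e t <-> giso s t.
Proof.
move=> cs ct; split=> [e1|st].
  have : code e s \in iso_class e s.
    by rewrite finset.inE; apply/asboolP; exists s; split=> //; exact: giso_refl.
  rewrite e1 finset.inE => /asboolP[u [cu tu eu]].
  by apply: giso_sym; apply: giso_trans tu _; apply: code_giso eu.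
apply/setP=> c; rewrite !finset.inE; apply/asboolP/asboolP => -[u [cu su eu]]; exists u; split=> //.
  exact: giso_trans (giso_sym st) su.
exact: giso_trans st su.
Qed.

(** * Products of counts of removable shapes *)

Definition giso_invariant (N : shape -> rat) := forall s t, giso s t -> N s = N t.

Definition gisob (s t : shape) : bool := `[< giso s t >].

Lemma gisobP s t : reflect (giso s t) (gisob s t).
Proof. exact: asboolP. Qed.

Lemma gisob_invariant s : giso_invariant (fun t => (gisob s t)%:R)%R.
Proof.
move=> t u tu; congr ((nat_of_bool _)%:R)%R; apply/gisobP/gisobP => h.
  exact: giso_trans h tu.
exact: giso_trans h (giso_sym tu).
Qed.

Definition filt_sum (X : shape) (N : shape -> rat) (e : nat) : rat :=
  (\sum_(u <- fpowerset X | filt X u && (#|` u| == e)) N u)%R.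

Definition filt_count (X s : shape) : rat :=
  (\sum_(u <- fpowerset X | filt X u) (gisob s u)%:R)%R.

Lemma filt_countE X s : filt_count X s = filt_sum X (fun u => (gisob s u)%:R)%R #|` s|.
Proof.
rewrite /filt_count /filt_sum [RHS]big_mkcondr; apply: eq_bigr => u _.
by case: eqP => // n; case: gisobP => // /card_giso e; rewrite e in n.
Qed.

Lemma filt_sub (X u w : shape) : filt X u -> (w `<=` u)%fset -> filt X w = filt u w.
Proof.
move=> /filtP[uX hu] wu; have wX := fsubset_trans wu uX.
apply/filtP/filtP => -[_ h]; split=> // x y xw.
  by move=> yu; apply: h => //; exact: (fsubsetP uX).
move=> yX e; apply: (h x) => //; apply: hu yX e; exact: (fsubsetP wu).
Qed.

Lemma filtU X u w : filt X u -> filt X w -> filt X (u `|` w)%fset.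
Proof.
move=> /filtP[uX hu] /filtP[wX hw]; apply/filtP; split; first by rewrite fsubUset uX.
move=> x y; rewrite !in_fsetU => /orP[xu|xw] yX e; first by rewrite (hu x).
by rewrite (hw x) ?orbT.
Qed.

(** The structure constants of [filt_count_mul]. The two shapes may overlap. *)
Definition covers (s1 s2 u : shape) : rat :=
  (\sum_(u1 <- fpowerset u | filt u u1) \sum_(u2 <- fpowerset u | filt u u2)
     [&& gisob s1 u1, gisob s2 u2 & u1 `|` u2 == u]%fset%:R)%R.

Lemma covers_invariant s1 s2 : giso_invariant (covers s1 s2).
Proof.
move=> s t [f fst]; have [fi ft fr fb] := fst.
apply: (giso_by_sum fst) => u1 u1s; first by rewrite (filt_giso_eq fst).
move=> _; apply: (giso_by_sum fst) => u2 u2s; first by rewrite (filt_giso_eq fst).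
move=> _; congr ((nat_of_bool _)%:R)%R.
have inv (s0 u0 : shape) : (u0 `<=` s)%fset -> gisob s0 u0 = gisob s0 [fset f x | x in u0]%fset.
  move=> us; have g : giso u0 [fset f x | x in u0]%fset by exists f; apply: giso_by_sub fst.
  by apply/gisobP/gisobP => h; [exact: giso_trans h g|exact: giso_trans h (giso_sym g)].
rewrite -!inv //; congr [&& _, _ & _].
have -> : ([fset f x | x in u1] `|` [fset f x | x in u2])%fset =
          [fset f x | x in (u1 `|` u2)%fset]%fset.
  apply/fsetP=> y; rewrite in_fsetU; apply/orP/imfsetP => [[|] /imfsetP[x xu ->]|[x]].
  - by exists x; rewrite ?inE /= ?in_fsetU ?xu.
  - by exists x; rewrite ?inE /= ?in_fsetU ?xu ?orbT.
  - by rewrite /= in_fsetU => /orP[xu|xu] ->; [left|right]; rewrite in_imfset.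
have us : (u1 `|` u2 `<=` s)%fset by rewrite fsubUset u1s.
apply/eqP/eqP => [->//|e]; apply/eqP; rewrite eqEfsubset us /=; apply/fsubsetP=> x xs.
have : f x \in t by rewrite -ft in_imfset.
by rewrite -e => /imfsetP[y yu /fi ->] //; exact: (fsubsetP us).
Qed.

(** Sort the pairs of removable shapes by their union, which is again a filter;
    the filters of a filter [u] of [X] are the filters of [X] inside [u]. *)
Lemma filt_count_mul X s1 s2 :
  (filt_count X s1 * filt_count X s2 =
   \sum_(u <- fpowerset X | filt X u) covers s1 s2 u)%R.
Proof.
pose T u1 u2 u : rat := ([&& gisob s1 u1, gisob s2 u2 & u1 `|` u2 == u]%fset%:R)%R.
transitivity (\sum_(u <- fpowerset X | filt X u) \sum_(u1 <- fpowerset X | filt X u1)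
   \sum_(u2 <- fpowerset X | filt X u2) T u1 u2 u)%R; last first.
  rewrite big_seq_cond [RHS]big_seq_cond; apply: eq_bigr => u /andP[].
  rewrite fpowersetE => uX fu.
  have restr (F : shape -> rat) : (forall w, ~~ (w `<=` u)%fset -> F w = 0%R) ->
     (\sum_(w <- fpowerset X | filt X w) F w = \sum_(w <- fpowerset u | filt u w) F w)%R.
    move=> F0; rewrite (bigID (fun w => w `<=` u)%fset) /= [X in (_ + X)%R]big1 ?addr0; last first.
      by move=> w /andP[_ /F0].
    apply: (@big_seq_bij _ _ _ _ _ _ _ _ _ _ _ id id); rewrite ?fset_uniq // => w.
      by rewrite !fpowersetE => wX /andP[fw wu]; rewrite -(filt_sub fu wu).
    rewrite !fpowersetE => wu fw; rewrite (filt_sub fu wu) fw; split=> //.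
    exact: fsubset_trans wu uX.
  rewrite restr => [|w wu]; last first.
    rewrite big1 // => w' _; rewrite /T; case: eqP => [e|]; last by rewrite !andbF.
    by rewrite -e fsubsetUl in wu.
  apply: eq_bigr => u1 _; apply: restr => w wu.
  rewrite /T; case: eqP => [e|]; last by rewrite !andbF.
  by rewrite -e fsubsetUr in wu.
rewrite /filt_count big_distrlr /= [RHS]exchange_big /=.
rewrite big_seq_cond [RHS]big_seq_cond; apply: eq_bigr => u1 /andP[u1X f1].
rewrite [RHS]exchange_big /= big_seq_cond [RHS]big_seq_cond; apply: eq_bigr => u2 /andP[u2X f2].
rewrite [RHS]big_mkcond [RHS](bigD1_seq (u1 `|` u2)%fset) ?fset_uniq //=; last first.
  by rewrite fpowersetE; case/filtP: (filtU f1 f2).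
rewrite filtU // /T eqxx andbT big1 ?addr0 => [|u nu]; last first.
  by rewrite eq_sym (negbTE nu) !andbF; case: ifP.
by rewrite -natrM mulnb.
Qed.

Lemma covers_gt0 s s1 s2 : filt s s1 -> filt s s2 -> (s1 `|` s2 = s)%fset -> (0 < covers s1 s2 s)%R.
Proof.
move=> f1 f2 e; have s1s : (s1 `<=` s)%fset by case/filtP: f1.
have s2s : (s2 `<=` s)%fset by case/filtP: f2.
have g (t : shape) : gisob t t by apply/gisobP; exact: giso_refl.
rewrite /covers big_mkcond (bigD1_seq s1) ?fset_uniq ?fpowersetE //= f1.
rewrite big_mkcond (bigD1_seq s2) ?fset_uniq ?fpowersetE //= f2 !g e eqxx /=.
rewrite -addrA ltr_wpDr // addr_ge0 //; apply: sumr_ge0 => u _; case: ifP => // _.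
by apply: sumr_ge0.
Qed.

(** Two filters that do not meet have no edge between them, since an edge
    starting in a filter ends in it. So the two isomorphisms can be glued. *)
Lemma giso_glue s t s1 s2 t1 t2 : filt s s1 -> filt s s2 -> (s1 `|` s2 = s)%fset ->
  (s1 `&` s2 = fset0)%fset -> filt t t1 -> filt t t2 -> (t1 `|` t2 = t)%fset ->
  (t1 `&` t2 = fset0)%fset -> giso s1 t1 -> giso s2 t2 -> giso s t.
Proof.
move=> fs1 fs2 es ds ft1 ft2 et dt [f1 [i1 e1 r1 b1]] [f2 [i2 e2 r2 b2]].
pose f x := if x \in s1 then f1 x else f2 x.
have n12 x : x \in s1 -> x \notin s2.
  by move=> x1; apply/negP=> x2; have := in_fset0 x; rewrite -ds in_fsetI x1 x2.
have n12' x : x \in t1 -> x \notin t2.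
  by move=> x1; apply/negP=> x2; have := in_fset0 x; rewrite -dt in_fsetI x1 x2.
have fE1 x : x \in s1 -> f x = f1 x /\ f x \in t1 by rewrite /f => x1; rewrite x1 -e1 in_imfset.
have fE2 x : x \in s2 -> f x = f2 x /\ f x \in t2.
  by rewrite /f => x2; case: ifP => [/n12|_]; rewrite ?x2 // -e2 in_imfset.
have sE x : x \in s -> x \in s1 \/ x \in s2 by rewrite -es in_fsetU => /orP.
have noedge X X1 X2 x y : filt X X1 -> (forall z, z \in X1 -> z \notin X2) -> (X1 `|` X2 = X)%fset ->
   x \in X1 -> y \in X2 -> edge x y = false.
  move=> /filtP[_ h] n e x1 y2; apply/negP=> exy.
  have : y \in X1 by apply: (h x) => //; rewrite -e in_fsetU y2 orbT.
  by move/n; rewrite y2.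
have n21 x : x \in s2 -> x \notin s1 by move=> x2; apply/negP => /n12; rewrite x2.
have n21' x : x \in t2 -> x \notin t1 by move=> x2; apply/negP => /n12'; rewrite x2.
have es' : (s2 `|` s1 = s)%fset by rewrite fsetUC.
have et' : (t2 `|` t1 = t)%fset by rewrite fsetUC.
exists f; split.
- move=> x y /sE[x1|x2] /sE[y1|y2].
  + by have [-> _] := fE1 x x1; have [-> _] := fE1 y y1; apply: i1.
  + by have [_ h] := fE1 x x1; have [_ h'] := fE2 y y2 => e; move/n12': h; rewrite e h'.
  + by have [_ h] := fE2 x x2; have [_ h'] := fE1 y y1 => e; move/n21': h; rewrite e h'.
  + by have [-> _] := fE2 x x2; have [-> _] := fE2 y y2; apply: i2.
- apply/fsetP=> y; apply/imfsetP/idP => [[x /sE[x1|x2] ->]|].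
  + by rewrite -et in_fsetU; have [_ ->] := fE1 x x1.
  + by rewrite -et in_fsetU; have [_ ->] := fE2 x x2; rewrite orbT.
  + rewrite -et in_fsetU -{1}e1 -{1}e2 => /orP[] /imfsetP[x /= xi ->].
      by exists x; [rewrite /= -es in_fsetU xi|have [-> _] := fE1 x xi].
    by exists x; [rewrite /= -es in_fsetU xi orbT|have [-> _] := fE2 x xi].
- move=> x y /sE[x1|x2] /sE[y1|y2].
  + by have [-> _] := fE1 x x1; have [-> _] := fE1 y y1; apply: r1.
  + have [_ h] := fE1 x x1; have [_ h'] := fE2 y y2.
    have := noedge _ _ _ _ _ fs1 n12 es x1 y2; have := noedge _ _ _ _ _ ft1 n12' et h h'.
    by rewrite /edge => /norP[/negbTE -> _] /norP[/negbTE -> _].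
  + have [_ h] := fE2 x x2; have [_ h'] := fE1 y y1.
    have := noedge _ _ _ _ _ fs2 n21 es' x2 y1; have := noedge _ _ _ _ _ ft2 n21' et' h h'.
    by rewrite /edge => /norP[/negbTE -> _] /norP[/negbTE -> _].
  + by have [-> _] := fE2 x x2; have [-> _] := fE2 y y2; apply: r2.
- move=> x y /sE[x1|x2] /sE[y1|y2].
  + by have [-> _] := fE1 x x1; have [-> _] := fE1 y y1; apply: b1.
  + have [_ h] := fE1 x x1; have [_ h'] := fE2 y y2.
    have := noedge _ _ _ _ _ fs1 n12 es x1 y2; have := noedge _ _ _ _ _ ft1 n12' et h h'.
    by rewrite /edge => /norP[_ /negbTE ->] /norP[_ /negbTE ->].
  + have [_ h] := fE2 x x2; have [_ h'] := fE1 y y1.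
    have := noedge _ _ _ _ _ fs2 n21 es' x2 y1; have := noedge _ _ _ _ _ ft2 n21' et' h h'.
    by rewrite /edge => /norP[_ /negbTE ->] /norP[_ /negbTE ->].
  + by have [-> _] := fE2 x x2; have [-> _] := fE2 y y2; apply: b2.
Qed.

(** The union of two removable shapes has at most [#|` s|] squares. If it has
    exactly that many the two shapes are disjoint, and by [giso_glue] their
    union is isomorphic to [s]; the other terms involve smaller shapes only. *)
Lemma filt_count_decomp X s s1 s2 : filt s s1 -> filt s s2 ->
  (s1 `|` s2 = s)%fset -> (s1 `&` s2 = fset0)%fset ->
  (filt_count X s1 * filt_count X s2 =
   \sum_(e < #|` s|) filt_sum X (covers s1 s2) e + covers s1 s2 s * filt_count X s)%R.
Proof.
move=> f1 f2 es ds; pose N := covers s1 s2.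
have cs : #|` s| = (#|` s1| + #|` s2|)%N by rewrite -es cardfsU ds cardfs0 subn0.
have Nnz u : N u != 0%R -> exists u1 u2, [/\ filt u u1, filt u u2, giso s1 u1, giso s2 u2
    & (u1 `|` u2 = u)%fset].
  move=> nz; apply: contrapT => nex; case/eqP: nz; rewrite /N /covers big1 // => u1 h1.
  rewrite big1 // => u2 h2; apply/eqP; rewrite pnatr_eq0 eqb0; apply/negP.
  move=> /and3P[/gisobP g1 /gisobP g2 /eqP e]; apply: nex; by exists u1, u2.
have Nle u : N u != 0%R -> #|` u| <= #|` s|.
  case/Nnz=> u1 [u2 [_ _ g1 g2 <-]].
  by rewrite cs (card_giso g1) (card_giso g2) cardfsU leq_subr.
have Neq u : #|` u| = #|` s| -> N u = (N s * (gisob s u)%:R)%R.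
  move=> cu; case: gisobP => [g|ng]; first by rewrite mulr1; apply/esym/covers_invariant.
  rewrite mulr0; apply/eqP; apply: contrapT => /negP/Nnz[u1 [u2 [fu1 fu2 g1 g2 eu]]].
  apply: ng; apply: (giso_glue f1 f2 es ds fu1 fu2 eu _ g1 g2).
  apply/eqP; rewrite -cardfs_eq0; have := cardfsU u1 u2.
  have : #|` u1 `&` u2|%fset <= #|` u1| by apply: fsubset_leq_card; exact: fsubsetIl.
  by rewrite eu cu cs -(card_giso g1) -(card_giso g2); lia.
rewrite filt_count_mul -/N.
transitivity (\sum_(e < #|` s|.+1) filt_sum X N e)%R; last first.
  rewrite big_ord_recr /=; congr (_ + _)%R; rewrite filt_countE /filt_sum mulr_sumr.
  by apply: eq_bigr => u /andP[_ /eqP cu]; apply: Neq.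
rewrite /filt_sum; under [RHS]eq_bigr => e _ do rewrite big_mkcondr.
rewrite exchange_big /=; apply: eq_bigr => u _.
case: (ltnP #|` s| #|` u|) => [lt|le].
  rewrite big1 => [|e _]; last first.
    case: eqP => // eu; apply/eqP; apply: contraLR lt => /Nle.
    by rewrite -leqNgt.
  apply/eqP; apply: contraLR lt => /Nle.
  by rewrite -leqNgt.
rewrite (bigD1 (Ordinal (_ : #|` u| < #|` s|.+1))) //= eqxx big1 ?addr0 // => e ne.
by case: eqP => // eu; case/eqP: ne; apply/val_inj.
Qed.

(** * Connected shapes *)

Lemma adjacent_edge x y : adjacent x y = edge x y || edge y x.
Proof.
rewrite /adjacent /edge /right_of /below [y.1 == x.1]eq_sym [y.2 == x.2]eq_sym.
by case: (x.1 == y.1); case: (x.2 == y.2); case: (x.2 == y.2.+1); case: (y.2 == x.2.+1);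
  case: (x.1 == y.1.+1); case: (y.1 == x.1.+1).
Qed.

Lemma adjacent_sym x y : adjacent x y = adjacent y x.
Proof. by rewrite !adjacent_edge orbC. Qed.

Definition adj_closed (s A : shape) : Prop :=
  forall x y, x \in A -> y \in s -> adjacent x y -> y \in A.

Lemma connected_closed s A : is_connected s -> (A `<=` s)%fset -> A != fset0 ->
  adj_closed s A -> A = s.
Proof.
case=> _ cs As /fset0Pn[x xA] clA; apply/eqP; rewrite eqEfsubset As /=.
apply/fsubsetP=> y ys; have xs := fsubsetP As x xA.
have := cs [` xs]%fset [` ys]%fset; rewrite /linked => cxy.
have clP : closed (fun x y : s => adjacent (val x) (val y)) [pred z : s | val z \in A].
  move=> z w /= zw; apply/idP/idP => h; first exact: clA h (valP w) zw.
  by apply: clA h (valP z) _; rewrite adjacent_sym.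
by have := closed_connect clP cxy; rewrite !inE /= xA => <-.
Qed.

Lemma mem_component (s : shape) (x : s) y :
  (y \in component x) = [exists z : s, (val z == y) && linked x z].
Proof.
apply/imfsetP/existsP => [[z /= + ->]|[z /andP[/eqP <- h]]].
  by rewrite inE => h; exists z; rewrite eqxx.
by exists z.
Qed.

Lemma component_sub (s : shape) (x : s) : (component x `<=` s)%fset.
Proof. by apply/fsubsetP=> y; rewrite mem_component => /existsP[z /andP[/eqP <- _]]; exact: valP. Qed.

Lemma component_refl (s : shape) (x : s) : val x \in component x.
Proof. by rewrite mem_component; apply/existsP; exists x; rewrite eqxx /linked connect0. Qed.

Lemma component_closed (s : shape) (x : s) : adj_closed s (component x).
Proof.
move=> y z; rewrite mem_component => /existsP[y' /andP[/eqP <- xy]] zs yz.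
rewrite mem_component; apply/existsP; exists [` zs]%fset; rewrite eqxx /=.
by apply: connect_trans xy (connect1 _).
Qed.

Lemma closed_filt s A : (A `<=` s)%fset -> adj_closed s A -> filt s A.
Proof.
move=> As clA; apply/filtP; split=> // x y xA ys e; apply: clA xA ys _.
by rewrite adjacent_edge e.
Qed.

Lemma closed_fsetD s A : (A `<=` s)%fset -> adj_closed s A -> adj_closed s (s `\` A)%fset.
Proof.
move=> As clA x y; rewrite !in_fsetD => /andP[xA xs] ys xy; rewrite ys andbT.
by apply: contra xA => yA; apply: clA yA xs _; rewrite adjacent_sym.
Qed.

(** A connected component and its complement are closed under adjacency in both
    directions, so both are filters. *)
Lemma disconnected_split s : s != fset0 -> ~ is_connected s ->
  exists s1 s2, [/\ filt s s1, filt s s2, (s1 `|` s2 = s)%fset, (s1 `&` s2 = fset0)%fset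
    & (#|` s1| < #|` s|) && (#|` s2| < #|` s|)].
Proof.
move=> s0 nc.
have [x [y nxy]] : exists x y : s, ~~ linked x y.
  apply: contrapT => nex; apply: nc; split=> // x y; apply/negPn/negP => nxy.
  by apply: nex; exists x, y.
pose A := component x; have As := component_sub x; have cA := component_closed (x := x).
have yA : val y \notin A.
  apply/negP; rewrite mem_component => /existsP[z /andP[/eqP/val_inj -> h]].
  by rewrite h in nxy.
exists A, (s `\` A)%fset; split.
- exact: closed_filt.
- by apply: closed_filt; [exact: fsubsetDl|exact: closed_fsetD].
- by apply/fsetP=> z; rewrite in_fsetU in_fsetD; have := fsubsetP As z; case: (z \in A) => // ->.
- by apply/fsetP=> z; rewrite in_fsetI in_fsetD in_fset0; case: (z \in A); rewrite ?andbF.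
apply/andP; split.
  by apply: fproper_ltn_card; rewrite fproperE As /=; apply/fsubsetPn; exists (val y) => //; exact: valP.
apply: fproper_ltn_card; rewrite fproperE fsubsetDl /=; apply/fsubsetPn.
exists (val x); first exact: valP.
by rewrite in_fsetD component_refl.
Qed.

Lemma component_connected (s : shape) (x : s) : is_connected s -> component x = s.
Proof.
move=> cs; apply: connected_closed => //; first exact: component_sub.
  by apply/fset0Pn; exists (val x); exact: component_refl.
exact: component_closed.
Qed.

Lemma giso_by_adjacent f s t x y : giso_by f s t -> x \in s -> y \in s ->
  adjacent (f x) (f y) = adjacent x y.
Proof. by move=> fst xs ys; rewrite !adjacent_edge !(giso_by_edge fst). Qed.

(** The preimage of a component is closed under adjacency, so it is all of the
    connected shape [s]. *)
Lemma giso_component (s t : shape) (z : t) : is_connected s -> giso s t -> component z = t.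
Proof.
move=> cs [f fst]; have [fi ft _ _] := fst.
apply/eqP; rewrite eqEfsubset component_sub /=.
pose A := [fset x in s | f x \in component z]%fset.
have eA : A = s.
  apply: connected_closed => //.
  - by apply/fsubsetP=> x; rewrite !inE /= => /andP[].
  - have /imfsetP[x /= xs ex] : val z \in [fset f x | x in s]%fset by rewrite ft; exact: valP.
    apply/fset0Pn; exists x; by rewrite !inE /= xs -ex component_refl.
  - move=> x y; rewrite !inE /= => /andP[xs fx] ys xy; rewrite ys /=.
    have fyt : f y \in t by rewrite -ft in_imfset.
    by apply: component_closed fx fyt _; rewrite (giso_by_adjacent fst).
apply/fsubsetP=> y yt; have : y \in [fset f x | x in s]%fset by rewrite ft.
case/imfsetP=> x /= xs ->.
by move: xs; rewrite -{1}eA !inE => /andP[].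
Qed.


(** The squares that are moved by the same vector as a fixed square [x0] are
    closed under adjacency. *)
Lemma giso_translate s t : is_connected s -> giso s t -> translate s t.
Proof.
move=> cs [f fst]; have [fi ft fr fb] := fst.
have [/fset0Pn[x0 x0s] _] := cs.
pose v : int * int := ((f x0).1%:Z - x0.1%:Z, (f x0).2%:Z - x0.2%:Z)%R.
pose A := [fset x in s | ((f x).1%:Z == x.1%:Z + v.1)%R && ((f x).2%:Z == x.2%:Z + v.2)%R]%fset.
have eA : A = s.
  apply: connected_closed => //.
  - by apply/fsubsetP=> x; rewrite !inE /= => /andP[].
  - apply/fset0Pn; exists x0; rewrite !inE /= x0s /=; apply/andP; split; apply/eqP; rewrite /v /=; lia.
  - move=> x y; rewrite !inE /= => /and3P[xs /eqP e1 /eqP e2] ys.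
    rewrite ys /= adjacent_edge => /orP[] /orP[] h.
    + have := fr x y xs ys; move: (h); rewrite /right_of => /andP[/eqP h1 /eqP h2].
      rewrite -/(right_of x y) h => /andP[/eqP h1' /eqP h2'].
      by apply/andP; split; apply/eqP; lia.
    + have := fb x y xs ys; move: (h); rewrite /below => /andP[/eqP h1 /eqP h2].
      rewrite -/(below x y) h => /andP[/eqP h1' /eqP h2'].
      by apply/andP; split; apply/eqP; lia.
    + have := fr y x ys xs; move: (h); rewrite /right_of => /andP[/eqP h1 /eqP h2].
      rewrite -/(right_of y x) h => /andP[/eqP h1' /eqP h2'].
      by apply/andP; split; apply/eqP; lia.
    + have := fb y x ys xs; move: (h); rewrite /below => /andP[/eqP h1 /eqP h2].
      rewrite -/(below y x) h => /andP[/eqP h1' /eqP h2'].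
      by apply/andP; split; apply/eqP; lia.
have fv x : x \in s -> ((f x).1%:Z = x.1%:Z + v.1)%R /\ ((f x).2%:Z = x.2%:Z + v.2)%R.
  by rewrite -{1}eA !inE => /and3P[_ /eqP -> /eqP ->].
exists v; apply/fsetP=> p; apply/imfsetP/imfsetP => -[x /= xs ->].
  exists (f x); first by rewrite /= -ft in_imfset.
  by have [-> ->] := fv x xs; rewrite !addr0.
move: xs; rewrite -{1}ft => /imfsetP[y /= ys ->]; exists y => //.
by have [-> ->] := fv y ys; rewrite !addr0.
Qed.

Lemma translate_giso s t : translate s t -> giso s t.
Proof.
case=> v ev.
pose f (x : nat * nat) : nat * nat := (`|(x.1%:Z + v.1)%R|%N, `|(x.2%:Z + v.2)%R|%N).
have fv x : x \in s -> ((f x).1%:Z = x.1%:Z + v.1)%R /\ ((f x).2%:Z = x.2%:Z + v.2)%R /\ f x \in t.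
  move=> xs; have : (x.1%:Z + v.1, x.2%:Z + v.2)%R \in shift v s.
    by apply/imfsetP; exists x.
  rewrite ev => /imfsetP[y /= yt [e1 e2]]; rewrite !addr0 in e1 e2.
  have fy : f x = y by rewrite /f e1 e2 !absz_nat; case: (y).
  by rewrite fy e1 e2.
clearbody f; exists f; split.
- move=> [x1 x2] [y1 y2] xs ys; have [+ [+ _]] := fv _ xs; have [+ [+ _]] := fv _ ys => /= .
  by move=> h1 h2 h3 h4 e; rewrite e in h3 h4; congr (_, _); lia.
- apply/fsetP=> y; apply/imfsetP/idP => [[x /= xs ->]|yt]; first by case: (fv x xs) => _ [].
  have : (y.1%:Z + 0, y.2%:Z + 0)%R \in shift (0, 0)%R t by apply/imfsetP; exists y.
  rewrite -ev => /imfsetP[x /= xs [e1 e2]]; exists x => //.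
  have [h1 [h2 _]] := fv x xs; rewrite !addr0 in e1 e2.
  by case: y yt e1 e2 => y1 y2 /= _ e1 e2; case: (f x) h1 h2 => a b /= h1 h2; congr (_, _); lia.
- move=> x y /fv[h1 [h2 _]] /fv[h3 [h4 _]]; rewrite /right_of.
  case: x y (f x) (f y) h1 h2 h3 h4 => [x1 x2] [y1 y2] [a b] [c d] /= h1 h2 h3 h4.
  by congr (_ && _); apply/eqP/eqP => e; lia.
- move=> x y /fv[h1 [h2 _]] /fv[h3 [h4 _]]; rewrite /below.
  case: x y (f x) (f y) h1 h2 h3 h4 => [x1 x2] [y1 y2] [a b] [c d] /= h1 h2 h3 h4.
  by congr (_ && _); apply/eqP/eqP => e; lia.
Qed.

Lemma components_connected (s : shape) : is_connected s -> components s = [set s]%classic.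
Proof.
move=> cs; apply/seteqP; split=> [c [x _ <-]|c ->]; first exact: component_connected.
by case: (cs) => /fset0Pn[x xs] _; exists [` xs]%fset => //; exact: component_connected.
Qed.

(** A connected shape is its own only component, so that both notions say that
    [t] is a translate of [s]. *)
Lemma skew_iso_giso s t : is_connected s -> skew_iso s t <-> giso s t.
Proof.
move=> cs; rewrite /skew_iso components_connected //; split.
  case=> f [[ff _ fsurj] ft].
  have [z _ ez] : components t (f s) by exact: ff.
  suff -> : t = f s by apply: translate_giso; apply: ft.
  apply/eqP; rewrite eqEfsubset -ez component_sub andbT; apply/fsubsetP=> y yt.
  have [c ->] : (f @` [set s])%classic (component [` yt]%fset) by apply: fsurj; exists [` yt]%fset.
  by move=> e; rewrite ez e; exact: (component_refl [` yt]%fset).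
move=> g; exists (fun=> t).
have ct : components t = [set t]%classic.
  apply/seteqP; split=> [c [x _ <-]|c ->]; first exact: giso_component g.
  have : t != fset0 by rewrite -cardfs_eq0 -(card_giso g) cardfs_eq0; case: cs.
  by move/fset0Pn=> [x xt]; exists [` xt]%fset => //; exact: giso_component g.
rewrite ct; split; last by move=> c ->; exact: giso_translate.
split=> //.
- by move=> x y; rewrite !inE => -> ->.
- by move=> c ->; exists s.
Qed.

(** * Removable diagrams as filters *)

Lemma anti_part la r : is_part la -> anti r (nth 0 la).
Proof. by move=> pla i _; apply: part_nth_anti. Qed.

Lemma rdiag0 r : rdiag r (fun=> 0) = fset0.
Proof.
by apply/fsetP=> -[i j]; rewrite mem_rdiag in_fset0; case: j => [|j]; rewrite !andbF.
Qed.

Lemma part_nth_neq0 la i : is_part la -> (nth 0 la i != 0) = (i < size la).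
Proof.
case/andP=> _ n0; case: (ltnP i (size la)) => h; last by rewrite nth_default.
by apply: contra n0 => /eqP <-; exact: mem_nth.
Qed.

Lemma eq_part la mu : is_part la -> is_part mu -> nth 0 la =1 nth 0 mu -> la = mu.
Proof.
move=> pla pmu e.
have lt i : (i < size la) = (i < size mu) by rewrite -!part_nth_neq0 // e.
apply: (@eq_from_nth _ 0) => [|i _]; last exact: e.
case: (ltngtP (size la) (size mu)) => // h.
  by have := lt (size la); rewrite ltnn h.
by have := lt (size mu); rewrite ltnn h.
Qed.

Lemma diagram_inj la mu : is_part la -> is_part mu -> diagram la = diagram mu -> la = mu.
Proof.
move=> pla pmu; pose r := maxn (size la) (size mu).
rewrite (diagram_rdiag (r := r)) ?leq_maxl // (diagram_rdiag (r := r) (la := mu)) ?leq_maxr //.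
move/rdiag_inj => e; apply: eq_part => // i; case: (ltnP i r) => ir; first exact: e.
by rewrite !nth_default //; apply: leq_trans ir; rewrite ?leq_maxl ?leq_maxr.
Qed.

Lemma diagram_sub_part la al : is_part la -> is_part al -> (diagram al `<=` diagram la)%fset ->
  size al <= size la /\ forall i, nth 0 al i <= nth 0 la i.
Proof.
move=> pla pal; pose r := maxn (size la) (size al).
rewrite (diagram_rdiag (r := r)) ?leq_maxr // (diagram_rdiag (r := r) (la := la)) ?leq_maxl //.
rewrite rdiag_sub => /forallP h.
have le i : nth 0 al i <= nth 0 la i.
  case: (ltnP i r) => ir; first exact: (h (Ordinal ir)).
  by rewrite [nth 0 al i]nth_default //; apply: leq_trans ir; rewrite leq_maxr.
split=> //; rewrite leqNgt; apply/negP=> lt.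
have := le (size la); rewrite [leqRHS]nth_default // leqn0.
by apply/negP; rewrite part_nth_neq0.
Qed.

Lemma part_of_rows r h : anti r h -> exists al, [/\ is_part al, size al <= r
  & forall i, i < r -> nth 0 al i = h i].
Proof.
move=> ha; pose P i := h i.-1 != 0; pose k := count P (iota 1 r).
have hP i : 0 < i <= r -> P i = (i <= k).
  apply: (@count_initial P r) => j /andP[j0 jr]; rewrite /P /= -!lt0n => h0.
  by apply: leq_trans h0 _; rewrite -{1}(prednK j0); apply: ha; rewrite prednK.
have kr : k <= r by rewrite -[leqRHS](size_iota 1) count_size.
exists (mkseq h k); split; rewrite ?size_mkseq //.
  apply/andP; split.
    apply/(sortedP 0) => i; rewrite size_mkseq => ik; rewrite !nth_mkseq ?(ltnW ik) //.
    by apply: ha; exact: leq_trans ik kr.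
  apply/mapP=> -[i]; rewrite mem_iota add0n => /= ik e.
  by have := hP i.+1; rewrite /P /= ik (leq_trans ik kr) -e => /(_ isT).
move=> i ir; case: (ltnP i k) => ik; first by rewrite nth_mkseq.
rewrite nth_default ?size_mkseq //; have := hP i.+1 ir; rewrite [i < k]ltnNge ik /P /=.
by move/negbFE/eqP.
Qed.

Lemma skew_diagram_filt la al : is_part la -> is_part al -> (diagram al `<=` diagram la)%fset ->
  filt (diagram la) (skew_diagram la al).
Proof.
move=> pla pal sub; have [sal hle] := diagram_sub_part pla pal sub.
rewrite /skew_diagram (diagram_rdiag sal) (diagram_rdiag (leqnn (size la))).
have := @rows_filt (size la) (nth 0 la) (fun=> 0) (nth 0 al) (anti_part pal).
by rewrite rdiag0 fsetD0; apply=> i _.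
Qed.

Lemma filt_skew_diagram la u : is_part la -> filt (diagram la) u ->
  exists al, [/\ is_part al, (diagram al `<=` diagram la)%fset & skew_diagram la al = u].
Proof.
move=> pla; rewrite (diagram_rdiag (leqnn (size la))) => fu.
have := @filt_rows (size la) (nth 0 la) (fun=> 0) (anti_part pla) (fun _ _ => isT) (fun _ _ => isT) u.
rewrite rdiag0 fsetD0 => /(_ fu)[h [ha _ hf eu]].
have [al [pal sal eal]] := part_of_rows ha.
have da : diagram al = rdiag (size la) h.
  by rewrite (diagram_rdiag sal); apply: eq_rdiag.
exists al; rewrite /skew_diagram da; split=> //.
by rewrite rdiag_sub; apply/forallP=> i; exact: hf.
Qed.

(** Partitions inside [la] correspond to filters of its diagram through
    [skew_diagram], which [removable] counts through bounded sequences. *)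
Lemma removableE la (D : set shape) : is_part la ->
  removable la D = \sum_(u <- fpowerset (diagram la) | filt (diagram la) u) `[< D u >].
Proof.
move=> pla.
pose val_seq (a : {bseq size la of 'I_(head 0 la).+1}) := [seq nat_of_ord x | x <- a].
pose ok a := [&& is_part (val_seq a), (diagram (val_seq a) `<=` diagram la)%fset
        & `[< D (skew_diagram la (val_seq a)) >] ].
rewrite /removable -sum1_card (eq_bigl ok) => [|a]; last by rewrite finset.inE.
transitivity (\sum_(u <- fpowerset (diagram la) | filt (diagram la) u && `[< D u >]) 1); last first.
  by rewrite big_mkcondr; apply: eq_bigr => u _; case: asboolP.
apply: (@big_seq_surj _ _ _ _ _ _ _ _ _ _ _ (fun a => skew_diagram la (val_seq a)));
  rewrite ?index_enum_uniq ?fset_uniq //.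
- move=> a b; rewrite !mem_filter => /andP[/and3P[pa sa _] _] /andP[/and3P[pb sb _] _] e.
  have : diagram (val_seq a) = diagram (val_seq b).
    by rewrite -(fsetDK sa) -(fsetDK sb) -/(skew_diagram la _) e.
  by move/(diagram_inj pa pb)/(inj_map val_inj)/val_inj.
- move=> a _ /and3P[pa sa Da]; have fa := skew_diagram_filt pla pa sa.
  by rewrite fpowersetE fa Da; split=> //; case/filtP: fa.
- move=> u _ /andP[fu Du]; case: (filt_skew_diagram pla fu) => al [pal sal eu].
  have [sz le] := diagram_sub_part pla pal sal.
  have all_lt : all (fun x => x < (head 0 la).+1) al.
    apply/(all_nthP 0) => i _; rewrite ltnS -nth0; apply: leq_trans (le i) _.
    exact: part_nth_anti.
  pose s : seq 'I_(head 0 la).+1 := [seq inord x | x <- al].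
  have es : [seq nat_of_ord x | x <- s] = al.
    rewrite /s -map_comp map_id_in // => x xal /=; rewrite inordK //; exact: (allP all_lt).
  have ss : size s <= size la by rewrite size_map.
  exists (Bseq ss); rewrite mem_index_enum; split=> //=.
    by rewrite /ok /val_seq /= es pal sal eu.
  by rewrite /val_seq /= es.
Qed.

Lemma is_skew_filt la u : is_part la -> filt (diagram la) u -> Defs.is_skew u.
Proof.
move=> pla fu; have [al [pal sal <-]] := filt_skew_diagram pla fu.
by exists la, al.
Qed.

(** For a connected shape [s] the count is the value of the variable attached to
    the class of [s]. *)
Lemma filt_count_connected d mu s : is_part mu -> filt (diagram mu) s -> is_connected s ->
  #|` s| <= d -> removable_poly d (fun la => filt_count (diagram la) s).
Proof.
move=> pmu fs cs sd.
have s0 : 0 < #|` s| by rewrite lt0n cardfs_eq0; case: cs.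
have hC : `[< is_conn_class d (diagram_class_of s) >].
  by apply/asboolP; exists s; split; rewrite ?s0 //; exact: is_skew_filt fs.
pose C : conn_class d := exist _ (diagram_class_of s) hC.
apply: eq_removable_poly (removable_polyX C) => la pla.
rewrite /= removableE // natr_sum; apply: eq_big => // u fu.
congr ((nat_of_bool _)%:R)%R; apply/gisobP/asboolP => [g|[_ /(skew_iso_giso _ cs)]] //.
by split; [exact: is_skew_filt fu|apply/skew_iso_giso].
Qed.

(** * Reduction to connected shapes *)

(** By induction on the size [e]. As [N] is constant on the finitely many classes
    of size [e], it is enough to treat the counts of single shapes. The empty
    shape counts 1, a connected shape is a variable, and a disconnected one is
    solved for in [filt_count_decomp], whose leading coefficient is positive. *)
Lemma filt_sum_poly d e N : e <= d -> giso_invariant N ->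
  removable_poly d (fun la => filt_sum (diagram la) N e).
Proof.
have [m] := ubnP e; elim: m e N => // m IH e N; rewrite ltnS => em ed iN.
have count_poly mu s : is_part mu -> filt (diagram mu) s -> #|` s| = e ->
    removable_poly d (fun la => filt_count (diagram la) s).
  move=> pmu fs ce.
  have [s_empty|s_n0] := eqVneq s fset0.
    apply: eq_removable_poly (removable_polyC d 1%R) => la pla.
    rewrite filt_countE s_empty cardfs0 /filt_sum big_mkcond (bigD1_seq fset0) ?fset_uniq ?fpowersetE ?fsub0set //.
    rewrite cardfs0 eqxx andbT (_ : filt _ _); last by apply/filtP; split; rewrite ?fsub0set.
    rewrite (_ : gisob _ _); last by apply/gisobP/giso_refl.
    by rewrite big1 ?addr0 // => u u0; rewrite cardfs_eq0 (negbTE u0) andbF.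
  have [cs|ncs] := pselect (is_connected s).
    by apply: filt_count_connected pmu fs cs _; rewrite ce.
  have [s1 [s2 [f1 f2 es ds /andP[c1 c2]]]] := disconnected_split s_n0 ncs.
  have lt_e k : k < #|` s| -> k < m /\ k <= d.
    by rewrite ce => ke; split; [exact: leq_trans ke em|exact: leq_trans (ltnW ke) ed].
  have cnt t : #|` t| < #|` s| -> removable_poly d (fun la => filt_count (diagram la) t).
    case/lt_e=> tm td; apply: eq_removable_poly (IH _ _ tm td (gisob_invariant t)) => la _.
    exact: filt_countE.
  pose c := covers s1 s2 s; have c0 : (c != 0)%R by rewrite gt_eqF // covers_gt0.
  pose S la := (\sum_(k < #|` s|) filt_sum (diagram la) (covers s1 s2) k)%R.
  have hS : removable_poly d S.
    apply: removable_poly_sum => k _; have [km kd] := lt_e k (ltn_ord k).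
    exact: IH (covers_invariant s1 s2).
  apply: (@eq_removable_poly _ _ (fun la => c^-1 *
     (filt_count (diagram la) s1 * filt_count (diagram la) s2 + (-1) * S la))%R).
    move=> la _; rewrite (filt_count_decomp _ f1 f2 es ds) -/c -/(S la) mulN1r.
    by rewrite addrAC subrr add0r mulKf.
  apply: removable_polyM; first exact: removable_polyC.
  apply: removable_polyD; first by apply: removable_polyM; exact: cnt.
  by apply: removable_polyM => //; exact: removable_polyC.
apply: (@eq_removable_poly _ _ (fun la => \sum_(K : {set code_type e})
  \sum_(u <- fpowerset (diagram la) | filt (diagram la) u && (#|` u| == e) &&
     (iso_class e u == K)) N u)%R).
  by move=> la _; rewrite /filt_sum (partition_big (iso_class e) predT).
apply: removable_poly_sum => K _.
have [[mu [s [pmu fs ce eK]]]|nK] := pselect (exists mu s, [/\ is_part mu, filt (diagram mu) s,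
   #|` s| = e & iso_class e s = K]).
  apply: (@eq_removable_poly _ _ (fun la => N s * filt_count (diagram la) s)%R).
    move=> la _; rewrite filt_countE ce /filt_sum mulr_sumr big_mkcondr; apply: eq_bigr => u.
    move=> /andP[_ /eqP cu]; rewrite -eK; case: eqP => [/(iso_classP cu ce) us|nus].
      rewrite (_ : gisob s u) ?mulr1; first exact: iN.
      by apply/gisobP/giso_sym.
    case: gisobP => [su|_]; last by rewrite mulr0.
    by case: nus; apply/(iso_classP cu ce)/giso_sym.
  by apply: removable_polyM; [exact: removable_polyC|exact: count_poly fs ce].
apply: eq_removable_poly (removable_polyC d 0%R) => la pla.
rewrite big1 // => u /andP[/andP[fu /eqP cu] /eqP eK].
by case: nK; exists la, u.
Qed.

(** * Kronecker coefficients *)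

Section FirstRow.
Variables (d : nat) (nubar : seq nat).
Hypothesis nubar_part : is_part_of d nubar.
Local Notation m := (size nubar).

Definition first_row (n : nat) (i : nat) : nat :=
  if i is i'.+1 then nth 0 nubar i' else n - d.

Lemma nubar_is_part : is_part nubar. Proof. by case/andP: nubar_part. Qed.
Lemma sumn_nubar : sumn nubar = d. Proof. by case/andP: nubar_part => _ /eqP. Qed.

(** When [n - d = 0] the hypothesis on [n] leaves only the empty partition. *)
Lemma add_first_row_part n : d + head 0 nubar <= n ->
  [/\ is_part_of n (add_first_row n d nubar), size (add_first_row n d nubar) <= m.+1
    & nth 0 (add_first_row n d nubar) =1 first_row n].
Proof.
move=> dn; have /andP[so n0] := nubar_is_part; have sd := sumn_nubar.
have dn' : d <= n by apply: leq_trans dn; exact: leq_addr.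
rewrite /add_first_row; case: eqP => [nd|/eqP nd].
  have nn : n = d by apply/eqP; rewrite eqn_leq dn' andbT -subn_eq0 nd.
  have nub : nubar = [::].
    move: n0 dn; rewrite nn -[leqRHS]addn0 leq_add2l leqn0.
    by case: (nubar) => //= a s /[swap] /eqP ->; rewrite inE eqxx.
  have d0 : d = 0 by rewrite -sd nub.
  rewrite nub nn d0; split=> // -[|i]; first by rewrite /first_row d0.
  by rewrite /first_row ?nub !nth_nil.
split=> //; last by case.
apply/andP; split; last by rewrite /= sd subnK.
apply/andP; split; last by rewrite inE negb_or eq_sym nd.
rewrite /=; move: so dn; case: (nubar) => //= a s -> h; rewrite andbT; lia.
Qed.

(** The term of [w] in the Jacobi-Trudi expansion of [(n - d, nubar)] has no
    negative part. The first part never becomes negative, since [delta] is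
    largest in position 0; the condition therefore does not involve [n]. *)
Definition shift_ok (w : 'S_m.+1) : bool :=
  [forall i : 'I_m, delta m.+1 (w (lift ord0 i)) <= nth 0 nubar i + delta m.+1 (lift ord0 i)].

(** The parts of that term below the first one; they do not involve [n]
    either. *)
Definition shift_parts (w : 'S_m.+1) : seq nat :=
  [seq nth 0 nubar (nat_of_ord i) + delta m.+1 (lift ord0 i) - delta m.+1 (w (lift ord0 i))
     | i <- enum 'I_m].

Lemma sumn_shift_parts w : shift_ok w ->
  sumn (shift_parts w) + delta m.+1 ord0 = d + delta m.+1 (w ord0).
Proof.
move=> /forallP ok; rewrite -sumn_nubar.
have e : sumn (shift_parts w) + \sum_(i : 'I_m) delta m.+1 (w (lift ord0 i)) =
         sumn nubar + \sum_(i : 'I_m) delta m.+1 (lift ord0 i).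
  rewrite sumnE big_map big_enum /= -big_split /= [sumn nubar]sumnE (big_nth 0) big_mkord.
  by rewrite -big_split /=; apply: eq_bigr => i _; rewrite subnK.
have wd : \sum_i delta m.+1 (w i) = \sum_i delta m.+1 i.
  by rewrite [RHS](reindex_perm w).
rewrite !big_ord_recl in wd; move: e wd; set a := \sum_(i < m) _; set b := \sum_(i < m) _; lia.
Qed.

Lemma seqV_first_row n w : d <= n -> shift_ok w ->
  seqV (subV (ofrow m.+1 (first_row n)) (permV w (delta m.+1))) =
  (n - sumn (shift_parts w)) :: shift_parts w.
Proof.
move=> dn ok; rewrite /seqV enum_ordSl /= -map_comp; congr (_ :: _).
  have := sumn_shift_parts ok; rewrite !ffunE /=.
  by have := ltn_ord (w ord0); move: (nat_of_ord _) (sumn _) dn => W S; lia.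
by apply: eq_map => i; rewrite /= !ffunE.
Qed.

Lemma leV_first_row n w :
  leV (permV w (delta m.+1)) (ofrow m.+1 (first_row n)) = shift_ok w.
Proof.
apply/forallP/forallP => h i; first by have := h (lift ord0 i); rewrite !ffunE.
case: (unliftP ord0 i) => [j ->|->]; first by have := h j; rewrite !ffunE.
by rewrite !ffunE /=; have := ltn_ord (w ord0); lia.
Qed.

(** The value of the Kronecker coefficient; it depends on [n] through [la]
    only. *)
Definition kron_sum (la : seq nat) : rat :=
  (\sum_(w : 'S_m.+1 | shift_ok w) sgn w *
     filt_sum (diagram la) (skew_coef (sumn (shift_parts w)) (shift_parts w))
       (sumn (shift_parts w)))%R.

Lemma shift_parts_le w : shift_ok w -> sumn (shift_parts w) <= d.
Proof.
move=> ok; have := sumn_shift_parts ok; rewrite !ffunE /=.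
by have := ltn_ord (w ord0); lia.
Qed.

Lemma kron_sum_poly : removable_poly d kron_sum.
Proof.
apply: removable_poly_sum => w ok; apply: removable_polyM; first exact: removable_polyC.
by apply: filt_sum_poly; [exact: shift_parts_le|move=> s t; exact: skew_coef_giso].
Qed.

Lemma kroneckerE n la : d + head 0 nubar <= n -> is_part_of n la ->
  kronecker n la la (add_first_row n d nubar) = ratr (kron_sum la).
Proof.
move=> dn pla; have [pnu snu enu] := add_first_row_part dn.
have dn' : d <= n by apply: leq_trans dn; exact: leq_addr.
pose r := size la; pose l := ofrow r (nth 0 la).
pose y := ofrow m.+1 (first_row n).
have la1 : is_part la by case/andP: pla.
have ey : ofrow m.+1 (nth 0 (add_first_row n d nubar)) = y.
  by apply/ffunP=> i; rewrite !ffunE enu.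
rewrite /kronecker (@cfdot_avg n _ _ (fun s => psi l (delta r) s * psi l (delta r) s)%R
   (psi y (delta m.+1))); first last.
- by move=> s; rewrite (sym_charE pnu snu) ey.
- by move=> s; rewrite cfunE (sym_charE pla (leqnn _)) rmorphM.
congr ratr.
have dl : decr l by exact: decr_la pla.
have wl : wt l = n + wt (delta r) by exact: wt_la pla (leqnn _).
have el : shape_of l = diagram la.
  by rewrite (diagram_rdiag (leqnn r)); apply: eq_rdiag => i ir; rewrite row_ofrow.
pose T w (s : 'S_n) := (sgn w * (psi l (delta r) s * psi l (delta r) s *
  (phiD y (permV w (delta m.+1)) s)%:R))%R.
rewrite (eq_avg (g := fun s => \sum_w T w s)%R) => [|s]; last first.
  by rewrite /(psi y) mulr_sumr; apply: eq_bigr => w _; rewrite /T mulrCA.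
rewrite avg_sum /kron_sum [RHS]big_mkcond /=; apply: eq_bigr => w _.
rewrite /T avgZ /phiD leV_first_row; case ok : (shift_ok w); last first.
  by rewrite /avg [X in (_ * (_ * X))%R]big1 ?mulr0 // => s _; rewrite mulr0.
congr (_ * _)%R.
have le_n : sumn (shift_parts w) <= n by exact: leq_trans (shift_parts_le ok) dn'.
rewrite -el /filt_sum -(avg_psi_sqr_shapes _ dl wl le_n); apply: eq_avg => s.
by rewrite phi_seqV seqV_first_row.
Qed.

End FirstRow.

Theorem theorem7p2 (d : nat) (nubar : seq nat) (nubar_part : is_part_of d nubar) :
  exists k : {malg rat[{cmonom conn_class d}]},
  forall (n : nat) (la : seq nat),
    (d + head 0 nubar <= n)%N -> is_part_of n la ->
    kronecker n la la (add_first_row n d nubar) =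
    ratr (poly_eval (fun C : conn_class d => ((removable la (val C))%:R)%R) k).
Proof.
have [k hk] := kron_sum_poly nubar_part; exists k => n la dn pla.
by rewrite kroneckerE // hk //; case/andP: pla.
Qed.
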